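(* Let $\alpha<\beta$, $\Omega:=(\alpha,\beta)$, $p\in(0,1)$, $b\in C(\overline\Omega)$, $0\le c\in L^\infty(\Omega)$, and $Lu:=-u''+b(x)u'+c(x)u$. Let $m\in L^2(\Omega)$ be a function that changes sign in $\Omega$ and suppose there exist $\alpha\le x_0<x_1\le\beta$ such that $0\not\equiv m\ge0$ in $I:=(x_0,x_1)$. Let $C_p:=\dfrac{2(1+p)}{(1-p)^2}$, and for $x\in\overline\Omega$ let $$\overline B_\alpha(x):=e^{\int_\alpha^x b(r)\,dr},\qquad \underline B_\alpha(x):=e^{-\int_\alpha^x b(r)\,dr}.$$ (i) Let $\gamma_b:=\max\left\{\|\overline B_\alpha\|_{L^1(\alpha,x_1)},\;\|\overline B_\alpha\|_{L^1(x_0,\beta)}\right\}$. If $m^-\in L^\infty(\Omega)$ and $$0<\frac{\left(\gamma_b\|\underline B_\alpha\|_{L^\infty(\Omega)}\right)^2}{C_p-\|c\|_{L^\infty(\Omega)}\left(\gamma_b\|\underline B_\alpha\|_{L^\infty(\Omega)}\right)^2}\,\|m^-\|_{L^\infty(\Omega)}\le\frac1{\lambda_1(m,I)},$$ then there exists a solution $u\in W^{2,2}(\Omega)$ of $$Lu=m u^p\text{ in }\Omega,\qquad u>0\text{ in }\Omega,\qquad u=0\text{ on }\partial\Omega.\quad(\ast)$$ (ii) Let $$\mathcal M:=\max\left\{\int_{x_0}^\beta\overline B_\alpha(x)\,\|m^-\underline B_\alpha\|_{L^1(x,\beta)}\,dx,\;\int_\alpha^{x_1}\overline B_\alpha(x)\,\|m^-\underline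 B_\alpha\|_{L^1(\alpha,x)}\,dx\right\}.$$ If $c\equiv0$ and $$(1-p)\,\mathcal M<\frac1{\lambda_1(m,I)},$$ then there exists a solution $u\in W^{2,2}(\Omega)$ of $(\ast)$.
   Context: $m^+=\max(m,0)$ and $m^-=\max(-m,0)$; ''$m$ changes sign in $\Omega$'' means that neither $m^+$ nor $m^-$ vanishes a.e. in $\Omega$. A solution of $(\ast)$ is a function $u\in W^{2,2}(\Omega)\cap W^{1,2}_0(\Omega)$ with $u(x)>0$ for all $x\in\Omega$ satisfying the equation for a.e. $x\in\Omega$. For an interval $I$, $\lambda_1(m,I)$ denotes the positive principal eigenvalue of $L$ with weight $m$ in $I$, i.e. the unique $\lambda>0$ for which there is $\varphi\in W^{2,2}(I)\cap W^{1,2}_0(I)$ with $\varphi>0$ in $I$ and $L\varphi=\lambda m\varphi$ a.e. in $I$. *)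

(* Defs.v *)
From HB Require Import structures.
From mathcomp Require Import all_boot all_order all_algebra.
From mathcomp Require Import all_classical all_reals all_analysis.

Set Implicit Arguments.
Unset Strict Implicit.
Unset Printing Implicit Defensive.
Import Order.TTheory GRing.Theory Num.Theory.
Import numFieldNormedType.Exports.

Local Open Scope classical_set_scope.
Local Open Scope ring_scope.

(* Functions on an interval are total functions R -> R; values outside the
   interval are irrelevant, since f \_ D replaces them by 0. *)

Definition inLp (R : realType) (q : \bar R) (D : set R) (f : R -> R) : Prop :=
  f \_ D \in Lfun (@lebesgue_measure R) q.

(* Meaningful when inLp q D f holds: fine sends an infinite norm to 0. *)
Definition Lpnorm (R : realType) (q : \bar R) (D : set R) (f : R -> R) : R :=
  fine ('N[@lebesgue_measure R]_q[EFin \o (f \_ D)])%E.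

Definition supp (R : realType) (f : R -> R) : set R :=
  closure [set x | f x != 0].

(* C^1_c(]a, b[), each function being extended by 0 to R. As is usual in
   dimension one, these are the test functions for Sobolev spaces. *)
Definition test_function (R : realType) (a b : R) (f : R -> R) : Prop :=
  [/\ forall x : R, derivable f x 1, continuous (derive1 f),
      compact (supp f) & supp f `<=` `]a, b[%classic].

Definition weak_derivative (R : realType) (a b : R) (u u1 : R -> R) : Prop :=
  forall f : R -> R, test_function a b f ->
    \int[@lebesgue_measure R]_(x in `]a, b[) (u x * derive1 f x) =
    - \int[@lebesgue_measure R]_(x in `]a, b[) (u1 x * f x).

(* u is in W^{1,2}(]a, b[), with u' = u1. *)
Definition sobolev12 (R : realType) (a b : R) (u u1 : R -> R) : Prop :=
  [/\ inLp 2%:E `]a, b[ u, inLp 2%:E `]a, b[ u1 & weak_derivative a b u u1].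

(* u is in W^{2,2}(]a, b[), with u' = u1 and u'' = u2. *)
Definition sobolev22 (R : realType) (a b : R) (u u1 u2 : R -> R) : Prop :=
  sobolev12 a b u u1 /\ sobolev12 a b u1 u2.

(* W^{1,2}_0(]a, b[): the closure of the test functions in W^{1,2}(]a, b[). *)
Definition sobolev120 (R : realType) (a b : R) (u u1 : R -> R) : Prop :=
  sobolev12 a b u u1 /\
  forall e : R, 0 < e -> exists2 f : R -> R, test_function a b f &
    Lpnorm 2%:E `]a, b[ (u \- f) + Lpnorm 2%:E `]a, b[ (u1 \- derive1 f) < e.

(* u belongs to W^{2,2} and W^{1,2}_0 of ]a, b[, is the continuous
   representative of its class on [a, b], is positive on ]a, b[, and satisfies
   - u'' + b0 u' + c u = rhs (x, u(x)) for a.e. x in ]a, b[. *)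
Definition positive_dirichlet_solution (R : realType) (a b : R)
    (b0 c : R -> R) (rhs : R -> R -> R) (u : R -> R) : Prop :=
  exists u1 u2 : R -> R,
    [/\ sobolev22 a b u u1 u2,
        sobolev120 a b u u1,
        {within `[a, b], continuous u},
        forall x : R, x \in `]a, b[ -> 0 < u x &
        {ae @lebesgue_measure R, forall x : R, x \in `]a, b[ ->
           - u2 x + b0 x * u1 x + c x * u x = rhs x (u x)}].

Definition is_solution (R : realType) (a b : R) (b0 c m : R -> R) (p : R)
    (u : R -> R) : Prop :=
  positive_dirichlet_solution a b b0 c (fun x v => m x * v `^ p) u.

Definition principal_eigenvalue (R : realType) (a b : R) (b0 c m : R -> R)
    (lam : R) : Prop :=
  0 < lam /\ exists phi : R -> R,
    positive_dirichlet_solution a b b0 c (fun x v => lam * m x * v) phi.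

(* The default 0 is taken only if there is no principal eigenvalue. *)
Definition lambda1 (R : realType) (a b : R) (b0 c m : R -> R) : R :=
  xget 0 [set lam | principal_eigenvalue a b b0 c m lam].

Definition changes_sign (R : realType) (a b : R) (m : R -> R) : Prop :=
  ~ {ae @lebesgue_measure R, forall x : R, x \in `]a, b[ -> m^\+ x = 0} /\
  ~ {ae @lebesgue_measure R, forall x : R, x \in `]a, b[ -> m^\- x = 0}.

Definition Bover (R : realType) (a : R) (b0 : R -> R) (x : R) : R :=
  expR (\int[@lebesgue_measure R]_(r in `[a, x]) b0 r).

Definition Bunder (R : realType) (a : R) (b0 : R -> R) (x : R) : R :=
  expR (- \int[@lebesgue_measure R]_(r in `[a, x]) b0 r).

Definition Cp (R : realType) (p : R) : R := 2 * (1 + p) / (1 - p) ^+ 2.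

Definition gammab (R : realType) (alpha beta x0 x1 : R) (b0 : R -> R) : R :=
  Num.max (Lpnorm 1%E `]alpha, x1[ (Bover alpha b0))
          (Lpnorm 1%E `]x0, beta[ (Bover alpha b0)).

Definition calM (R : realType) (alpha beta x0 x1 : R) (b0 m : R -> R) : R :=
  Num.max
    (\int[@lebesgue_measure R]_(x in `]x0, beta[)
       (Bover alpha b0 x *
        Lpnorm 1%E `]x, beta[ (fun y => m^\- y * Bunder alpha b0 y)))
    (\int[@lebesgue_measure R]_(x in `]alpha, x1[)
       (Bover alpha b0 x *
        Lpnorm 1%E `]alpha, x[ (fun y => m^\- y * Bunder alpha b0 y))).

(* Main.v *)
Require Import Defs.
From mathcomp Require Import all_boot all_order all_algebra.
From mathcomp Require Import all_classical all_reals all_analysis.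
From mathcomp Require Import measurable_realfun ess_sup_inf ring lra.
Set Implicit Arguments.
Unset Strict Implicit.
Unset Printing Implicit Defensive.
Import Order.TTheory GRing.Theory Num.Theory.
Import numFieldNormedType.Exports.
Local Open Scope classical_set_scope.
Local Open Scope ring_scope.

(** Multiplied by q = Bunder = 1 / Bover, the equation L u = m u^p reads
    - (q u')' = P u^p - N u^p - C u with P = q m^+, N = q m^- and C = q c.  In
    the coordinate S = scale, the primitive of Bover = 1 / q, the left hand side
    is a second derivative, with an explicit Green operator Green.  A solution
    is found above a subsolution psi that is positive in ]a, b[, and the
    hypotheses serve to construct psi.

    From psi to a solution (solution_above_subsolution).  A large constant is a
    supersolution because p < 1.  From it a monotone iteration descends: the
    source P u^p is evaluated at the preceding iterate, while the absorption
    C u + N u^p, made Lipschitz near u = 0, stays implicit.  Each step is a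
    monotone equation, solved by continuation in its absorption (solvable1).
    All iterates stay above psi, hence their limit is positive, where the
    truncation of the power disappears.  The limit is u = Green f with f in L^2,
    and Green_sobolev recovers the weak derivatives of u.

    Subsolutions are meant in a local sense, touched_below, that allows to take
    maxima.  The comparison of such a subsolution with a Green potential,
    Green_ge_subsolution, rests on minimum_principle, which is
    stated with second differences along S, so that no derivative is needed.

    The subsolution.  In ]x0, x1[, where m >= 0, it is the eigenfunction phi for
    lambda1, scaled to have the maximum lambda1^(- 1 / (1 - p)); up to this
    height lambda1 phi <= phi^p.  Its boundary values are those of the continuous
    representative (sobolev120_trace) and its equation holds in integrated form
    (du_bois_reymond, dirichlet_solution_represents).  To the left and to the
    right of its maximum point, phi is continued by barriers uL and uR which
    vanish at a and at b, and are below phi at the maximum point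
    (patch_subsolution).  The barriers are subsolutions because they are powers
    of functions T which are affine in S or convex in S:
    - under a bound on the norm of m^-, multiples of T^(2 / (1 - p)) with T = S or
      T = S b - S, for which both - (q u')' and N u^p are comparable with
      T^(2 p / (1 - p)) (touched_below_linear_power);
    - under the integral condition, T^(1 / (1 - p)) with (q T')' slightly larger
      than (1 - p) N (touched_below_power).
    In both cases the hypothesis on lambda1 says that the barriers are below the
    maximum of phi; it also gives 1 / lambda1 > 0, so that lambda1 is indeed an
    eigenvalue. *)

(** * Integrals over a segment *)

Notation seg_integrable c d f :=
  ((@lebesgue_measure _).-integrable `[c, d]%classic (EFin \o f)) (only parsing).

Definition segint (R : realType) (c d : R) (f : R -> R) : R :=
  \int[@lebesgue_measure R]_(y in `[c, d]) f y.

Section SegInt.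
Context {R : realType}.
Implicit Types (c d x : R) (f g h : R -> R).
Local Notation mu := (@lebesgue_measure R).

Lemma ae_imp (P Q : R -> Prop) : {ae mu, forall x, P x} ->
  (forall x, P x -> Q x) -> {ae mu, forall x, Q x}.
Proof.
have FF := ae_filter_ringOfSetsType (@lebesgue_measure R).
by move=> aeP PQ; move: aeP; apply: filterS => x; exact: PQ.
Qed.

Lemma ae_imp2 (P Q T : R -> Prop) : {ae mu, forall x, P x} ->
  {ae mu, forall x, Q x} -> (forall x, P x -> Q x -> T x) ->
  {ae mu, forall x, T x}.
Proof.
have FF := ae_filter_ringOfSetsType (@lebesgue_measure R).
by move=> aeP aeQ PQ; move: aeP aeQ; apply: filterS2 => x; exact: PQ.
Qed.

Lemma seg_measurable_fun c d f : seg_integrable c d f -> measurable_fun `[c, d] f.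
Proof. by move=> /(measurable_int mu)/measurable_EFinP. Qed.

Lemma seg_integrableS c d c' d' f : c <= c' -> d' <= d ->
  seg_integrable c d f -> seg_integrable c' d' f.
Proof.
move=> cc dd; apply: integrableS => //.
by apply: subset_itv; rewrite bnd_simp.
Qed.

Lemma eq_seg_integrable c d f g : {in `[c, d], f =1 g} ->
  seg_integrable c d f -> seg_integrable c d g.
Proof.
move=> fg; apply: eq_integrable => // x; rewrite inE /= => xcd.
by rewrite fg.
Qed.

Lemma seg_integrableD c d f g : seg_integrable c d f -> seg_integrable c d g ->
  seg_integrable c d (fun x => f x + g x).
Proof.
move=> f1 g1; rewrite (_ : EFin \o _ = (EFin \o f) \+ (EFin \o g))%E//.
exact: integrableD.
Qed.

Lemma seg_integrableB c d f g : seg_integrable c d f -> seg_integrable c d g ->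
  seg_integrable c d (fun x => f x - g x).
Proof.
move=> f1 g1; rewrite (_ : EFin \o _ = (EFin \o f) \- (EFin \o g))%E//.
exact: integrableB.
Qed.

Lemma seg_integrableZ c d k f : seg_integrable c d f ->
  seg_integrable c d (fun x => k * f x).
Proof.
move=> f1; rewrite (_ : EFin \o _ = (fun x => k%:E * (EFin \o f) x))%E//.
exact: integrableZl.
Qed.

Lemma seg_integrableN c d f : seg_integrable c d f ->
  seg_integrable c d (fun x => - f x).
Proof.
move=> f1; apply: (@eq_seg_integrable _ _ (fun x => -1 * f x)).
  by move=> x _; rewrite mulN1r.
exact: seg_integrableZ.
Qed.

Lemma seg_integrable_norm c d f : seg_integrable c d f ->
  seg_integrable c d (fun x => `|f x|).
Proof. by move=> /integrable_norm. Qed.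

Lemma seg_integrable_le c d f g : measurable_fun `[c, d] f ->
  (forall x, x \in `[c, d] -> `|f x| <= g x) ->
  seg_integrable c d g -> seg_integrable c d f.
Proof.
move=> mf fg; apply: le_integrable => //; first exact/measurable_EFinP.
move=> x /= xcd; rewrite lee_fin (le_trans (fg x xcd))//; exact: ler_norm.
Qed.

Lemma seg_continuous_measurable c d f : {within `[c, d], continuous f} ->
  measurable_fun `[c, d] f.
Proof. by move=> cf; exact: subspace_continuous_measurable_fun. Qed.

Lemma seg_continuous_bounded c d f : {within `[c, d], continuous f} ->
  exists2 M, 0 <= M & forall x, x \in `[c, d] -> `|f x| <= M.
Proof.
move=> cf; have [cd|dc] := leP c d; last first.
  exists 0 => // x; rewrite in_itv /= => /andP[cx xd].
  by have := le_lt_trans (le_trans cx xd) dc; rewrite ltxx.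
have cnf : {within `[c, d], continuous (fun x => `|f x|)}.
  by move=> x; apply: continuous_comp; [exact: cf|exact: norm_continuous].
have [x xcd Hx] := EVT_max cd cnf.
by exists `|f x|.
Qed.

Lemma seg_continuous_integrable c d f : {within `[c, d], continuous f} ->
  seg_integrable c d f.
Proof. by move=> cf; apply: continuous_compact_integrable => //; exact: segment_compact. Qed.

Lemma seg_integrable_mulb c d M f g : measurable_fun `[c, d] g ->
  (forall x, x \in `[c, d] -> `|g x| <= M) ->
  seg_integrable c d f -> seg_integrable c d (fun x => g x * f x).
Proof.
move=> mg gM fi.
apply: (@seg_integrable_le _ _ _ (fun x => M * `|f x|)).
- by apply: measurable_funM => //; exact: seg_measurable_fun.
- by move=> x xcd; rewrite normrM ler_wpM2r// gM.
- exact/seg_integrableZ/seg_integrable_norm.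
Qed.

Lemma seg_integrable_mulc c d f g : {within `[c, d], continuous g} ->
  seg_integrable c d f -> seg_integrable c d (fun x => g x * f x).
Proof.
move=> cg fi; have [M _ gM] := seg_continuous_bounded cg.
by apply: seg_integrable_mulb fi; [exact: seg_continuous_measurable|exact: gM].
Qed.

Lemma eq_segint c d f g : {in `[c, d], f =1 g} -> segint c d f = segint c d g.
Proof. by move=> fg; apply: eq_Rintegral => x; rewrite inE /= => /fg. Qed.

Lemma segint_oo c d f : seg_integrable c d f ->
  \int[mu]_(y in `]c, d[) f y = segint c d f.
Proof.
move=> fi; rewrite /segint.
rewrite Rintegral_itv_bndo_bndc ?Rintegral_itv_obnd_cbnd//.
- apply: integrableS fi => //; apply: subset_itv; rewrite bnd_simp//.
- apply: integrableS fi => //; apply: subset_itv; rewrite bnd_simp//.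
Qed.

Lemma segint_ae_eq c d f g : measurable_fun `[c, d] f -> measurable_fun `[c, d] g ->
  {ae mu, forall x, x \in `]c, d[ -> f x = g x} -> segint c d f = segint c d g.
Proof.
move=> mf mg fg; rewrite /segint /Rintegral.
congr fine.
have soc : [set` `]c, d[] `<=` [set` `[c, d]].
  by apply: subset_itv; rewrite bnd_simp.
rewrite (@integral_itv_bndoo R c d (EFin \o f) true false); last first.
  by apply/measurable_EFinP; apply: measurable_funS mf.
rewrite (@integral_itv_bndoo R c d (EFin \o g) true false); last first.
  by apply/measurable_EFinP; apply: measurable_funS mg.
apply: ae_eq_integral => //.
- by apply/measurable_EFinP; apply: measurable_funS mf.
- by apply/measurable_EFinP; apply: measurable_funS mg.
by apply: (ae_imp fg) => x H xcd; rewrite /= H.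
Qed.

Lemma segint_split c x d f : c <= x <= d -> seg_integrable c d f ->
  segint c d f = segint c x f + segint x d f.
Proof.
move=> /andP[cx xd] fi.
have fi1 : seg_integrable x d f by exact: seg_integrableS fi.
rewrite /segint -(@Rintegral_itv_obnd_cbnd R x (BRight d) f); last first.
  by apply: integrableS fi1 => //; apply: subset_itv; rewrite bnd_simp.
rewrite -(@Rintegral_itvB R f (BLeft c) (BRight d) x) ?bnd_simp//.
by rewrite addrC subrK.
Qed.

Lemma segint_xx c f : segint c c f = 0.
Proof. by rewrite /segint set_itv1 Rintegral_set1. Qed.

Lemma segint_gt c d f : d < c -> segint c d f = 0.
Proof. by move=> dc; rewrite /segint set_itv_ge ?Rintegral_set0// bnd_simp -ltNge. Qed.

Lemma segintD c d f g : seg_integrable c d f -> seg_integrable c d g ->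
  segint c d (fun x => f x + g x) = segint c d f + segint c d g.
Proof. by move=> f1 g1; rewrite /segint RintegralD. Qed.

Lemma segintB c d f g : seg_integrable c d f -> seg_integrable c d g ->
  segint c d (fun x => f x - g x) = segint c d f - segint c d g.
Proof. by move=> f1 g1; rewrite /segint RintegralB. Qed.

Lemma segintZ c d k f : seg_integrable c d f ->
  segint c d (fun x => k * f x) = k * segint c d f.
Proof. by move=> f1; rewrite /segint RintegralZl. Qed.

Lemma segintN c d f : seg_integrable c d f ->
  segint c d (fun x => - f x) = - segint c d f.
Proof.
move=> f1; rewrite -mulN1r -segintZ//; apply: eq_segint => x _; exact/esym/mulN1r.
Qed.

Lemma segint_cst c d k : c <= d -> segint c d (fun=> k) = k * (d - c).
Proof.
move=> cd; rewrite /segint Rintegral_cst//= lebesgue_measure_itv/= lte_fin.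
by case: ltgtP cd => //= -> _; rewrite subrr.
Qed.

Lemma segint_ge0 c d f : (forall x, x \in `[c, d] -> 0 <= f x) -> 0 <= segint c d f.
Proof. by move=> f0; apply: Rintegral_ge0 => x /= /f0. Qed.

Lemma segint_ae_le c d f g : seg_integrable c d f -> seg_integrable c d g ->
  {ae mu, forall x, x \in `]c, d[ -> f x <= g x} ->
  segint c d f <= segint c d g.
Proof.
move=> fi gi fg.
have mg := seg_measurable_fun gi; have mf := seg_measurable_fun fi.
have -> : segint c d g = segint c d (fun x => Num.max (f x) (g x)).
  apply: segint_ae_eq => //; first exact: measurable_maxr.
  by apply: (ae_imp fg) => x /[apply] h; rewrite (max_idPr h).
apply: le_Rintegral => //; last by move=> x _; rewrite le_max lexx.
apply: (@seg_integrable_le _ _ _ (fun x => `|f x| + `|g x|)).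
- exact: measurable_maxr.
- move=> x _ /=; case: (leP (f x) (g x)) => _; rewrite ?lerDl ?lerDr ?normr_ge0//.
- by apply: seg_integrableD; exact: seg_integrable_norm.
Qed.

Lemma segint_le c d f g : seg_integrable c d f -> seg_integrable c d g ->
  (forall x, x \in `[c, d] -> f x <= g x) -> segint c d f <= segint c d g.
Proof. by move=> fi gi fg; apply: le_Rintegral => // x /= /fg. Qed.

Lemma segint_norm c d f : seg_integrable c d f ->
  `|segint c d f| <= segint c d (fun x => `|f x|).
Proof. by move=> fi; apply: le_normr_Rintegral. Qed.

Lemma segint_subset_le c d c' d' f : c <= c' -> d' <= d ->
  (forall x, x \in `[c, d] -> 0 <= f x) -> seg_integrable c d f ->
  segint c' d' f <= segint c d f.
Proof.
move=> cc dd f0 fi; have [cd'|cd'] := leP c' d'; last first.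
  by rewrite segint_gt// segint_ge0.
rewrite (segint_split (x := c') _ fi) ?cc ?(le_trans cd')//.
have fi' : seg_integrable c' d f by exact: seg_integrableS fi.
rewrite (segint_split (x := d') _ fi') ?cd'//.
rewrite addrCA lerDl addr_ge0// segint_ge0// => x xcd; apply: f0;
 move: xcd; rewrite !in_itv /= => /andP[] a b; apply/andP; split; lra.
Qed.

(** The end points are left out because the cutoff functions used below converge
    to 1 in the interior only. *)
Lemma segint_dct c d (F : nat -> R -> R) f g :
  (forall n, measurable_fun `[c, d] (F n)) -> measurable_fun `[c, d] f ->
  (forall x, x \in `]c, d[ -> F ^~ x @ \oo --> f x) ->
  seg_integrable c d g ->
  (forall n x, x \in `]c, d[ -> `|F n x| <= g x) ->
  (fun n => segint c d (F n)) @ \oo --> segint c d f.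
Proof.
move=> mF mf Ff gi Fg.
have soc : [set` `]c, d[] `<=` [set` `[c, d]] by apply: subset_itv; rewrite bnd_simp.
have gi' : mu.-integrable `]c, d[ (EFin \o g) by apply: integrableS gi.
have ooE h : measurable_fun `[c, d] h ->
    segint c d h = fine (\int[mu]_(x in `]c, d[) (h x)%:E)%E.
  move=> mh; rewrite /segint /Rintegral (@integral_itv_bndoo R c d _ true false)//.
  by apply/measurable_EFinP; apply: measurable_funS mh.
have mEF n : measurable_fun `]c, d[ (EFin \o F n).
  by apply/measurable_EFinP; apply: measurable_funS (mF n).
have mEf : measurable_fun `]c, d[ (EFin \o f).
  by apply/measurable_EFinP; apply: measurable_funS mf.
have [] := @dominated_convergence _ _ _ mu `]c, d[ (measurable_itv _)
  (fun n => EFin \o F n) (EFin \o f) (EFin \o g) mEF mEf _ gi'.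
- apply: aeW => x /= xcd.
  by apply: cvg_EFin; [exact: nearW|exact: Ff].
- by apply: aeW => x /= n xcd; rewrite lee_fin; exact: Fg.
move=> fi' _ h; rewrite ooE//.
rewrite (_ : (fun n => segint c d (F n)) =
  (fun n => fine (\int[mu]_(x in `]c, d[) (F n x)%:E)%E)); last first.
  by apply/funext => n; exact: ooE.
apply: fine_cvg; rewrite fineK//; exact: integrable_fin_num.
Qed.

Lemma segint_FTC2 c d f (F : R -> R) : c <= d -> {within `[c, d], continuous f} ->
  {within `[c, d], continuous F} ->
  (forall x : R, x \in `]c, d[ -> is_derive x (1 : R) F (f x)) ->
  segint c d f = F d - F c.
Proof.
rewrite le_eqVlt => /predU1P[<- _ _ _|cd cf cF dF]; first by rewrite segint_xx subrr.
rewrite /segint /Rintegral (@continuous_FTC2 R f F c d cd cf) //.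
  move/(continuous_within_itvP _ cd) : cF => [? ? ?]; split => // x xcd.
  by have [] := dF x xcd.
by move=> x xcd; rewrite derive1E; have [_ ->] := dF x xcd.
Qed.

Lemma segint_continuous c d f : c <= d -> seg_integrable c d f ->
  {within `[c, d], continuous (fun x => segint c x f)}.
Proof. exact: parameterized_integral_continuous. Qed.

End SegInt.

Section Triangle.
Context {R : realType}.
Local Notation mu := (@lebesgue_measure R).

Lemma EFin_Rintegral (D : set R) (f : R -> R) : measurable D ->
  mu.-integrable D (EFin \o f) ->
  (\int[mu]_(x in D) (f x)%:E)%E = (\int[mu]_(x in D) f x)%:E.
Proof. by move=> mD fi; rewrite /Rintegral fineK//; exact: integrable_fin_num. Qed.

(** Both sides integrate f t * h y over the triangle c <= y <= t <= d. *)
Lemma segint_triangle (c d : R) (f h : R -> R) :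
  seg_integrable c d f -> seg_integrable c d h ->
  segint c d (fun t => f t * segint c t h) =
  segint c d (fun y => h y * segint y d f).
Proof.
move=> fi hi.
pose D := [set` `[c, d]].
have mD : measurable D by exact: measurable_itv.
pose ft := f \_ D; pose ht := h \_ D.
have fti : mu.-integrable setT (EFin \o ft).
  by rewrite /ft -restrict_EFin; exact: (@integrable_mkcond _ _ R mu D (EFin \o f) mD).1.
have hti : mu.-integrable setT (EFin \o ht).
  by rewrite /ht -restrict_EFin; exact: (@integrable_mkcond _ _ R mu D (EFin \o h) mD).1.
have mft : measurable_fun setT ft by apply/measurable_EFinP; exact: measurable_int fti.
have mht : measurable_fun setT ht by apply/measurable_EFinP; exact: measurable_int hti.
pose Phi (z : R * R) := ft z.1 * ht z.2 * (z.2 <= z.1)%R%:R.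
have mPhi : measurable_fun setT Phi.
  apply: measurable_funM.
    by apply: measurable_funM; [exact: measurableT_comp mft _|exact: measurableT_comp mht _].
  have -> : (fun z : R * R => (z.2 <= z.1)%R%:R : R) =
            (fun z => if z.2 <= z.1 then 1 else 0).
    by apply/funext => z; case: ifP.
  by apply: measurable_fun_ifT => //; exact: measurable_fun_ler.
have Phii : (mu \x mu)%E.-integrable setT (EFin \o Phi).
  apply/integrable12ltyP; first exact/measurable_EFinP.
  apply: (@le_lt_trans _ _ (\int[mu]_x \int[mu]_y (`|ft x| * `|ht y|)%:E)%E).
    apply: ge0_le_integral => //.
    - by move=> x _; exact: integral_ge0.
    - apply: (@measurable_fun_fubini_tonelli_F _ _ _ _ R mu (fun z => `|(Phi z)%:E|%E)) => //.
      by apply: measurableT_comp => //; exact/measurable_EFinP.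
    - apply: (@measurable_fun_fubini_tonelli_F _ _ _ _ R mu (fun z => (`|ft z.1| * `|ht z.2|)%:E)) => //.
      apply/measurable_EFinP; apply: measurable_funM; apply: measurableT_comp => //;
        exact: measurableT_comp.
    move=> x _; apply: ge0_le_integral => //.
    - apply: measurableT_comp => //; apply/measurable_EFinP.
      exact: (measurableT_comp mPhi).
    - by apply/measurable_EFinP; apply: measurable_funM => //; exact: measurableT_comp.
    move=> y _; rewrite lee_fin /Phi /= !normrM ler_piMr ?mulr_ge0//.
    by rewrite normr_nat lern1 leq_b1.
  have hnn : (\int[mu]_y `|ht y|%:E)%E \is a fin_num.
    by apply: integrable_fin_num => //; exact: integrable_norm.
  have inner x : (\int[mu]_y (`|ft x| * `|ht y|)%:E =
      `|ft x|%:E * \int[mu]_y `|ht y|%:E)%E.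
    by rewrite -ge0_integralZl//; apply/measurable_EFinP; exact: measurableT_comp.
  under eq_integral do rewrite inner.
  rewrite ge0_integralZr//; first last.
  - exact: integral_ge0.
  - by apply/measurable_EFinP; exact: measurableT_comp.
  rewrite lte_mul_pinfty// ?integral_ge0// ?ltry//.
    by apply: integrable_fin_num => //; exact: integrable_norm.
  by rewrite -ge0_fin_numE// integral_ge0.
have := Fubini Phii.
have memD x : (x \in D) = (c <= x <= d) by rewrite mem_setE in_itv.
have -> : (\int[mu]_x \int[mu]_y (EFin \o Phi) (x, y))%E =
  (\int[mu]_x ((fun t => (f t * segint c t h)%:E) \_ D) x)%E.
  apply: eq_integral => t _; rewrite patchE memD.
  case: ifP => [/andP[ct td]|/negP ntD]; last first.
    rewrite (eq_integral (cst 0%E)) ?integral0// => y _ /=.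
    have f0 : ft t = 0 by rewrite /ft patchE memD; case: ifP.
    by rewrite /Phi /= f0 !mul0r.
  transitivity (\int[mu]_(y in `[c, t]) (f t * h y)%:E)%E.
    rewrite [RHS]integral_mkcond; apply: eq_integral => y _ /=.
    rewrite restrict_EFin /= /Phi /ft /ht /= !patchE !memD ct td /= mem_setE in_itv /=.
    case: (leP c y) => cy /=; last by rewrite mulr0 mul0r.
    case: (leP y t) => yt /=; last by rewrite mulr0.
    by rewrite (le_trans yt td) mulr1.
  rewrite EFin_Rintegral//; first last.
    exact/seg_integrableZ/(seg_integrableS _ td hi).
  by rewrite RintegralZl// (seg_integrableS _ td hi).
have -> : (\int[mu]_y \int[mu]_x (EFin \o Phi) (x, y))%E =
  (\int[mu]_x ((fun y => (h y * segint y d f)%:E) \_ D) x)%E.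
  apply: eq_integral => y _; rewrite patchE memD.
  case: ifP => [/andP[cy yd]|/negP ntD]; last first.
    rewrite (eq_integral (cst 0%E)) ?integral0// => t _ /=.
    have h0 : ht y = 0 by rewrite /ht patchE memD; case: ifP.
    by rewrite /Phi /= h0 mulr0 mul0r.
  transitivity (\int[mu]_(t in `[y, d]) (h y * f t)%:E)%E.
    rewrite [RHS]integral_mkcond; apply: eq_integral => t _ /=.
    rewrite restrict_EFin /= /Phi /ft /ht /= !patchE !memD cy yd /= mem_setE in_itv /=.
    case: (leP y t) => yt /=; last by rewrite mulr0.
    rewrite (le_trans cy yt) /=.
    by case: ifP => _; rewrite ?mul0r// mulr1 mulrC.
  rewrite EFin_Rintegral//; first last.
    exact/seg_integrableZ/(seg_integrableS cy _ fi).
  by rewrite RintegralZl// (seg_integrableS cy _ fi).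
by rewrite -!integral_mkcond /segint /Rintegral => ->.
Qed.

End Triangle.

(** * The Green operator of a Sturm-Liouville problem *)

Section Scale.
Context {R : realType}.
Local Notation mu := (@lebesgue_measure R).

(** The model is the primitive of 1 / q on [a, b], extended by constants so that
    it is continuous and bounded on the line.  With respect to the coordinate S,
    the operator - (q v')' becomes a second derivative. *)
Definition scale_function (a b : R) (S : R -> R) :=
  [/\ continuous S, forall x y, a <= x -> x < y -> y <= b -> S x < S y,
      forall x, x <= a -> S x = 0 & forall x, b <= x -> S x = S b].

(** S d - S c times the height of v above its chord over [c, d]: a second
    difference along S, which replaces - (q v')' where v has no derivative. *)
Definition sdiff (S v : R -> R) (c x d : R) : R :=
  (S d - S c) * v x - (S d - S x) * v c - (S x - S c) * v d.

(** S d - S c times the Green function of - (q v')' in [c, d]. *)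
Definition kern (S : R -> R) (c d x y : R) : R :=
  (Num.min (S x) (S y) - S c) * (S d - Num.max (S x) (S y)).

Definition kernint (S f : R -> R) (c x d : R) : R :=
  segint c d (fun y => kern S c d x y * f y).

(** The equation - (q v')' = f integrated twice; z is the value of q v' at c. *)
Definition represents (S v f : R -> R) (c d : R) :=
  exists z, forall x, x \in `[c, d] ->
    v x = v c + z * (S x - S c) - segint c x (fun y => (S x - S y) * f y).

Definition Green (S : R -> R) (a b : R) (f : R -> R) (x : R) : R :=
  (S b)^-1 * segint a b (fun y => kern S a b x y * f y).

Variables (a b : R) (S : R -> R).
Hypothesis ab : a < b.
Hypothesis hS : scale_function a b S.

Lemma scale_continuous : continuous S. Proof. by case: hS. Qed.

Lemma scale_lt x y : a <= x -> x < y -> y <= b -> S x < S y.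
Proof. by case: hS => _ + _ _; exact. Qed.

Lemma scale_a : S a = 0. Proof. by case: hS => _ _ + _; exact. Qed.

Lemma scale_le x y : a <= x -> x <= y -> y <= b -> S x <= S y.
Proof.
move=> ax; rewrite le_eqVlt => /predU1P[->//|xy] yb.
by apply/ltW/scale_lt.
Qed.

Lemma scale_b_gt0 : 0 < S b.
Proof. by rewrite -scale_a; apply: scale_lt. Qed.

Lemma scale_itv x : 0 <= S x <= S b.
Proof.
case: hS => _ _ Sl Sr.
have [xa|ax] := leP x a; first by rewrite Sl// lexx ltW// scale_b_gt0.
have [xb|bx] := leP x b; last by rewrite (Sr _ (ltW bx)) lexx ltW// scale_b_gt0.
by rewrite -{1}scale_a !scale_le// ltW.
Qed.

Lemma seg_integrable_scale c d f : seg_integrable c d f ->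
  seg_integrable c d (fun y => S y * f y).
Proof.
by move=> fi; apply: seg_integrable_mulc => //; exact/continuous_subspaceT/scale_continuous.
Qed.

Lemma segint_scaleBr c d k f : seg_integrable c d f ->
  segint c d (fun y => (k - S y) * f y) =
  k * segint c d f - segint c d (fun y => S y * f y).
Proof.
move=> fi; under [LHS]eq_segint do rewrite mulrBl.
rewrite segintB ?segintZ//; first exact: seg_integrableZ.
exact: seg_integrable_scale.
Qed.

Lemma kern_continuous c d x : continuous (kern S c d x).
Proof.
move=> y; apply: cvgM; apply: cvgB; try exact: cvg_cst.
- by apply: (@continuous_min _ _ (cst (S x)) S y); [exact: cst_continuous|exact: scale_continuous].
- by apply: (@continuous_max _ _ (cst (S x)) S y); [exact: cst_continuous|exact: scale_continuous].
Qed.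

Lemma seg_integrable_kern c d x c' d' f : seg_integrable c' d' f ->
  seg_integrable c' d' (fun y => kern S c d x y * f y).
Proof.
by move=> fi; apply: seg_integrable_mulc => //; exact/continuous_subspaceT/kern_continuous.
Qed.

Lemma kern_ge0 x y : 0 <= kern S a b x y.
Proof.
have /andP[x0 xb] := scale_itv x; have /andP[y0 yb] := scale_itv y.
rewrite /kern scale_a subr0 mulr_ge0//; first by rewrite le_min x0.
by rewrite subr_ge0 ge_max xb.
Qed.

Lemma kern_le x y : kern S a b x y <= S b * S b.
Proof.
have /andP[x0 xb] := scale_itv x; have /andP[y0 yb] := scale_itv y.
rewrite /kern scale_a subr0 ler_pM//.
- by rewrite le_min x0.
- by rewrite subr_ge0 ge_max xb.
- by rewrite ge_min xb.
- by rewrite lerBlDr lerDl le_max x0.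
Qed.

(** On a subinterval the kernel is the Green function of that subinterval. *)
Lemma kernintE c x d f : a <= c -> c <= x -> x <= d -> d <= b ->
  seg_integrable c d f ->
  kernint S f c x d =
    (S d - S x) * (segint c x (fun y => S y * f y) - S c * segint c x f) +
    (S x - S c) * (S d * segint x d f - segint x d (fun y => S y * f y)).
Proof.
move=> ac cx xd db fi.
have fi1 : seg_integrable c x f by exact: seg_integrableS fi.
have fi2 : seg_integrable x d f by exact: seg_integrableS fi.
rewrite /kernint (segint_split (x := x)) ?cx//; last exact: seg_integrable_kern.
congr (_ + _).
- rewrite (@eq_segint _ _ _ _ (fun y => - (S d - S x) * ((S c - S y) * f y))).
    rewrite segintZ ?segint_scaleBr//; first by ring.
    apply: (@eq_seg_integrable _ _ _ (fun y => S c * f y - S y * f y)).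
      by move=> y _; rewrite mulrBl.
    by apply: seg_integrableB; [exact: seg_integrableZ|exact: seg_integrable_scale].
  move=> y; rewrite in_itv /= => /andP[cy yx].
  have Syx : S y <= S x by rewrite scale_le ?(le_trans ac) ?(le_trans xd).
  rewrite /kern (min_idPr Syx) (max_idPl Syx); ring.
- rewrite (@eq_segint _ _ _ _ (fun y => (S x - S c) * ((S d - S y) * f y))).
    rewrite segintZ ?segint_scaleBr//.
    apply: (@eq_seg_integrable _ _ _ (fun y => S d * f y - S y * f y)).
      by move=> y _; rewrite mulrBl.
    by apply: seg_integrableB; [exact: seg_integrableZ|exact: seg_integrable_scale].
  move=> y; rewrite in_itv /= => /andP[xy yd].
  have Sxy : S x <= S y by rewrite scale_le ?(le_trans (le_trans ac cx)) ?(le_trans yd).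
  rewrite /kern (min_idPl Sxy) (max_idPr Sxy); ring.
Qed.

(** A second difference along S cancels the two constants of integration. *)
Lemma sdiff_represents v f c0 d0 c x d : a <= c0 -> d0 <= b ->
  c0 <= c -> c <= x -> x <= d -> d <= d0 ->
  seg_integrable c0 d0 f -> represents S v f c0 d0 ->
  sdiff S v c x d = kernint S f c x d.
Proof.
move=> ac0 db0 c0c cx xd dd0 fi [z vE].
have fic : seg_integrable c d f by exact: seg_integrableS fi.
have Sfi := seg_integrable_scale fi.
rewrite kernintE ?(le_trans ac0)// ?(le_trans dd0)//.
have E y : c0 <= y <= d0 -> v y = v c0 + z * (S y - S c0)
    - (S y * segint c0 y f - segint c0 y (fun y => S y * f y)).
  move=> /andP[c0y yd0]; rewrite vE ?in_itv/= ?c0y//.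
  by rewrite segint_scaleBr// (seg_integrableS _ _ fi).
have xd0 := le_trans xd dd0; have c0x := le_trans c0c cx.
have cd0 := le_trans cx xd0; have c0d := le_trans c0x xd.
rewrite /sdiff (E x) ?c0x// (E c) ?c0c// (E d) ?c0d//.
have sp g u w : c0 <= u -> u <= w -> w <= d0 -> seg_integrable c0 d0 g ->
    segint u w g = segint c0 w g - segint c0 u g.
  move=> c0u uw wd gi; rewrite (segint_split (c := c0) (x := u)) ?c0u//.
    by rewrite addrC addKr.
  exact: seg_integrableS gi.
rewrite !(sp _ c x)// !(sp _ x d)//; ring.
Qed.

Lemma Green_out f x : (x <= a) || (b <= x) -> Green S a b f x = 0.
Proof.
case: (hS) => _ _ Sl Sr.
move=> h; rewrite /Green (@eq_segint _ _ _ _ (fun=> 0)); last first.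
  move=> y _; rewrite /kern scale_a subr0.
  have /andP[y0 yb] := scale_itv y.
  case/orP: h => h; first by rewrite (Sl _ h) (min_idPl y0) !mul0r.
  by rewrite (Sr _ h) (max_idPl yb) subrr mulr0 mul0r.
by rewrite segint_cst ?ltW// mul0r mulr0.
Qed.

Lemma Green_represents f : seg_integrable a b f -> represents S (Green S a b f) f a b.
Proof.
move=> fi; have S0 : S b != 0 by rewrite gt_eqF// scale_b_gt0.
have Sfi := seg_integrable_scale fi.
have E x : x \in `[a, b] -> S b * Green S a b f x =
   S x * (S b * segint a b f - segint a b (fun y => S y * f y))
   - S b * (S x * segint a x f - segint a x (fun y => S y * f y)).
  rewrite in_itv /= => /andP[ax xb].
  rewrite /Green mulVKf//.
  rewrite -/(kernint S f a x b) kernintE// scale_a.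
  rewrite !(@segint_split _ a x b)// ?ax//; ring.
exists ((S b)^-1 * (S b * segint a b f - segint a b (fun y => S y * f y))) => x xab.
have xab' := xab; move: xab'; rewrite in_itv /= => /andP[ax xb].
apply: (mulfI S0); rewrite E// segint_scaleBr; last exact: seg_integrableS fi.
rewrite (@Green_out f a) ?lexx// add0r scale_a.
by field.
Qed.

Lemma Green_ge0 f x : (forall y, y \in `[a, b] -> 0 <= f y) -> 0 <= Green S a b f x.
Proof.
move=> f0; rewrite /Green mulr_ge0 ?invr_ge0 ?(ltW scale_b_gt0)//.
by apply: segint_ge0 => y yab; rewrite mulr_ge0 ?kern_ge0 ?f0.
Qed.

Lemma Green_bound f x : seg_integrable a b f ->
  `|Green S a b f x| <= S b * segint a b (fun y => `|f y|).
Proof.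
move=> fi; have Sb := scale_b_gt0.
rewrite /Green normrM gtr0_norm ?invr_gt0// ler_pdivrMl//.
apply: (le_trans (segint_norm (seg_integrable_kern _ _ _ fi))).
rewrite mulrA -segintZ; last exact: seg_integrable_norm.
apply: segint_le.
- exact/seg_integrable_norm/seg_integrable_kern.
- exact/seg_integrableZ/seg_integrable_norm.
by move=> y _; rewrite normrM ler_wpM2r// ger0_norm ?kern_ge0 ?kern_le.
Qed.

Lemma Green_continuous f : seg_integrable a b f -> continuous (Green S a b f).
Proof.
move=> fi.
(* the kernel is Lipschitz in S x, uniformly in y *)
have key x x' : `|Green S a b f x - Green S a b f x'| <=
    2 * `|S x - S x'| * segint a b (fun y => `|f y|).
  have Sb := scale_b_gt0.
  rewrite /Green -mulrBr normrM gtr0_norm ?invr_gt0// ler_pdivrMl//.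
  rewrite -segintB; try exact: seg_integrable_kern.
  have di : seg_integrable a b (fun y => kern S a b x y * f y - kern S a b x' y * f y).
    by apply: seg_integrableB; exact: seg_integrable_kern.
  apply: (le_trans (segint_norm di)).
  rewrite mulrA -segintZ; last exact: seg_integrable_norm.
  apply: segint_le.
  - exact/seg_integrable_norm.
  - exact/seg_integrableZ/seg_integrable_norm.
  move=> y _; rewrite -mulrBl normrM ler_wpM2r//.
  have /andP[x0 xb] := scale_itv x; have /andP[y0 yb] := scale_itv y.
  have /andP[x'0 x'b] := scale_itv x'.
  set de := `|S x - S x'|.
  have : `|S x - S x'| <= de by [].
  rewrite ler_norml => /andP[d1 d2].
  have dmin : `|Num.min (S x) (S y) - Num.min (S x') (S y)| <= de.
    by rewrite ler_norml; case: (leP (S x) (S y)); case: (leP (S x') (S y));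
      move=> *; apply/andP; split; lra.
  have dmax : `|Num.max (S x') (S y) - Num.max (S x) (S y)| <= de.
    by rewrite ler_norml; case: (leP (S x) (S y)); case: (leP (S x') (S y));
      move=> *; apply/andP; split; lra.
  have -> : kern S a b x y - kern S a b x' y =
     (Num.min (S x) (S y) - Num.min (S x') (S y)) * (S b - Num.max (S x) (S y)) +
     Num.min (S x') (S y) * (Num.max (S x') (S y) - Num.max (S x) (S y)).
    by rewrite /kern scale_a; ring.
  apply: (le_trans (ler_normD _ _)).
  have -> : S b * (2 * de) = de * S b + S b * de by ring.
  rewrite !normrM lerD// ler_pM//.
  - by rewrite ger0_norm ?subr_ge0 ?ge_max ?xb// lerBlDr lerDl le_max x0.
  - by rewrite ger0_norm ?le_min ?x'0// ge_min x'b.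
move=> x; apply/cvgrPdist_le => e e0.
set C := segint a b _ in key.
have C0 : 0 <= C by apply: segint_ge0.
have e1 : 0 < e / (2 * C + 1) by rewrite divr_gt0// ltr_wpDl// mulr_ge0.
have cSx : S y @[y --> x] --> S x by exact: scale_continuous.
move/cvgrPdist_le : cSx => /(_ _ e1); apply: filterS => y Sxy.
apply: (le_trans (key x y)).
rewrite -mulrA [_ * C]mulrC mulrA.
apply: (@le_trans _ _ ((2 * C + 1) * `|S x - S y|)); first by rewrite ler_wpM2r// lerDl.
by rewrite -ler_pdivlMl ?ltr_wpDl ?mulr_ge0// mulrC.
Qed.

End Scale.

(** * Comparison principles *)

Section Comparison.
Context {R : realType}.
Local Notation mu := (@lebesgue_measure R).
Variables (a b : R) (S : R -> R).
Hypothesis ab : a < b.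
Hypothesis hS : scale_function a b S.

(** If w is negative somewhere, then so is w + eta S (S b - S) for small eta.  At
    a minimum point of this sum, second differences along S are not positive,
    whereas those of w are nonnegative and those of S (S b - S) are positive. *)
Lemma minimum_principle (w : R -> R) : {within `[a, b], continuous w} ->
  0 <= w a -> 0 <= w b ->
  (forall x, x \in `]a, b[ -> w x < 0 -> exists2 e, 0 < e &
     forall c d, a <= c -> d <= b -> x - e < c -> c < x -> x < d -> d < x + e ->
     0 <= sdiff S w c x d) ->
  forall x, x \in `[a, b] -> 0 <= w x.
Proof.
move=> cw wa wb hw x0 x0ab; rewrite leNgt; apply/negP => wx0.
have Sb := scale_b_gt0 ab hS.
pose eta := - w x0 / (2 * (S b * S b)).
have eta0 : 0 < eta by rewrite divr_gt0 ?oppr_gt0// mulr_gt0// mulr_gt0.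
pose w' x := w x + eta * (S x * (S b - S x)).
have cS := scale_continuous hS.
have cw' : {within `[a, b], continuous w'}.
  move=> x; apply: cvgD; first exact: cw.
  apply: cvgM; first exact: cvg_cst.
  by apply: cvgM; [|apply: cvgB; first exact: cvg_cst]; apply: (continuous_subspaceT cS).
have [x1 x1ab min1] := EVT_min (ltW ab) cw'.
have ge0 x : 0 <= eta * (S x * (S b - S x)).
  have /andP[? ?] := scale_itv ab hS x.
  by apply: mulr_ge0; [exact: ltW|rewrite mulr_ge0 ?subr_ge0].
have w'x0 : w' x0 < 0.
  rewrite /w'; have : eta * (S x0 * (S b - S x0)) <= eta * (S b * S b).
    have /andP[? ?] := scale_itv ab hS x0.
    by rewrite ler_wpM2l ?(ltW eta0)// ler_pM ?subr_ge0// lerBlDr lerDl.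
  have -> : eta * (S b * S b) = - w x0 / 2.
    by rewrite /eta; field; rewrite gt_eqF.
  by move: wx0; lra.
have w'x1 : w' x1 < 0 by apply: le_lt_trans w'x0; exact: min1.
have wx1 : w x1 < 0 by apply: le_lt_trans w'x1; rewrite /w' lerDl.
have x1oo : x1 \in `]a, b[.
  move: x1ab; rewrite !in_itv /= !le_eqVlt => /andP[/predU1P[x1a|->]].
    by move: wx1; rewrite -x1a ltNge wa.
  by case/predU1P => [x1b|->//]; move: wx1; rewrite x1b ltNge wb.
have [e e0 he] := hw _ x1oo wx1.
move: x1oo; rewrite in_itv /= => /andP[ax1 x1b].
pose c := Num.max a (x1 - e / 2); pose d := Num.min b (x1 + e / 2).
have ac : a <= c by rewrite le_max lexx.
have db : d <= b by rewrite ge_min lexx.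
have cx1 : c < x1 by rewrite gt_max ax1/= ltrBlDr ltrDl divr_gt0.
have x1d : x1 < d by rewrite lt_min x1b/= ltrDl divr_gt0.
have ec : x1 - e < c by rewrite lt_max; apply/orP; right; lra.
have ed : d < x1 + e by rewrite gt_min; apply/orP; right; lra.
have sw := he c d ac db ec cx1 x1d ed.
have wc : w' x1 <= w' c by apply: min1; rewrite in_itv /= ac ltW// (lt_trans cx1)// (lt_le_trans x1d).
have wd : w' x1 <= w' d by apply: min1; rewrite in_itv /= db andbT ltW// (lt_trans ax1).
have Scx : S c < S x1 by apply: (scale_lt hS) => //; rewrite ltW.
have Sxd : S x1 < S d by apply: (scale_lt hS) => //; rewrite ltW.
have : sdiff S w c x1 d < 0.
  apply: (@lt_le_trans _ _ ((S d - S x1) * (w' x1 - w' c) + (S x1 - S c) * (w' x1 - w' d))).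
    rewrite -subr_gt0.
    have -> : (S d - S x1) * (w' x1 - w' c) + (S x1 - S c) * (w' x1 - w' d) -
      sdiff S w c x1 d = eta * ((S d - S x1) * (S x1 - S c) * (S d - S c)).
      by rewrite /sdiff /w'; ring.
    by have Scd := lt_trans Scx Sxd; apply: mulr_gt0 => //; rewrite !mulr_gt0 ?subr_gt0.
  by rewrite -oppr_ge0 opprD -!mulrN; apply: addr_ge0; apply: mulr_ge0;
    rewrite ?oppr_ge0 ?subr_le0 ?subr_ge0//; exact: ltW.
by rewrite ltNge sw.
Qed.

Lemma kernint_le f g c x d : a <= c -> c <= x -> x <= d -> d <= b ->
  seg_integrable c d f -> seg_integrable c d g ->
  {ae mu, forall y, y \in `]c, d[ -> f y <= g y} ->
  kernint S f c x d <= kernint S g c x d.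
Proof.
move=> ac cx xd db fi gi fg; apply: segint_ae_le.
- exact: (seg_integrable_kern hS).
- exact: (seg_integrable_kern hS).
apply: (ae_imp fg) => y h ycd; rewrite ler_wpM2l ?h//.
move: ycd; rewrite in_itv /= => /andP[cy yd].
have Scy : S c <= S y by apply: (scale_le hS) => //; apply: ltW => //; exact: lt_le_trans db.
have Syd : S y <= S d by apply: (scale_le hS) => //; apply: ltW => //; exact: le_lt_trans cy.
have Scx : S c <= S x by apply: (scale_le hS) => //; exact: le_trans db.
have Sxd : S x <= S d by apply: (scale_le hS) => //; exact: le_trans cx.
by rewrite /kern mulr_ge0// subr_ge0 ?le_min ?ge_max ?Scx ?Sxd.
Qed.

Lemma sdiffB v w c x d : sdiff S (v \- w) c x d = sdiff S v c x d - sdiff S w c x d.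
Proof. by rewrite /sdiff /=; ring. Qed.

Lemma sdiff_Green f c x d : a <= c -> c <= x -> x <= d -> d <= b ->
  seg_integrable a b f -> sdiff S (Green S a b f) c x d = kernint S f c x d.
Proof.
move=> ac cx xd db fi; apply: (sdiff_represents hS _ _ ac) => //.
exact: (Green_represents ab hS).
Qed.

Lemma continuous_lt_near (w : R -> R) x k : {for x, continuous w} -> w x < k ->
  exists2 e, 0 < e & forall y, x - e < y -> y < x + e -> w y < k.
Proof.
move=> cw wx; have wxx : w y @[y --> x] --> w x by exact: cw.
have : nbhs x [set y | w y < k] by exact: (cvgr_lt _ wxx _ wx).
move=> /nbhs_ballP[e /= e0 he]; exists e => // y xy yx.
by apply: he; rewrite /ball /= ltr_norml; apply/andP; split; lra.
Qed.

(** Where the conclusion fails, f1 <= f2 makes the difference of the potentials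
    concave along S, and the minimum principle applies. *)
Lemma Green_comparison f1 f2 : seg_integrable a b f1 -> seg_integrable a b f2 ->
  {ae mu, forall y, y \in `]a, b[ -> Green S a b f2 y < Green S a b f1 y -> f1 y <= f2 y} ->
  forall x, Green S a b f1 x <= Green S a b f2 x.
Proof.
move=> fi1 fi2 f12 x; have [xab|xab] := boolP (x \in `[a, b]); last first.
  move: xab; rewrite in_itv /= negb_and -!ltNge => xab.
  have {}xab : (x <= a) || (b <= x) by case/orP: xab => /ltW ->//; rewrite orbT.
  by rewrite !(Green_out ab hS).
pose w := Green S a b f2 \- Green S a b f1.
have cw : continuous w.
  by move=> y; apply: cvgB; exact: (Green_continuous ab hS).
rewrite -subr_ge0 -/(w x).
apply: (@minimum_principle w) => //; first exact: continuous_subspaceT.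
- by rewrite /w /= !(Green_out ab hS) ?lexx// subrr.
- by rewrite /w /= !(Green_out ab hS) ?lexx ?orbT// subrr.
move=> y yab wy; have [e e0 he] := continuous_lt_near (cw y) wy.
exists e => // c d ac db ec cy yd de.
have [cy' yd'] := (ltW cy, ltW yd).
rewrite sdiffB !sdiff_Green// subr_ge0.
apply: kernint_le => //.
- exact: seg_integrableS fi1.
- exact: seg_integrableS fi2.
apply: (ae_imp f12) => z h; rewrite in_itv /= => /andP[cz zd]; apply: h.
  by rewrite in_itv /= (le_lt_trans ac cz) (lt_le_trans zd db).
by rewrite -subr_lt0; apply: he; lra.
Qed.

(** A notion of subsolution in the spirit of viscosity theory: psi is touched from
    below at x by a function chi with - (q chi')' <= F <= rhs (y, chi).  It is
    stable under maxima, and psi itself needs no equation. *)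
Definition touched_below (rhs : R -> R -> R) (psi : R -> R) (x : R) :=
  exists c0 d0 chi F, [/\ [/\ a <= c0, c0 < x, x < d0 & d0 <= b],
    [/\ seg_integrable c0 d0 F, {within `[c0, d0], continuous chi}, chi x = psi x &
     forall y, y \in `[c0, d0] -> chi y <= psi y],
    forall c d, c0 <= c -> c < x -> x < d -> d <= d0 ->
      sdiff S chi c x d <= kernint S F c x d &
    {ae mu, forall y, y \in `]c0, d0[ -> F y <= rhs y (chi y)}].

Definition subsolution (rhs : R -> R -> R) (psi : R -> R) :=
  forall x, x \in `]a, b[ -> touched_below rhs psi x.

(** Where Green f is below psi, it is also below the function chi that touches
    psi from below, near the point of contact; there the last hypothesis bounds
    the density of chi by f.  The second difference of psi at the point of
    contact is at most that of chi. *)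
Lemma Green_ge_subsolution (rhs : R -> R -> R) (psi f : R -> R) : seg_integrable a b f ->
  {within `[a, b], continuous psi} -> psi a <= 0 -> psi b <= 0 ->
  subsolution rhs psi ->
  {ae mu, forall y, y \in `]a, b[ -> forall t, Green S a b f y < t -> t <= psi y ->
     rhs y t <= f y} ->
  forall x, x \in `[a, b] -> psi x <= Green S a b f x.
Proof.
move=> fi cpsi psia psib hpsi hf x xab.
pose w := Green S a b f \- psi.
have cG : continuous (Green S a b f) by exact: (Green_continuous ab hS).
rewrite -subr_ge0 -/(w x).
apply: (@minimum_principle w) => //.
- by move=> y; apply: cvgB; [apply: (continuous_subspaceT cG)|exact: cpsi].
- by rewrite /w /= (Green_out ab hS) ?lexx// subr_ge0.
- by rewrite /w /= (Green_out ab hS) ?lexx ?orbT// subr_ge0.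
move=> {xab}x xab wx.
have [c0 [d0 [chi [F [[ac0 c0x xd0 d0b] [Fi cchi chix chile] hsd hF]]]]] := hpsi x xab.
have xcd : x \in `]c0, d0[ by rewrite in_itv /= c0x.
have cwc : {for x, continuous (Green S a b f \- chi)}.
  move/(continuous_within_itvP _ (lt_trans c0x xd0)) : cchi => [cchi _ _].
  by apply: cvgB; [exact: cG|exact: cchi].
have wx' : (Green S a b f \- chi) x < 0 by rewrite /= chix.
have [e1 e10 he1] := continuous_lt_near cwc wx'.
pose e := Num.min e1 (Num.min (x - c0) (d0 - x)).
have e0 : 0 < e by rewrite !lt_min e10 !subr_gt0 c0x.
have [ee1 ec0 ed0] : [/\ e <= e1, e <= x - c0 & e <= d0 - x].
  by split; rewrite ?ge_min ?lexx// ?ge_min ?lexx ?orbT.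
exists e => // c d ac db ec cx xd de.
have [cx' xd'] := (ltW cx, ltW xd).
have c0c : c0 <= c by lra.
have dd0 : d <= d0 by lra.
apply: (@le_trans _ _ (sdiff S (Green S a b f \- chi) c x d)).
  rewrite sdiffB sdiff_Green// subr_ge0.
  apply: (le_trans (hsd _ _ c0c cx xd dd0)); apply: kernint_le => //.
  - exact: seg_integrableS Fi.
  - exact: seg_integrableS fi.
  apply: (ae_imp2 hF hf) => y h1 h2; rewrite in_itv /= => /andP[cy yd].
  have ycd0 : y \in `]c0, d0[ by rewrite in_itv /= (le_lt_trans c0c) ?(lt_le_trans yd).
  apply: (le_trans (h1 ycd0)); apply: h2.
  - by rewrite in_itv /= (le_lt_trans ac cy) (lt_le_trans yd db).
  - rewrite -subr_lt0; apply: (he1 y); lra.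
  - by apply: chile; apply: subset_itv_oo_cc.
have Sxc : 0 <= S x - S c by rewrite subr_ge0 (scale_le hS)// (le_trans xd').
have Sdx : 0 <= S d - S x by rewrite subr_ge0 (scale_le hS)// (le_trans ac).
have chic : chi c <= psi c by apply: chile; rewrite in_itv /=; apply/andP; split; lra.
have chid : chi d <= psi d by apply: chile; rewrite in_itv /=; apply/andP; split; lra.
rewrite -subr_ge0.
have -> : sdiff S w c x d - sdiff S (Green S a b f \- chi) c x d =
  (S d - S x) * (psi c - chi c) + (S x - S c) * (psi d - chi d).
  by rewrite /sdiff /w /= chix; ring.
by apply: addr_ge0; apply: mulr_ge0; rewrite // subr_ge0.
Qed.

End Comparison.

(** * Solvability of monotone equations *)

Section Sequences.
Context {R : realType}.

Lemma halving_steps_bound (u : nat -> R) M : u 0%N = 0 ->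
  (forall n, `|u n.+1 - u n| <= M * 2^-1 ^+ n) -> forall n, `|u n| <= 2 * M.
Proof.
move=> u0 hu.
have M0 : 0 <= M by have := le_trans (normr_ge0 _) (hu 0%N); rewrite expr0 mulr1.
have hn n : `|u n| <= M * (2 - 2 * 2^-1 ^+ n).
  elim: n => [|n IH]; first by rewrite u0 normr0 expr0 mulr1 subrr mulr0.
  rewrite -(subrK (u n) (u n.+1)); apply: (le_trans (ler_normD _ _)).
  apply: (le_trans (lerD (hu n) IH)).
  rewrite exprS.
  by rewrite le_eqVlt; apply/orP; left; apply/eqP; field.
move=> n; apply: (le_trans (hn n)); rewrite mulrC ler_wpM2r//.
by rewrite lerBlDr lerDl mulr_ge0// exprn_ge0// invr_ge0.
Qed.

Lemma halving_steps_cvg (u : nat -> R) M :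
  (forall n, `|u n.+1 - u n| <= M * 2^-1 ^+ n) -> cvgn u.
Proof.
move=> hu.
have M0 : 0 <= M by have := le_trans (normr_ge0 _) (hu 0%N); rewrite expr0 mulr1.
have h2 : `|2^-1 : R| < 1 by rewrite ger0_norm ?invr_ge0// invf_lt1// ltr1n.
have : cvgn (series (telescope u)).
  apply: normed_cvg.
  apply: (series_le_cvg _ _ _ (is_cvg_geometric_series (a := M) h2)) => n.
  - exact: normr_ge0.
  - by rewrite /geometric /= mulr_ge0// exprn_ge0// invr_ge0.
  - exact: hu.
rewrite telescopeK => h.
have -> : u = (fun n => (u n - u 0%N) + u 0%N) by apply/funext => n; rewrite subrK.
by apply: is_cvgD => //; exact: is_cvg_cst.
Qed.

End Sequences.

Section Solver.
Context {R : realType}.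
Local Notation mu := (@lebesgue_measure R).
Variables (a b : R) (S : R -> R).
Hypothesis ab : a < b.
Hypothesis hS : scale_function a b S.

Definition bounded_measurable (v : R -> R) :=
  measurable_fun `[a, b] v /\ exists M, forall x, x \in `[a, b] -> `|v x| <= M.

Lemma continuous_bounded_measurable v : continuous v -> bounded_measurable v.
Proof.
move=> cv; have cv' : {within `[a, b], continuous v} by exact: continuous_subspaceT.
split; first exact: seg_continuous_measurable.
by have [M _ ?] := seg_continuous_bounded cv'; exists M.
Qed.

Lemma GreenD f g x : seg_integrable a b f -> seg_integrable a b g ->
  Green S a b (fun y => f y + g y) x = Green S a b f x + Green S a b g x.
Proof.
move=> fi gi; rewrite /Green -mulrDr -segintD; try exact: (seg_integrable_kern hS).
by congr (_ * _); apply: eq_segint => y _; rewrite mulrDr.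
Qed.

Lemma eq_Green f g x : {in `[a, b], f =1 g} -> Green S a b f x = Green S a b g x.
Proof. by move=> fg; congr (_ * _); apply: eq_segint => y yab; rewrite fg. Qed.

Lemma Green0 x : Green S a b (fun=> 0) x = 0.
Proof.
rewrite /Green (@eq_segint _ _ _ _ (fun=> 0)).
  by rewrite segint_cst ?(ltW ab)// mul0r mulr0.
by move=> y _; rewrite mulr0.
Qed.

Lemma Green_cvg (F : nat -> R -> R) f g x :
  (forall n, measurable_fun `[a, b] (F n)) ->
  (forall y, y \in `[a, b] -> F ^~ y @ \oo --> f y) ->
  seg_integrable a b g ->
  (forall n y, y \in `[a, b] -> `|F n y| <= g y) ->
  seg_integrable a b f /\
  ((fun n => Green S a b (F n) x) @ \oo --> Green S a b f x).
Proof.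
move=> mF Ff gi Fg.
have mf : measurable_fun `[a, b] f by apply: measurable_fun_cvg mF _ => y /Ff.
have fi : seg_integrable a b f.
  apply: seg_integrable_le gi => // y yab.
  have c : (fun n => `|F n y|) @ \oo --> `|f y| by apply: cvg_norm; exact: Ff.
  by apply: (cvgr_to_le c); apply: nearW => n; exact: Fg.
have mk : measurable_fun `[a, b] (kern S a b x).
  by apply: seg_continuous_measurable; exact/continuous_subspaceT/(kern_continuous hS).
split => //.
apply: cvgM; first exact: cvg_cst.
apply: (segint_dct (g := fun y => S b * S b * g y)).
- by move=> n; exact: measurable_funM.
- exact: measurable_funM.
- by move=> y yab; apply: cvgM; [exact: cvg_cst|exact/Ff/subset_itv_oo_cc].
- exact: seg_integrableZ.
move=> n y yab; rewrite normrM ger0_norm ?(kern_ge0 ab hS)// ler_pM ?(kern_ge0 ab hS)//.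
- exact: (kern_le ab hS).
- exact/Fg/subset_itv_oo_cc.
Qed.

Variables (C N : R -> R) (g : R -> R) (L : R).
Hypotheses (Ci : seg_integrable a b C) (Ni : seg_integrable a b N).
Hypotheses (C0 : forall y, 0 <= C y) (N0 : forall y, 0 <= N y).
Hypothesis gmono : forall s t, s <= t -> g s <= g t.
Hypothesis glip : forall s t, `|g s - g t| <= L * `|s - t|.
Hypothesis g0 : g 0 = 0.

Definition absorption (y s : R) : R := C y * s + N y * g s.

Let A := absorption.
Let k y := C y + L * N y.

Let L0 : 0 <= L.
Proof. by have := le_trans (normr_ge0 _) (glip 1 0); rewrite subr0 normr1 mulr1. Qed.

Let k0 y : 0 <= k y.
Proof. by rewrite addr_ge0// mulr_ge0. Qed.

Let ki : seg_integrable a b k.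
Proof. by apply: seg_integrableD => //; exact: seg_integrableZ. Qed.

Lemma absorption_mono y s t : s <= t -> A y s <= A y t.
Proof. by move=> st; rewrite /A/absorption lerD// ler_wpM2l// gmono. Qed.

Lemma absorption_lipschitz y s t : `|A y s - A y t| <= k y * `|s - t|.
Proof.
rewrite /A/absorption.
have -> : C y * s + N y * g s - (C y * t + N y * g t) =
  C y * (s - t) + N y * (g s - g t) by ring.
apply: (le_trans (ler_normD _ _)).
rewrite !normrM (ger0_norm (C0 y)) (ger0_norm (N0 y)).
rewrite /k mulrDl lerD//.
by rewrite -mulrA mulrCA ler_wpM2l.
Qed.

Lemma absorption_bound y s : `|A y s| <= k y * `|s|.
Proof.
have := absorption_lipschitz y s 0.
by rewrite {2}/A/absorption g0 !mulr0 addr0 !subr0.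
Qed.

Let gcont : continuous g.
Proof.
move=> s; apply/cvgrPdist_le => e e0.
have e1 : 0 < e / (L + 1) by rewrite divr_gt0// ltr_wpDl.
near=> t; apply: (le_trans (glip s t)).
apply: (@le_trans _ _ ((L + 1) * `|s - t|)); first by rewrite ler_wpM2r// lerDl.
rewrite -ler_pdivlMl ?ltr_wpDl// mulrC.
near: t; have /cvgrPdist_le := @cvg_id _ (nbhs s) => /(_ _ e1).
by apply: filterS => t; rewrite distrC.
Unshelve. all: by end_near. Qed.

Lemma absorption_measurable v : measurable_fun `[a, b] v ->
  measurable_fun `[a, b] (fun y => A y (v y)).
Proof.
move=> mv; apply: measurable_funD; apply: measurable_funM => //.
- exact: seg_measurable_fun.
- exact: seg_measurable_fun.
- by apply: (measurableT_comp _ mv); exact: continuous_measurable_fun.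
Qed.

Lemma absorption_integrable v : bounded_measurable v ->
  seg_integrable a b (fun y => A y (v y)).
Proof.
move=> [mv [M vM]]; apply: (@seg_integrable_le _ _ _ _ (fun y => M * k y)).
- exact: absorption_measurable.
- move=> y yab; apply: (le_trans (absorption_bound _ _)).
  by rewrite mulrC ler_wpM2r// vM.
- exact: seg_integrableZ.
Qed.

(** The parameter t leads from the linear problem at t = 0 to the problem with
    the full absorption at t = 1. *)
Definition solvable (t : R) := forall h, seg_integrable a b h ->
  exists2 v, continuous v &
    forall x, v x = Green S a b (fun y => h y - t * A y (v y)) x.

Let srci t h v : seg_integrable a b h -> continuous v ->
  seg_integrable a b (fun y => h y - t * A y (v y)).
Proof.
move=> hi cv; apply: seg_integrableB => //; apply: seg_integrableZ.
exact/absorption_integrable/continuous_bounded_measurable.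
Qed.

(** By monotonicity of the absorption, v2 plus the potential of |h1 - h2| is a
    supersolution of the problem solved by v1. *)
Lemma solution_comparison t h1 h2 v1 v2 : 0 <= t ->
  seg_integrable a b h1 -> seg_integrable a b h2 -> continuous v1 -> continuous v2 ->
  (forall x, v1 x = Green S a b (fun y => h1 y - t * A y (v1 y)) x) ->
  (forall x, v2 x = Green S a b (fun y => h2 y - t * A y (v2 y)) x) ->
  forall x, v1 x <= v2 x + Green S a b (fun y => `|h1 y - h2 y|) x.
Proof.
move=> t0 hi1 hi2 cv1 cv2 v1E v2E x.
have di : seg_integrable a b (fun y => `|h1 y - h2 y|).
  exact/seg_integrable_norm/seg_integrableB.
have GE z : v2 z + Green S a b (fun y => `|h1 y - h2 y|) z =
    Green S a b (fun y => h2 y - t * A y (v2 y) + `|h1 y - h2 y|) z.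
  by rewrite GreenD//; [rewrite -v2E|exact: srci].
rewrite GE v1E; apply: (Green_comparison ab hS).
- exact: srci.
- by apply: seg_integrableD => //; exact: srci.
apply: aeW => y yab; rewrite -GE -v1E => v21.
have {}v21 : v2 y <= v1 y.
  apply: ltW; apply: le_lt_trans v21; rewrite lerDl.
  by apply: (Green_ge0 ab hS).
have := absorption_mono y v21; have := ler_norm (h1 y - h2 y).
move=> h12 hA; have : t * A y (v2 y) <= t * A y (v1 y) by rewrite ler_wpM2l.
by move: h12; lra.
Qed.

(** The constant does not depend on t, so that the continuation in t can proceed
    with steps of a fixed length. *)
Lemma solution_distance t h1 h2 v1 v2 : 0 <= t ->
  seg_integrable a b h1 -> seg_integrable a b h2 -> continuous v1 -> continuous v2 ->
  (forall x, v1 x = Green S a b (fun y => h1 y - t * A y (v1 y)) x) ->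
  (forall x, v2 x = Green S a b (fun y => h2 y - t * A y (v2 y)) x) ->
  forall x, `|v1 x - v2 x| <= S b * segint a b (fun y => `|h1 y - h2 y|).
Proof.
move=> t0 hi1 hi2 cv1 cv2 v1E v2E x.
have c12 := solution_comparison t0 hi1 hi2 cv1 cv2 v1E v2E x.
have c21 := solution_comparison t0 hi2 hi1 cv2 cv1 v2E v1E x.
have di : seg_integrable a b (fun y => h1 y - h2 y) by exact: seg_integrableB.
have := Green_bound ab hS x (seg_integrable_norm di).
under [X in _ <= _ * X -> _]eq_segint do rewrite normr_id.
have GE : Green S a b (fun y => `|h2 y - h1 y|) x = Green S a b (fun y => `|h1 y - h2 y|) x.
  by apply: eq_Green => y _; rewrite distrC.
rewrite GE in c21.
rewrite ler_norml => /andP[_ B]; rewrite ler_norml; apply/andP; split; lra.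
Qed.

Lemma solvable0 : solvable 0.
Proof.
move=> h hi; exists (Green S a b h); first exact: (Green_continuous ab hS).
by move=> x; apply: eq_Green => y _; rewrite mul0r subr0.
Qed.

(** For a short step dt the extra term is a contraction in the sup norm, so
    that the fixed point is the limit of the Picard iterates. *)
Lemma solvable_step t dt : 0 <= t -> 0 <= dt ->
  S b * (dt * segint a b k) <= 2^-1 -> solvable t -> solvable (t + dt).
Proof.
move=> t0 dt0 small solt h hi.
have [sol solP] : {sol : (R -> R) -> R -> R & forall f, seg_integrable a b f ->
    continuous (sol f) /\
    forall x, sol f x = Green S a b (fun y => f y - t * A y (sol f y)) x}.
  apply: (@choice _ _ (fun f w => seg_integrable a b f -> continuous w /\
    forall x, w x = Green S a b (fun y => f y - t * A y (w y)) x)) => f.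
  have [fi|nfi] := pselect (seg_integrable a b f).
    by have [v cv vE] := solt f fi; exists v.
  by exists (fun=> 0).
pose v n := iter n (fun w => sol (fun y => h y - dt * A y (w y))) (fun=> 0).
have vc n : continuous (v n).
  elim: n => [|n IH] /=; first exact: cst_continuous.
  by have [] := solP _ (srci dt hi IH).
have si n := srci dt hi (vc n).
have vE n x : v n.+1 x = Green S a b (fun y => h y - dt * A y (v n y)
    - t * A y (v n.+1 y)) x.
  by have [_] := solP _ (si n); exact.
pose M := S b * segint a b (fun y => `|h y - dt * A y (v 0%N y) - t * A y (v 1%N y)|).
have step n x : `|v n.+1 x - v n x| <= M * 2^-1 ^+ n.
  elim: n x => [|n IH] x.
    rewrite expr0 mulr1 subr0 vE; apply: (Green_bound ab hS).
    by rewrite /=; apply: (srci t (si 0%N) (vc 1%N)).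
  have := solution_distance t0 (si n.+1) (si n) (vc n.+2) (vc n.+1) (vE n.+1) (vE n) x.
  move=> /le_trans; apply.
  have q0 : 0 <= M * 2^-1 ^+ n by apply: le_trans (IH a).
  apply: (@le_trans _ _ (S b * (dt * segint a b k) * (M * 2^-1 ^+ n))); last first.
    have -> : M * 2^-1 ^+ n.+1 = 2^-1 * (M * 2^-1 ^+ n) by rewrite exprS mulrCA.
    exact: ler_wpM2r.
  have -> : S b * (dt * segint a b k) * (M * 2^-1 ^+ n) =
    S b * (dt * (M * 2^-1 ^+ n) * segint a b k) by ring.
  rewrite ler_wpM2l ?(ltW (scale_b_gt0 ab hS))// -segintZ//.
  apply: segint_le.
  - exact/seg_integrable_norm/seg_integrableB.
  - exact: seg_integrableZ.
  move=> y _.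
  have -> : h y - dt * A y (v n.+1 y) - (h y - dt * A y (v n y)) =
    dt * (A y (v n y) - A y (v n.+1 y)) by ring.
  rewrite normrM ger0_norm// -mulrA ler_wpM2l//.
  apply: (le_trans (absorption_lipschitz _ _ _)).
  by rewrite mulrC ler_wpM2r// distrC.
have vb x n : `|v n x| <= 2 * M.
  exact: (@halving_steps_bound _ (v ^~ x) M erefl (step ^~ x)).
pose w x := limn (v ^~ x).
have vw x : v ^~ x @ \oo --> w x by apply: halving_steps_cvg (step ^~ x).
have vw1 x : (fun n => v n.+1 x) @ \oo --> w x.
  by rewrite (cvg_shiftS (v ^~ x)); exact: vw.
have gi : seg_integrable a b (fun y => `|h y| + (dt + t) * (2 * M) * k y).
  by apply: seg_integrableD; [exact: seg_integrable_norm|exact: seg_integrableZ].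
have Ac y (u : nat -> R) l : u @ \oo --> l -> (fun n => A y (u n)) @ \oo --> A y l.
  move=> ul; apply: cvgD; apply: cvgM; try exact: cvg_cst; first exact: ul.
  by apply: (cvg_comp _ _ ul); exact: gcont.
have Ab y n : `|A y (v n y)| <= 2 * M * k y.
  by apply: (le_trans (absorption_bound _ _)); rewrite mulrC ler_wpM2r.
have Gc x : seg_integrable a b (fun y => h y - (t + dt) * A y (w y)) /\
   (v n.+1 x @[n --> \oo] --> Green S a b (fun y => h y - (t + dt) * A y (w y)) x).
  rewrite (_ : (fun n => v n.+1 x) = (fun n => Green S a b
     ((fun n y => h y - dt * A y (v n y) - t * A y (v n.+1 y)) n) x)); last first.
    by apply/funext => n; exact: vE.
  apply: (@Green_cvg _ _ (fun y => `|h y| + (dt + t) * (2 * M) * k y)) => //.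
  - by move=> n; apply: seg_measurable_fun; apply: (srci t (si n) (vc n.+1)).
  - move=> y _.
    have -> : h y - (t + dt) * A y (w y) = h y - dt * A y (w y) - t * A y (w y) by ring.
    apply: cvgB; last by apply: cvgM; [exact: cvg_cst|exact/Ac/vw1].
    apply: cvgB; first exact: cvg_cst.
    by apply: cvgM; [exact: cvg_cst|exact/Ac/vw].
  - move=> n y _; rewrite -addrA -opprD.
    apply: (le_trans (ler_normB _ _)); rewrite lerD2l.
    apply: (le_trans (ler_normD _ _)); rewrite !normrM (ger0_norm dt0) (ger0_norm t0).
    have -> : (dt + t) * (2 * M) * k y = dt * (2 * M * k y) + t * (2 * M * k y) by ring.
    by apply: lerD; rewrite ler_wpM2l.
have wE x : w x = Green S a b (fun y => h y - (t + dt) * A y (w y)) x.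
  by apply: cvg_unique (vw1 x) (Gc x).2.
exists w => //.
rewrite (_ : w = Green S a b (fun y => h y - (t + dt) * A y (w y))); last exact/funext.
by apply: (Green_continuous ab hS); have [] := Gc a.
Qed.

Lemma solvable1 : solvable 1.
Proof.
have q0 : 0 <= S b * segint a b k.
  by rewrite mulr_ge0 ?(ltW (scale_b_gt0 ab hS))// segint_ge0.
pose m := (Num.truncn (2 * (S b * segint a b k))).+1.
have m0 : 0 < m%:R :> R by rewrite ltr0n.
have mq : 2 * (S b * segint a b k) < m%:R by exact: truncnS_gt.
have h j : solvable (j%:R / m%:R).
  elim: j => [|j IH]; first by rewrite mul0r; exact: solvable0.
  rewrite -natr1 mulrDl mul1r; apply: solvable_step => //.
  by rewrite mulrCA mulrC ler_pdivrMr//; move: mq; lra.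
by rewrite -(divff (lt0r_neq0 m0)); exact: h.
Qed.

End Solver.

(** * Existence between a subsolution and a constant *)

Section Powers.
Context {R : realType}.
Implicit Types r x : R.

Lemma is_derive_powR r x : 0 < x -> is_derive x (1 : R) (fun y => y `^ r) (r * x `^ (r - 1)).
Proof.
move=> x0; have xin : x \in `]0, +oo[ by rewrite in_itv/= x0.
apply: DeriveDef; first exact: (@derivable_powR R 1 r x xin).
by rewrite -derive1E (@powR_derive1 R r x xin).
Qed.

Lemma powR_continuous r x : 0 < x -> {for x, continuous (fun y : R => y `^ r)}.
Proof.
move=> x0; have [d _] := is_derive_powR r x0.
by apply: differentiable_continuous; apply/derivable1_diffP.
Qed.

Lemma powR_le r s t : 0 <= r -> 0 <= s -> s <= t -> s `^ r <= t `^ r.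
Proof.
move=> r0 s0 st; apply: ge0_ler_powR => //.
by rewrite nnegrE (le_trans s0).
Qed.

End Powers.

Section TruncatedPower.
Context {R : realType}.
Variable p : R.
Hypothesis p01 : 0 < p < 1.

Let p0 : 0 < p. Proof. by case/andP: p01. Qed.
Let p1 : p < 1. Proof. by case/andP: p01. Qed.

(** The power t^p is not Lipschitz at 0; replacing it by kappa t there does not
    raise it. *)
Definition truncated_power (kappa t : R) : R :=
  Num.min (Num.max t 0 `^ p) (kappa * Num.max t 0).

Lemma truncated_power0 kappa : truncated_power kappa 0 = 0.
Proof. by rewrite /truncated_power maxxx powR0 ?mulr0 ?minxx// gt_eqF. Qed.

Let powR_mono s t : 0 <= s -> s <= t -> s `^ p <= t `^ p.
Proof. by apply: powR_le; exact: ltW. Qed.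

Lemma truncated_power_mono kappa s t : 0 <= kappa -> s <= t ->
  truncated_power kappa s <= truncated_power kappa t.
Proof.
move=> k0 st; rewrite /truncated_power.
have m : Num.max s 0 <= Num.max t 0 by rewrite ge_max !le_max st lexx orbT.
have s0 : 0 <= Num.max s 0 by rewrite le_max lexx orbT.
rewrite le_min; apply/andP; split; rewrite ge_min; apply/orP; [left|right].
  exact: powR_mono.
exact: ler_wpM2l.
Qed.

Lemma truncated_power_ge0 kappa t : 0 <= kappa -> 0 <= truncated_power kappa t.
Proof. by move=> k0; rewrite le_min powR_ge0/= mulr_ge0// le_max lexx orbT. Qed.

Lemma truncated_power_le kappa t : 0 <= t -> truncated_power kappa t <= t `^ p.
Proof. by move=> t0; rewrite /truncated_power (max_idPl t0) ge_min lexx. Qed.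

Lemma truncated_power_homo kappa kappa' t : kappa <= kappa' ->
  truncated_power kappa t <= truncated_power kappa' t.
Proof.
move=> kk; rewrite /truncated_power le_min !ge_min lexx/=.
by rewrite ler_wpM2r ?orbT// le_max lexx orbT.
Qed.

(** Where the minimum is the power, t^(p - 1) <= kappa, which bounds the slope
    p t^(p - 1). *)
Lemma truncated_power_lipschitz kappa s t : 0 <= kappa ->
  `|truncated_power kappa s - truncated_power kappa t| <= kappa * `|s - t|.
Proof.
move=> k0; wlog ts : s t / t <= s.
  move=> W; case: (leP t s) => [|/ltW] h; first exact: W.
  by rewrite distrC [X in _ <= _ * X]distrC; exact: W.
rewrite ger0_norm ?subr_ge0 ?truncated_power_mono// ger0_norm ?subr_ge0//.
have m : Num.max s 0 - Num.max t 0 <= s - t.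
  by case: (leP s 0) => s0; case: (leP t 0) => t0; lra.
apply: (@le_trans _ _ (kappa * (Num.max s 0 - Num.max t 0))); last by rewrite ler_wpM2l.
rewrite /truncated_power.
have : Num.max t 0 <= Num.max s 0 by rewrite ge_max !le_max ts lexx orbT.
have : 0 <= Num.max t 0 by rewrite le_max lexx orbT.
move: (Num.max s 0) (Num.max t 0) => x y; rewrite le_eqVlt => /predU1P[<- _|y0 yx].
  by rewrite powR0 ?gt_eqF// mulr0 minxx !subr0 ge_min lexx orbT.
have [yk|ky] := leP (y `^ p) (kappa * y); last first.
  by rewrite mulrBr lerD2r ge_min lexx orbT.
rewrite lerBlDr ge_min; apply/orP; left.
have xy1 : 1 <= x / y by rewrite ler_pdivlMr// mul1r.
have xE : x = x / y * y by rewrite divfK// gt_eqF.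
rewrite {1}xE powRM ?(ltW y0)//; last by rewrite (le_trans _ xy1).
have h1 : (x / y) `^ p <= x / y by apply: ler1_powR => //; exact: ltW.
apply: (@le_trans _ _ (x / y * y `^ p)); first by rewrite ler_wpM2r// powR_ge0.
rewrite -lerBlDr.
have -> : x / y * y `^ p - y `^ p = (x / y - 1) * y `^ p by rewrite mulrBl mul1r.
have -> : x - y = (x / y - 1) * y by rewrite mulrBl mul1r -xE.
rewrite mulrCA.
by rewrite ler_wpM2l ?subr_ge0.
Qed.

Lemma powR_cvg (u : nat -> R) (l : R) : 0 < l -> u @ \oo --> l ->
  (fun n => u n `^ p) @ \oo --> l `^ p.
Proof.
move=> l0 ul; apply: (@cvg_comp _ _ _ u (fun y : R => y `^ p) _ _ _ ul).
exact: powR_continuous.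
Qed.

Lemma truncated_power_cvg (kappa u : nat -> R) (l : R) :
  (forall n, n%:R <= kappa n) -> 0 < l -> u @ \oo --> l ->
  (fun n => truncated_power (kappa n) (u n)) @ \oo --> l `^ p.
Proof.
move=> kn l0 ul; apply: cvg_trans (powR_cvg l0 ul); apply: near_eq_cvg.
have l2 : l / 2 < l by lra.
have l2' : l < 2 * l by lra.
near=> n.
have un : l / 2 < u n by near: n; exact: (cvgr_gt _ ul).
have un' : u n < 2 * l by near: n; exact: (cvgr_lt _ ul).
have nl : (2 * l) `^ p / (l / 2) < kappa n.
  apply: lt_le_trans (kn n); near: n.
  exists (Num.truncn ((2 * l) `^ p / (l / 2))).+1 => // n /= hn.
  by apply: lt_le_trans (truncnS_gt _) _; rewrite ler_nat.
have u0 : 0 < u n by lra.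
rewrite /truncated_power (max_idPl (ltW u0)); apply/esym/min_idPl.
apply: (@le_trans _ _ ((2 * l) `^ p)); first by apply: powR_mono; exact: ltW.
rewrite ltr_pdivrMr ?divr_gt0// in nl; apply: (le_trans (ltW nl)).
by rewrite ler_wpM2l ?(le_trans _ (kn n))// ltW.
Unshelve. all: by end_near. Qed.

End TruncatedPower.

Section Iteration.
Context {R : realType}.
Local Notation mu := (@lebesgue_measure R).
Variables (a b p : R) (S P N C psi : R -> R).
Hypothesis ab : a < b.
Hypothesis hS : scale_function a b S.
Hypothesis p01 : 0 < p < 1.
Hypotheses (Pi : seg_integrable a b P) (Ni : seg_integrable a b N)
  (Ci : seg_integrable a b C).
Hypotheses (P0 : forall y, 0 <= P y) (N0 : forall y, 0 <= N y)
  (C0 : forall y, 0 <= C y).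
Hypothesis cpsi : {within `[a, b], continuous psi}.
Hypotheses (psia : psi a <= 0) (psib : psi b <= 0).
Hypothesis psi0 : forall x, x \in `]a, b[ -> 0 < psi x.
Hypothesis subpsi :
  subsolution a b S (fun y t => (P y - N y) * t `^ p - C y * t) psi.

Let p0 : 0 < p. Proof. by case/andP: p01. Qed.
Let p1 : p < 1. Proof. by case/andP: p01. Qed.

Let g n := truncated_power p n.+1%:R.
Let A n := absorption C N (g n).

Let gmono n s t : s <= t -> g n s <= g n t.
Proof. exact: truncated_power_mono. Qed.

Let glip n s t : `|g n s - g n t| <= n.+1%:R * `|s - t|.
Proof. exact: truncated_power_lipschitz. Qed.

Let g0 n : g n 0 = 0. Proof. exact: truncated_power0. Qed.

Let Amono n y s t : s <= t -> A n y s <= A n y t.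
Proof. exact: (absorption_mono C0 N0 (@gmono n)). Qed.

Let A0 n y : A n y 0 = 0.
Proof. by rewrite /A /absorption mulr0 g0 mulr0 addr0. Qed.

Let Ai n v : bounded_measurable a b v -> seg_integrable a b (fun y => A n y (v y)).
Proof. by move=> bv; apply: (absorption_integrable Ci Ni C0 N0 (@glip n) (g0 n)). Qed.

Let powi v : bounded_measurable a b v -> (forall y, 0 <= v y) ->
  seg_integrable a b (fun y => P y * v y `^ p).
Proof.
move=> [mv [M vM]] v0.
apply: (@seg_integrable_le _ _ _ _ (fun y => M `^ p * P y)).
- apply: measurable_funM; first exact: seg_measurable_fun.
  by apply: (@measurableT_comp _ _ _ _ _ _ (fun t : R => t `^ p) _ v _ mv); exact: measurable_powR.
- move=> y yab; rewrite normrM !ger0_norm ?powR_ge0// mulrC ler_wpM2r//.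
  by apply: powR_le => //; [exact: ltW|rewrite -(ger0_norm (v0 y)) vM].
- exact: seg_integrableZ.
Qed.

(** Monotone iteration from the constant K: the iterate of index n + 1 has the
    source P v^p of its predecessor v and an absorption truncated at level n + 1.
    The iterates decrease, since a source that decreases and an absorption that
    increases lower the solution, and they stay above psi.  Their limit is
    positive, the truncation is eventually inactive at each point, and the
    integral equation passes to the limit by dominated convergence. *)
Theorem solution_above_subsolution : exists u, [/\ continuous u,
  forall x, x \in `[a, b] -> psi x <= u x,
  exists M, forall x, 0 <= u x <= M,
  seg_integrable a b (fun y => (P y - N y) * u y `^ p - C y * u y) &
  forall x, u x = Green S a b (fun y => (P y - N y) * u y `^ p - C y * u y) x].
Proof.
have [Mpsi Mpsi0 psiM] := seg_continuous_bounded cpsi.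
(* As p < 1, a large K satisfies E K^p <= K, where E K^p bounds the Green
   potential of P K^p. *)
pose E := S b * segint a b P.
have E0 : 0 <= E by rewrite mulr_ge0 ?(ltW (scale_b_gt0 ab hS))// segint_ge0.
pose K := Mpsi + E `^ (1 - p)^-1 + 1.
have K0 : 0 < K by rewrite ltr_wpDl// addr_ge0// powR_ge0.
have EK : E * K `^ p <= K.
  have E1 : E <= K `^ (1 - p).
    have EE : E = (E `^ (1 - p)^-1) `^ (1 - p).
      by rewrite -powRrM mulVf ?powRr1// gt_eqF ?subr_gt0.
    rewrite {1}EE; apply: powR_le; rewrite ?powR_ge0//.
    - by rewrite subr_ge0 ltW.
    - by rewrite /K -addrA ler_wpDl// lerDl.
  apply: (@le_trans _ _ (K `^ (1 - p) * K `^ p)); first by rewrite ler_wpM2r ?powR_ge0.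
  by rewrite -powRD ?subrK ?powRr1 ?(ltW K0)// oner_eq0.
have psiK x : x \in `[a, b] -> psi x <= K.
  move=> xab; apply: (le_trans (ler_norm _)); apply: (le_trans (psiM x xab)).
  by rewrite /K -addrA lerDl addr_ge0// powR_ge0.
have [sol solP] : {sol : (nat * (R -> R)) -> R -> R & forall nw,
    bounded_measurable a b nw.2 -> (forall y, 0 <= nw.2 y) ->
    continuous (sol nw) /\
    forall x, sol nw x =
      Green S a b (fun y => P y * nw.2 y `^ p - 1 * A nw.1 y (sol nw y)) x}.
  apply: (@choice _ _ (fun nw w => bounded_measurable a b nw.2 ->
    (forall y, 0 <= nw.2 y) -> continuous w /\
    forall x, w x = Green S a b (fun y => P y * nw.2 y `^ p - 1 * A nw.1 y (w y)) x)).
  move=> [n w] /=.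
  have [bw|nbw] := pselect (bounded_measurable a b w); last by exists (fun=> 0).
  have [w0|nw0] := pselect (forall y, 0 <= w y); last by exists (fun=> 0).
  have [v cv vE] := solvable1 ab hS Ci Ni C0 N0 (@gmono n) (@glip n) (g0 n) (powi bw w0).
  by exists v.
pose v := fix v n := if n is m.+1 then sol (m, v m) else fun=> K.
have vS n : v n.+1 = sol (n, v n) by [].
pose F n y := P y * v n y `^ p - A n y (v n.+1 y).
have inv n : bounded_measurable a b (v n) /\ (forall y, 0 <= v n y) ->
  [/\ continuous (v n.+1), seg_integrable a b (F n) &
      forall x, v n.+1 x = Green S a b (F n) x].
  move=> [bv v0]; have [cv vE] := solP (n, v n) bv v0.
  split => //.
  - by apply: seg_integrableB; [exact: powi|exact/Ai/continuous_bounded_measurable].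
  - by move=> x; rewrite vS vE; apply: eq_Green => y _; rewrite mul1r.
have vpos n : bounded_measurable a b (v n) /\ (forall y, 0 <= v n y).
  elim: n => [|n IH].
    split=> [|y]; last exact: ltW.
    split; first exact: measurable_cst.
    by exists K => x _; rewrite ger0_norm// ltW.
  have [cv Fi vE] := inv n IH.
  split=> [|x]; first exact: continuous_bounded_measurable.
  rewrite -(Green0 S ab x).
  rewrite vE; apply: (Green_comparison ab hS) => //.
    apply: seg_continuous_integrable => y; exact: cvg_cst.
  apply: aeW => y _; rewrite -vE => vneg.
  have vy0 : v n.+1 y <= 0.
    by apply: ltW; move: vneg; rewrite Green0.
  have := Amono n y vy0; rewrite A0 => An.
  by rewrite /F subr_ge0 (le_trans An)// mulr_ge0// powR_ge0.
have cv n := let: And3 c _ _ := inv n (vpos n) in c.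
have Fi n := let: And3 _ c _ := inv n (vpos n) in c.
have vE n := let: And3 _ _ c := inv n (vpos n) in c.
have v0 n := (vpos n).2.
have psiv n x : x \in `[a, b] -> psi x <= v n x.
  elim: n x => [|n IH] x xab; first exact: psiK.
  rewrite vE; apply: (Green_ge_subsolution ab hS (Fi n) cpsi psia psib subpsi) => //.
  apply: aeW => y yab t; rewrite -vE => vt tpsi.
  have yab' : y \in `[a, b] by exact: subset_itv_oo_cc.
  have t0 : 0 <= t by apply: le_trans (ltW vt).
  have h1 : P y * t `^ p <= P y * v n y `^ p.
    by rewrite ler_wpM2l// powR_le// ?(ltW p0)// (le_trans tpsi)// IH.
  have h2 : N y * g n (v n.+1 y) <= N y * t `^ p.
    rewrite ler_wpM2l//; apply: (le_trans (truncated_power_le _ _ (v0 n.+1 y))).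
    by apply: powR_le; [exact: ltW|exact: v0|exact: ltW].
  have h3 : C y * v n.+1 y <= C y * t by rewrite ler_wpM2l// ltW.
  by rewrite /F /A /absorption; lra.
have vdec n x : v n.+1 x <= v n x.
  elim: n x => [|n IH] x.
    apply: (@le_trans _ _ (Green S a b (fun y => P y * v 0%N y `^ p) x)).
      have Pv := powi (vpos 0%N).1 (v0 0%N).
      rewrite vE; apply: (Green_comparison ab hS) => //.
      apply: aeW => y _ _; rewrite /F gerBl.
      by rewrite -(A0 0%N y); exact: Amono.
    apply: (le_trans (ler_norm _)); apply: (le_trans (Green_bound ab hS x (powi (vpos 0%N).1 (v0 0%N)))).
    rewrite (@eq_segint _ _ _ _ (fun y => K `^ p * P y)).
      by rewrite segintZ// mulrCA mulrC.
    by move=> y _; rewrite ger0_norm ?mulr_ge0 ?powR_ge0// mulrC.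
  rewrite (vE n.+1) (vE n); apply: (Green_comparison ab hS) => //.
  apply: aeW => y _; rewrite -!vE => vv; rewrite /F lerB//.
    by rewrite ler_wpM2l// powR_le// ltW.
  apply: (le_trans (Amono n y (ltW vv))).
  rewrite /A /absorption lerD2l ler_wpM2l//.
  by apply: truncated_power_homo; rewrite ler_nat.
have vK n x : v n x <= K.
  by elim: n => [|n IH] //; apply: le_trans (vdec n x) IH.
pose w x := limn (v ^~ x).
have vw x : v ^~ x @ \oo --> w x.
  apply: nonincreasing_is_cvgn; first by apply/nonincreasing_seqP => n; exact: vdec.
  by exists 0 => _ [n _ <-]; exact: v0.
have vwS k x : (fun n => v (n + k)%N x) @ \oo --> w x.
  by rewrite (cvg_shiftn k (v ^~ x)); exact: vw.
have psiw x : x \in `[a, b] -> psi x <= w x.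
  by move=> xab; apply: (cvgr_to_ge (vw x)); apply: nearW => n; exact: psiv.
have w0K x : 0 <= w x <= K.
  apply/andP; split.
    by apply: (cvgr_to_ge (vw x)); apply: nearW => n; exact: v0.
  by apply: (cvgr_to_le (vw x)); apply: nearW => n; exact: vK.
have vab n y : (y == a) || (y == b) -> v n.+1 y = 0.
  by case/orP => /eqP ->; rewrite vE (Green_out ab hS) ?lexx ?orbT.
have Glim x : seg_integrable a b (fun y => (P y - N y) * w y `^ p - C y * w y) /\
   (fun n => v (n + 2)%N x) @ \oo --> Green S a b (fun y => (P y - N y) * w y `^ p - C y * w y) x.
  rewrite (_ : (fun n => v (n + 2)%N x) = (fun n => Green S a b ((fun n => F n.+1) n) x)); last first.
    by apply/funext => n; rewrite addn2 vE.
  apply: (@Green_cvg _ _ _ _ ab hS _ _ (fun y => K `^ p * P y + (K * C y + K `^ p * N y))) => //.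
  - by move=> n; apply: seg_measurable_fun; exact: Fi.
  - move=> y yab; have [yb|yin] := boolP ((y == a) || (y == b)).
      have wy0 : w y = 0.
        apply: (cvg_unique _ (vwS 1%N y)) => //.
        rewrite (_ : (fun n => _) = fun=> 0); first exact: cvg_cst.
        by apply/funext => n; rewrite addn1 vab.
      rewrite wy0 powR0 ?gt_eqF// !mulr0 subr0.
      rewrite (_ : (fun n => _) = fun=> 0); first exact: cvg_cst.
      apply/funext => n; rewrite /F !vab// powR0 ?gt_eqF// mulr0 A0 subr0//.
    have yoo : y \in `]a, b[.
      move: yab; rewrite !in_itv /= !le_eqVlt => /andP[+ +].
      by move: yin; rewrite negb_or ![y == _]eq_sym => /andP[/negbTE -> ]; rewrite eq_sym => /negbTE -> /= -> ->.
    have wy0 : 0 < w y by apply: lt_le_trans (psi0 yoo) (psiw _ yab).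
    have -> : (P y - N y) * w y `^ p - C y * w y =
      P y * w y `^ p - (C y * w y + N y * w y `^ p) by ring.
    have v1 : (fun n => v n.+1 y) @ \oo --> w y by have := vwS 1%N y; under eq_fun do rewrite addn1.
    have v2 : (fun n => v n.+2 y) @ \oo --> w y by have := vwS 2%N y; under eq_fun do rewrite addn2.
    apply: cvgB; first by apply: cvgM; [exact: cvg_cst|apply: powR_cvg => //].
    apply: cvgD; first by apply: cvgM; [exact: cvg_cst|exact: v2].
    apply: cvgM; first exact: cvg_cst.
    by apply: truncated_power_cvg => // n; rewrite ler_nat ltnW.
  - by apply: seg_integrableD; [|apply: seg_integrableD]; exact: seg_integrableZ.
  - move=> n y _.
    have vp : v n.+1 y `^ p <= K `^ p by apply: powR_le; rewrite ?(ltW p0).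
    have v2 := vK n.+2 y; have v20 := v0 n.+2 y.
    have gv : g n.+1 (v n.+2 y) <= K `^ p.
      apply: (le_trans (truncated_power_le _ _ v20)).
      by apply: powR_le; rewrite ?(ltW p0).
    have gv0 : 0 <= g n.+1 (v n.+2 y) by exact: truncated_power_ge0.
    apply: (le_trans (ler_normB _ _)); rewrite /A /absorption.
    rewrite ger0_norm ?mulr_ge0 ?powR_ge0// ger0_norm ?addr_ge0 ?mulr_ge0//.
    by apply: lerD; [|apply: lerD]; rewrite mulrC ler_wpM2r.
exists w; split => //.
- rewrite (_ : w = Green S a b (fun y => (P y - N y) * w y `^ p - C y * w y)).
    by apply: (Green_continuous ab hS); have [] := Glim a.
  by apply/funext => x; apply: (cvg_unique _ (vwS 2%N x) (Glim x).2).
- by exists K.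
- by have [] := Glim a.
- by move=> x; apply: (cvg_unique _ (vwS 2%N x) (Glim x).2).
Qed.

End Iteration.

(** * Lebesgue spaces on a bounded interval *)

Section Lebesgue.
Context {R : realType}.
Local Notation mu := (@lebesgue_measure R).
Implicit Types (c d : R) (f g : R -> R).

Lemma oo_cc_measurable c d f : measurable_fun `]c, d[ f -> measurable_fun `[c, d] f.
Proof.
have [cd|dc] := ltP c d => mf; last first.
  move: dc; rewrite le_eqVlt => /predU1P[->|dc].
    by rewrite set_itv1; exact: measurable_fun_set1.
  by rewrite set_itv_ge ?bnd_simp -?ltNge//; exact: measurable_fun_set0.
apply/measurable_EFinP/emeasurable_fun_itv_bndo_bndcP.
by apply/emeasurable_fun_itv_obnd_cbndP/measurable_EFinP.
Qed.

Lemma patch_measurable (D : set R) f : measurable D ->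
  measurable_fun setT (f \_ D) -> measurable_fun D f.
Proof. by move=> mD /(measurable_restrictT _ mD). Qed.

Lemma inLp_measurable c d q f : inLp q `]c, d[ f -> measurable_fun `[c, d] f.
Proof.
rewrite /inLp inE => /andP[/[!inE]/= mf _].
by apply: oo_cc_measurable; exact: patch_measurable mf.
Qed.

Lemma oo_seg_integrable c d f :
  mu.-integrable `]c, d[ (EFin \o f) -> seg_integrable c d f.
Proof.
move=> fi; have mf := measurable_int _ fi.
have mf' : measurable_fun `[c, d] f by apply: oo_cc_measurable; exact/measurable_EFinP.
apply/integrableP; split; first exact/measurable_EFinP.
rewrite (@integral_itv_bndoo R c d (fun x => `|(EFin \o f) x|)%E true false).
  by case/integrableP: fi.
exact: measurableT_comp.
Qed.

Lemma inLp2_elim c d f : inLp 2%:E `]c, d[ f -> seg_integrable c d (fun x => f x ^+ 2).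
Proof.
move=> h; have h2 := Lfun2_integrable_sqr h.
apply: oo_seg_integrable.
apply: (@integrable_mkcond _ _ R mu _ (EFin \o (fun x => f x ^+ 2)) (measurable_itv _)).2.
rewrite restrict_EFin.
apply: eq_integrable h2 => // x _ /=; congr (_%:E).
by rewrite !patchE; case: ifP => // _; rewrite expr0n.
Qed.

Lemma sqr_integrable c d f : measurable_fun `[c, d] f ->
  seg_integrable c d (fun x => f x ^+ 2) -> seg_integrable c d f.
Proof.
move=> mf fi; apply: (@seg_integrable_le _ _ _ _ (fun x => 1 + f x ^+ 2)) => //.
- move=> x _; have := sqr_ge0 (`|f x| - 1); rewrite -(real_normK (num_real (f x))).
  by have := normr_ge0 (f x); nra.
- apply: seg_integrableD => //.
  by apply: seg_continuous_integrable => x; exact: cvg_cst.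
Qed.

Lemma inLp2_integrable c d f : inLp 2%:E `]c, d[ f -> seg_integrable c d f.
Proof.
by move=> h; apply: sqr_integrable; [exact: inLp_measurable h|exact: inLp2_elim].
Qed.

Lemma Lnorm2_sqr c d f : measurable_fun `[c, d] f ->
  seg_integrable c d (fun x => f x ^+ 2) ->
  ('N[mu]_2%:E[EFin \o (f \_ `]c, d[)] = (Num.sqrt (segint c d (fun x => f x ^+ 2)))%:E)%E.
Proof.
move=> mf fi; rewrite unlock /=.
have fi' : mu.-integrable `]c, d[ (EFin \o (fun x => f x ^+ 2)).
  by apply: integrableS fi => //; apply: subset_itv; rewrite bnd_simp.
have -> : (\int[mu]_x (`|((f \_ `]c, d[) x)%:E| `^ 2) = (segint c d (fun x => f x ^+ 2))%:E)%E.
  rewrite -segint_oo// -EFin_Rintegral// [RHS]integral_mkcond.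
  apply: eq_integral => x _; rewrite restrict_EFin /= !patchE.
  case: ifP => _; rewrite ?normr0 ?powR0//.
  by rewrite -[2%R]/(2%:R) powR_mulrn// real_normK// num_real.
by rewrite /= powR12_sqrt// segint_ge0// => x _; exact: sqr_ge0.
Qed.

Lemma inLp2_intro c d f : measurable_fun `[c, d] f ->
  seg_integrable c d (fun x => f x ^+ 2) -> inLp 2%:E `]c, d[ f.
Proof.
move=> mf fi; rewrite /inLp inE; apply/andP; split; rewrite inE /=.
  apply/(measurable_restrictT _ (measurable_itv _)).
  by apply: measurable_funS mf => //; apply: subset_itv; rewrite bnd_simp.
by rewrite /finite_norm Lnorm2_sqr// ltry.
Qed.

Lemma Lpnorm2E c d f : inLp 2%:E `]c, d[ f ->
  Lpnorm 2%:E `]c, d[ f = Num.sqrt (segint c d (fun x => f x ^+ 2)).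
Proof.
by move=> h; rewrite /Lpnorm Lnorm2_sqr//; [exact: inLp_measurable h|exact: inLp2_elim].
Qed.

Lemma continuous_inLp2 c d f : {within `[c, d], continuous f} -> inLp 2%:E `]c, d[ f.
Proof.
move=> cf; apply: inLp2_intro; first exact: seg_continuous_measurable.
apply: (@eq_seg_integrable _ _ _ (fun x => f x * f x)) => [x _|]; first by rewrite expr2.
by apply: seg_continuous_integrable => x; apply: cvgM; exact: cf.
Qed.

Lemma inLp2D c d f g : inLp 2%:E `]c, d[ f -> inLp 2%:E `]c, d[ g ->
  inLp 2%:E `]c, d[ (fun x => f x + g x).
Proof.
move=> hf hg; have [mf mg] := (inLp_measurable hf, inLp_measurable hg).
apply: inLp2_intro; first exact: measurable_funD.
apply: (@seg_integrable_le _ _ _ _ (fun x => 2 * f x ^+ 2 + 2 * g x ^+ 2)).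
- by apply: measurable_funX; exact: measurable_funD.
- move=> x _; rewrite ger0_norm ?sqr_ge0//.
  by have := sqr_ge0 (f x - g x); nra.
- by apply: seg_integrableD; apply: seg_integrableZ; exact: inLp2_elim.
Qed.

Lemma inLp2_mulb c d M f g : measurable_fun `[c, d] g ->
  (forall x, x \in `[c, d] -> `|g x| <= M) -> inLp 2%:E `]c, d[ f ->
  inLp 2%:E `]c, d[ (fun x => g x * f x).
Proof.
move=> mg gM hf; have mf := inLp_measurable hf.
apply: inLp2_intro; first exact: measurable_funM.
apply: (@seg_integrable_le _ _ _ _ (fun x => M ^+ 2 * f x ^+ 2)).
- by apply: measurable_funX; exact: measurable_funM.
- move=> x xcd; rewrite ger0_norm ?sqr_ge0// exprMn ler_wpM2r ?sqr_ge0//.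
  rewrite -(real_normK (num_real (g x))); apply: lerXn2r; rewrite ?nnegrE ?gM//.
  by apply: le_trans (gM _ xcd).
- by apply: seg_integrableZ; exact: inLp2_elim.
Qed.

(** By Young's inequality |f| <= e + f^2 / e. *)
Lemma segint_norm_Lpnorm2 c d f e : c <= d -> 0 < e -> inLp 2%:E `]c, d[ f ->
  Lpnorm 2%:E `]c, d[ f <= e ->
  segint c d (fun x => `|f x|) <= (d - c + 1) * e.
Proof.
move=> cd e0 hf; rewrite Lpnorm2E// => fe.
have f2i := inLp2_elim hf; have fi := inLp2_integrable hf.
have I2 : segint c d (fun x => f x ^+ 2) <= e ^+ 2.
  rewrite -(sqr_sqrtr (_ : 0 <= segint c d (fun x => f x ^+ 2))); last first.
    by apply: segint_ge0 => x _; exact: sqr_ge0.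
  by apply: lerXn2r; rewrite ?nnegrE ?sqrtr_ge0// ltW.
apply: (@le_trans _ _ (segint c d (fun x => e + e^-1 * f x ^+ 2))).
  apply: segint_le.
  - exact: seg_integrable_norm.
  - apply: seg_integrableD; last exact: seg_integrableZ.
    by apply: seg_continuous_integrable => x; exact: cvg_cst.
  move=> x _.
  have -> : e + e^-1 * f x ^+ 2 = (e ^+ 2 + `|f x| ^+ 2) / e.
    by rewrite real_normK ?num_real//; field; rewrite gt_eqF.
  rewrite ler_pdivlMr//.
  by have := sqr_ge0 (`|f x| - e); have := normr_ge0 (f x); nra.
rewrite segintD; last 2 first.
- by apply: seg_continuous_integrable => x; exact: cvg_cst.
- exact: seg_integrableZ.
rewrite segint_cst// segintZ// mulrDl mul1r mulrC lerD2l.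
by rewrite ler_pdivrMl// -expr2.
Qed.

Lemma Lpnorm1E c d f : seg_integrable c d f ->
  Lpnorm 1%E `]c, d[ f = segint c d (fun x => `|f x|).
Proof.
move=> fi; rewrite /Lpnorm Lnorm1 -segint_oo; last exact: seg_integrable_norm.
rewrite /Rintegral; congr fine; rewrite [RHS]integral_mkcond.
apply: eq_integral => x _; rewrite restrict_EFin /= !patchE.
by case: ifP => _; rewrite ?normr0.
Qed.

Lemma Lnormy_ae (f : R -> R) (D : set R) :
  ('N[mu]_+oo[EFin \o (f \_ D)] \is a fin_num)%E ->
  {ae mu, forall x, D x -> `|f x| <= Lpnorm +oo%E D f}.
Proof.
rewrite /Lpnorm unlock /=; case: ifP => [_|] hfin; last first.
  by move: hfin; rewrite -set_itvE lebesgue_measure_itv /= addye// ltry.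
have := ess_sup_ge mu (fun x => `|((f \_ D) x)%:E|%E).
move=> /ae_imp; apply => x h Dx; rewrite -lee_fin fineK//.
by move: h; rewrite patchE mem_set.
Qed.

(** A nonzero value of Lpnorm shows that the norm is finite, as fine sends an
    infinite norm to 0. *)
Lemma Lpnormy_ae (f : R -> R) (D : set R) : Lpnorm +oo%E D f != 0 ->
  {ae mu, forall x, D x -> `|f x| <= Lpnorm +oo%E D f}.
Proof.
rewrite /Lpnorm => h; apply: Lnormy_ae.
by move: h; case: ('N[mu]_+oo[_])%E => //=; rewrite eqxx.
Qed.

Lemma inLpy_ae (f : R -> R) (D : set R) : inLp +oo%E D f ->
  {ae mu, forall x, D x -> `|f x| <= Lpnorm +oo%E D f}.
Proof.
rewrite /inLp inE => /andP[_]; rewrite inE /= /finite_norm => h.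
by apply: Lnormy_ae; rewrite ge0_fin_numE// Lnorm_ge0.
Qed.

Lemma Lpnorm_ge0 q (D : set R) f : 0 <= Lpnorm q D f.
Proof. by rewrite /Lpnorm fine_ge0// Lnorm_ge0. Qed.

End Lebesgue.

(** * Absolutely continuous functions and test functions *)

Section AbsolutelyContinuous.
Context {R : realType}.
Local Notation mu := (@lebesgue_measure R).
Implicit Types (a b c d : R).

(** U is absolutely continuous, with derivative h almost everywhere. *)
Definition antiderivative c d (U h : R -> R) :=
  forall x, x \in `[c, d] -> U x = U c + segint c x h.

Lemma antiderivative_continuous c d U h : c <= d -> seg_integrable c d h ->
  antiderivative c d U h -> {within `[c, d], continuous U}.
Proof.
move=> cd hi Uh.
have cI := segint_continuous cd hi.
apply: (@subspace_eq_continuous _ _ _ (fun x => U c + segint c x h)).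
  by move=> x; rewrite inE => xcd; exact/esym/Uh.
by move=> x; apply: cvgD; [exact: cvg_cst|exact: cI].
Qed.

Lemma antiderivative_sub c d c' d' U h : c <= c' -> d' <= d -> seg_integrable c d h ->
  antiderivative c d U h -> antiderivative c' d' U h.
Proof.
move=> cc dd hi Uh x; rewrite in_itv /= => /andP[c'x xd'].
have xcd : x \in `[c, d] by rewrite in_itv /= (le_trans cc c'x) (le_trans xd').
have c'cd : c' \in `[c, d] by rewrite in_itv /= cc (le_trans c'x (le_trans xd' dd)).
rewrite (Uh x)// (Uh c')// (@segint_split _ c c' x) ?cc ?addrA//.
by apply: seg_integrableS hi => //; exact: le_trans dd.
Qed.

(** The product rule; segint_triangle takes the place of an integration by
    parts. *)
Lemma antiderivative_mul c d (G g U h : R -> R) : c <= d ->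
  {within `[c, d], continuous G} -> {within `[c, d], continuous g} ->
  (forall x, x \in `]c, d[ -> is_derive x 1 G (g x)) ->
  seg_integrable c d h -> antiderivative c d U h ->
  antiderivative c d (fun x => G x * U x) (fun x => g x * U x + G x * h x).
Proof.
move=> cd cG cg dG hi Uh x xcd.
have := xcd; rewrite in_itv /= => /andP[cx xd].
have sub : {subset `[c, x] <= `[c, d]}.
  by move=> y; rewrite !in_itv /= => /andP[-> yx]; rewrite (le_trans yx).
have cU := antiderivative_continuous cd hi Uh.
have gi : seg_integrable c d g by exact: seg_continuous_integrable.
have gi' : seg_integrable c x g by exact: seg_integrableS gi.
have hi' : seg_integrable c x h by exact: seg_integrableS hi.
have Ghi : seg_integrable c d (fun y => G y * h y) by exact: seg_integrable_mulc.
have Ghi' : seg_integrable c x (fun y => G y * h y) by exact: seg_integrableS Ghi.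
have gUi : seg_integrable c d (fun y => g y * U y).
  by apply: seg_continuous_integrable => y; apply: cvgM; [exact: cg|exact: cU].
rewrite segintD//; last exact: seg_integrableS gUi.
have FTC y : c <= y <= x -> segint y x g = G x - G y.
  move=> /andP[cy yx].
  have sub' : [set` `[y, x]] `<=` [set` `[c, d]].
    by apply: subset_itv; rewrite bnd_simp.
  have h1 : {within `[y, x], continuous g} by exact: continuous_subspaceW sub' cg.
  have h2 : {within `[y, x], continuous G} by exact: continuous_subspaceW sub' cG.
  have h3 : forall z : R, z \in `]y, x[ -> is_derive z (1 : R) G (g z).
    move=> z; rewrite in_itv /= => /andP[yz zx]; apply: dG.
    by rewrite in_itv /= (le_lt_trans cy yz) (lt_le_trans zx xd).
  exact: (segint_FTC2 yx h1 h2 h3).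
have -> : segint c x (fun y => g y * U y) = U c * (G x - G c) +
    segint c x (fun y => g y * segint c y h).
  rewrite -FTC ?lexx// -segintZ// -segintD; last 2 first.
  - exact: seg_integrableZ.
  - apply: (@eq_seg_integrable _ _ _ (fun y => g y * U y - U c * g y)).
      by move=> y /sub ycd; rewrite (Uh y ycd); ring.
    by apply: seg_integrableB; [exact: seg_integrableS gUi|exact: seg_integrableZ].
  by apply: eq_segint => y /sub ycd; rewrite (Uh y ycd); ring.
rewrite segint_triangle//.
have -> : segint c x (fun y => h y * segint y x g) =
    G x * segint c x h - segint c x (fun y => G y * h y).
  rewrite -segintZ// -segintB//; last exact: seg_integrableZ.
  by apply: eq_segint => y; rewrite in_itv /= => /FTC ->; ring.
by rewrite (Uh x xcd); ring.
Qed.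

Lemma test_function0 a b (f : R -> R) x : test_function a b f -> x \notin `]a, b[ -> f x = 0.
Proof.
move=> [_ _ _ sf] xab; apply/eqP; apply: contraNT xab => fx.
by apply: sf; apply: subset_closure.
Qed.

Lemma test_function_continuous a b f : test_function a b f -> continuous f.
Proof.
move=> [df _ _ _] x; apply: differentiable_continuous; apply/derivable1_diffP.
exact: df.
Qed.

(** The product rule for U f, which vanishes at both end points. *)
Lemma weak_derivative_antiderivative a b (U h : R -> R) : a < b -> seg_integrable a b h ->
  antiderivative a b U h -> weak_derivative a b U h.
Proof.
move=> ab hi Uh f tf.
have cf := test_function_continuous tf; have [df cf' _ _] := tf.
have cU := antiderivative_continuous (ltW ab) hi Uh.
have wf : {within `[a, b], continuous f} by exact: continuous_subspaceT.
have wf' : {within `[a, b], continuous (derive1 f)} by exact: continuous_subspaceT.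
have Ufi : seg_integrable a b (fun x => U x * derive1 f x).
  by apply: seg_continuous_integrable => y; apply: cvgM; [exact: cU|exact: wf'].
have hfi : seg_integrable a b (fun x => h x * f x).
  apply: (@eq_seg_integrable _ _ _ (fun y => f y * h y)) => [x _|]; first by rewrite mulrC.
  exact: seg_integrable_mulc.
rewrite !segint_oo//.
have df1 : forall x : R, x \in `]a, b[ -> is_derive x (1 : R) f (derive1 f x).
  by move=> x _; apply: DeriveDef; [exact: df|rewrite derive1E].
have bab : b \in `[a, b] by rewrite in_itv /= lexx ltW.
have := antiderivative_mul (ltW ab) wf wf' df1 hi Uh bab.
rewrite !(test_function0 tf) ?in_itv /= ?ltxx ?andbF//.
rewrite !mul0r add0r (@eq_segint _ _ _ _ (fun x => U x * derive1 f x + h x * f x)); last first.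
  by move=> x _; ring.
by rewrite segintD// => /eqP; rewrite eq_sym addr_eq0 => /eqP.
Qed.

Lemma sobolev12_antiderivative a b (U h : R -> R) : a < b -> inLp 2%:E `]a, b[ h ->
  antiderivative a b U h -> sobolev12 a b U h.
Proof.
move=> ab h2 Uh; have hi := inLp2_integrable h2.
split => //; last exact: weak_derivative_antiderivative.
exact/continuous_inLp2/(antiderivative_continuous (ltW ab) hi Uh).
Qed.

Lemma test_function_primitive a b c d (g : R -> R) : a < c -> c <= d -> d < b -> continuous g ->
  (forall x, x <= c -> g x = 0) -> (forall x, d <= x -> g x = 0) ->
  segint a b g = 0 ->
  test_function a b (fun x => segint a x g) /\ derive1 (fun x => segint a x g) = g.
Proof.
move=> ac cd db cg gc gd g0.
have gi x y : seg_integrable x y g.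
  by apply: seg_continuous_integrable; exact: continuous_subspaceT.
have zero x y : (forall z, z \in `[x, y] -> g z = 0) -> segint x y g = 0.
  move=> gz; have [xy|yx] := leP x y; last by rewrite segint_gt.
  by rewrite (@eq_segint _ _ _ _ (fun=> 0)) ?segint_cst ?mul0r.
have f0c x : x <= c -> segint a x g = 0.
  move=> xc; apply: zero => z; rewrite in_itv /= => /andP[_ zx].
  by apply: gc; exact: le_trans xc.
have f0d x : d <= x -> segint a x g = 0.
  move=> dx; have ad : a <= d by rewrite (le_trans (ltW ac)).
  have adE y : d <= y -> segint a y g = segint a d g.
    move=> dy; rewrite (@segint_split _ a d y) ?ad// (zero d y) ?addr0// => z.
    by rewrite in_itv /= => /andP[dz _]; exact: gd.
  by rewrite adE// -(adE b) ?g0// ltW.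
have dall x : is_derive x (1 : R) (fun x => segint a x g) (g x).
  have [ax|xa] := ltP a x.
    have x1 : x < x + 1 by rewrite ltrDl.
    have [dx dE] := continuous_FTC1_closed x1 (gi a (x + 1)) ax (cg x).
    by apply: DeriveDef; [exact: dx|rewrite -derive1E].
  have xc : x < c by exact: le_lt_trans ac.
  rewrite gc ?(ltW xc)//.
  have fz : {near x, (fun=> 0) =1 (fun y => segint a y g)}.
    near=> y; rewrite f0c//; apply: ltW; near: y.
    exact: lt_nbhsl.
  apply: (near_eq_is_derive fz).
have dE : derive1 (fun x => segint a x g) = g.
  by apply/funext => x; rewrite derive1E; have [_ ->] := dall x.
have sf : supp (fun x => segint a x g) `<=` `[c, d].
  have cl : closed [set` `[c, d]] by exact: itv_closed.
  rewrite [X in _ `<=` X](closure_id _).1//; apply: closure_subset => x /= fx0.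
  rewrite in_itv /=; apply/andP; split; rewrite leNgt; apply/negP => h.
  - by move: fx0; rewrite f0c ?eqxx// ltW.
  - by move: fx0; rewrite f0d ?eqxx// ltW.
split => //; split.
- by move=> x; have [] := dall x.
- by rewrite dE.
- by apply: (subclosed_compact _ (@segment_compact R c d)) => //; exact: closed_closure.
- move=> x /sf /=; rewrite !in_itv /= => /andP[cx xd].
  by rewrite (lt_le_trans ac cx) (le_lt_trans xd db).
Unshelve. all: by end_near. Qed.

End AbsolutelyContinuous.

Section Cutoff.
Context {R : realType}.
Local Notation mu := (@lebesgue_measure R).
Variables (a b : R).
Hypothesis ab : a < b.

(** Trapezoids supported in ]a, b[ which tend to 1 in ]a, b[. *)
Definition cutoff (n : nat) (x : R) : R :=
  Num.max 0 (Num.min 1 (Num.min (n.+1%:R * (x - a) - 1) (n.+1%:R * (b - x) - 1))).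

Lemma cutoff_itv n x : 0 <= cutoff n x <= 1.
Proof. by rewrite /cutoff le_max lexx/= ge_max ler01/= ge_min lexx. Qed.

Lemma cutoff_norm n x : `|cutoff n x| <= 1.
Proof. by have /andP[? ?] := cutoff_itv n x; rewrite ger0_norm. Qed.

Lemma cutoff_continuous n : continuous (cutoff n).
Proof.
have c1 : continuous (fun x : R => n.+1%:R * (x - a) - 1).
  move=> x; apply: cvgB; last exact: cvg_cst.
  by apply: cvgM; [exact: cvg_cst|apply: cvgB; [exact: cvg_id|exact: cvg_cst]].
have c2 : continuous (fun x : R => n.+1%:R * (b - x) - 1).
  move=> x; apply: cvgB; last exact: cvg_cst.
  by apply: cvgM; [exact: cvg_cst|apply: cvgB; [exact: cvg_cst|exact: cvg_id]].
have cmin (f g : R -> R) : continuous f -> continuous g ->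
    continuous (fun x => Num.min (f x) (g x)).
  by move=> cf cg x; apply: (@continuous_min _ _ f g x); [exact: cf|exact: cg].
have cmax (f g : R -> R) : continuous f -> continuous g ->
    continuous (fun x => Num.max (f x) (g x)).
  by move=> cf cg x; apply: (@continuous_max _ _ f g x); [exact: cf|exact: cg].
have cc (k : R) : continuous (fun _ : R => k) by move=> x; exact: cvg_cst.
exact: (cmax _ _ (cc 0) (cmin _ _ (cc 1) (cmin _ _ c1 c2))).
Qed.

Lemma cutoff_left n x : x <= a + n.+1%:R^-1 -> cutoff n x = 0.
Proof.
move=> h; rewrite /cutoff; apply/max_idPl; rewrite !ge_min.
by rewrite subr_le0 -ler_pdivlMl// mulr1 lerBlDl h orbT.
Qed.

Lemma cutoff_right n x : b - n.+1%:R^-1 <= x -> cutoff n x = 0.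
Proof.
move=> h; rewrite /cutoff; apply/max_idPl; rewrite !ge_min.
have h' : b - x <= n.+1%:R^-1 by rewrite lerBlDr -lerBlDl.
by rewrite !subr_le0 -!ler_pdivlMl// mulr1 h' !orbT.
Qed.

Lemma cutoff_cvg x : x \in `]a, b[ -> (cutoff ^~ x) @ \oo --> (1 : R).
Proof.
rewrite in_itv /= => /andP[ax xb].
pose e := Num.min (x - a) (b - x).
have e0 : 0 < e by rewrite lt_min !subr_gt0 ax.
apply: (@cvg_trans _ ((fun _ : nat => 1 : R) @ \oo)); last exact: cvg_cst.
apply: near_eq_cvg; near=> n.
have ne : 2 <= n.+1%:R * e.
  rewrite -ler_pdivrMr//; near: n.
  exists (Num.truncn (2 / e)) => // n /= hn.
  by apply: ltW; apply: lt_le_trans (truncnS_gt _) _; rewrite ler_nat.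
have [ea eb] : e <= x - a /\ e <= b - x by split; rewrite ge_min lexx ?orbT.
have na : 2 <= n.+1%:R * (x - a) by apply: le_trans ne _; rewrite ler_wpM2l.
have nb : 2 <= n.+1%:R * (b - x) by apply: le_trans ne _; rewrite ler_wpM2l.
have m1 : 1 <= Num.min (n.+1%:R * (x - a) - 1) (n.+1%:R * (b - x) - 1).
  by rewrite le_min; apply/andP; split; lra.
by rewrite /cutoff (min_idPl m1); apply/esym/max_idPr.
Unshelve. all: by end_near. Qed.

Let contW (g : R -> R) : continuous g -> {within `[a, b], continuous g}.
Proof. exact: continuous_subspaceT. Qed.

Lemma cutoff_mul_integral_cvg (g : R -> R) : seg_integrable a b g ->
  (fun n => segint a b (fun x => cutoff n x * g x)) @ \oo --> segint a b g.
Proof.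
move=> gi; have mg := seg_measurable_fun gi.
apply: (@segint_dct _ _ _ _ _ (fun x => `|g x|)) => //.
- move=> n; apply: measurable_funM => //; apply: seg_continuous_measurable.
  exact/contW/cutoff_continuous.
- move=> x xab; rewrite -[X in _ --> X](mul1r (g x)).
  by apply: cvgM; [exact: cutoff_cvg|exact: cvg_cst].
- exact: seg_integrable_norm.
- by move=> n x xab; rewrite normrM -[leRHS]mul1r ler_wpM2r//; exact: cutoff_norm.
Qed.

Lemma cutoff_integral_gt0 : exists n, 0 < segint a b (cutoff n).
Proof.
have c1 : {within `[a, b], continuous (fun=> 1 : R)} by move=> x; exact: cvg_cst.
have := cutoff_mul_integral_cvg (seg_continuous_integrable c1); rewrite segint_cst ?(ltW ab)// mul1r => h.
have ba : 0 < b - a by rewrite subr_gt0.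
have [n _ hn] := cvgr_gt _ h _ ba.
exists n; have := hn n (leqnn n); rewrite /= (@eq_segint _ _ _ _ (cutoff n))//.
by move=> x _; rewrite mulr1.
Qed.

(** A cut off function g, corrected by a multiple of a fixed bump to have
    mean zero, is the derivative of a test function. *)
Lemma cutoff_test_function (g : R -> R) n N (r := segint a b (cutoff N))
  (k := segint a b (fun x => cutoff n x * g x))
  (h := fun x => cutoff n x * g x - k / r * cutoff N x) :
  continuous g -> 0 < r ->
  [/\ continuous h, test_function a b (fun x => segint a x h) &
      derive1 (fun x => segint a x h) = h].
Proof.
move=> cg r0.
have cnG : continuous (fun x => cutoff n x * g x).
  by move=> x; apply: cvgM; [exact: cutoff_continuous|exact: cg].
have crN : continuous (fun x => k / r * cutoff N x).
  by move=> x; apply: cvgM; [exact: cvg_cst|exact: cutoff_continuous].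
have ch : continuous h by move=> x; apply: cvgB; [exact: cnG|exact: crN].
pose e := Num.min (Num.min n.+1%:R^-1 N.+1%:R^-1) ((b - a) / 2) : R.
have e0 : 0 < e by rewrite !lt_min !invr_gt0 !ltr0n/= divr_gt0// subr_gt0.
have [e1 e2 e3] : [/\ e <= n.+1%:R^-1, e <= N.+1%:R^-1 & e <= (b - a) / 2].
  by split; rewrite !ge_min lexx ?orbT.
have [] // := @test_function_primitive R a b (a + e) (b - e) h.
- by rewrite ltrDl.
- by move: e3; lra.
- by rewrite ltrBlDr ltrDl.
- by move=> x xa; rewrite /h !cutoff_left ?mul0r ?mulr0 ?subr0//;
    apply: (le_trans xa); rewrite lerD2l.
- by move=> x xa; rewrite /h !cutoff_right ?mul0r ?mulr0 ?subr0//;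
    apply: le_trans xa; rewrite lerD2l lerN2.
rewrite /h segintB; last 2 first.
- exact/seg_continuous_integrable/contW.
- exact/seg_continuous_integrable/contW.
rewrite segintZ; last exact/seg_continuous_integrable/contW/cutoff_continuous.
by rewrite -/k -/r divfK ?subrr// gt_eqF.
Qed.

(** U1 has mean zero because U vanishes at both ends, hence the correction in
    cutoff_test_function tends to 0 with n, and the cut off derivative tends to
    U1 in L^2. *)
Lemma sobolev120_antiderivative (U U1 : R -> R) : continuous U1 ->
  antiderivative a b U U1 -> U a = 0 -> U b = 0 -> sobolev120 a b U U1.
Proof.
move=> cU1 UU1 Ua Ub.
have wU1 := contW cU1.
have U1i := seg_continuous_integrable wU1.
have U12 := continuous_inLp2 wU1.
have cU := antiderivative_continuous (ltW ab) U1i UU1.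
split; first exact: sobolev12_antiderivative.
have [N r0] := cutoff_integral_gt0.
set r := segint a b (cutoff N) in r0.
pose k n := segint a b (fun x => cutoff n x * U1 x).
pose h n x := cutoff n x * U1 x - k n / r * cutoff N x.
pose D n x := U1 x - h n x.
have k0 : k @ \oo --> (0 : R).
  have -> : (0 : R) = segint a b U1.
    have /UU1 : b \in `[a, b] by rewrite in_itv /= lexx ltW.
    by rewrite Ub Ua add0r.
  exact: cutoff_mul_integral_cvg.
have H n := cutoff_test_function n cU1 r0.
have cD n : continuous (D n).
  by move=> x; apply: cvgB; [exact: cU1|have [c _ _] := H n; exact: c].
have [M M0 U1M] := seg_continuous_bounded wU1.
have kM n : `|k n| <= M * (b - a).
  rewrite -segint_cst ?(ltW ab)//.
  have ki : seg_integrable a b (fun x => cutoff n x * U1 x).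
    apply: seg_continuous_integrable => x; apply: cvgM; last exact: wU1.
    exact: (contW (cutoff_continuous (n := n))).
  apply: (le_trans (segint_norm ki)); apply: segint_le.
  - exact: seg_integrable_norm.
  - by apply: seg_continuous_integrable => x; exact: cvg_cst.
  move=> x xab; rewrite normrM -[leRHS]mul1r ler_pM//; first exact: cutoff_norm.
  exact: U1M.
pose B := M + (M + M * (b - a) / r).
have DB n x : x \in `[a, b] -> `|D n x| <= B.
  move=> xab; rewrite /D /h; apply: (le_trans (ler_normB _ _)).
  rewrite lerD ?U1M//; apply: (le_trans (ler_normB _ _)); rewrite lerD//.
    by rewrite normrM -[leRHS]mul1r ler_pM ?cutoff_norm ?U1M.
  rewrite normrM -[leRHS]mulr1 ler_pM ?cutoff_norm// normrM ler_pM ?kM//.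
  by rewrite gtr0_norm ?invr_gt0.
have D0 x : x \in `]a, b[ -> D ^~ x @ \oo --> (0 : R).
  move=> xab; rewrite (_ : 0 = U1 x - (1 * U1 x - 0 / r * cutoff N x)); last by ring.
  apply: cvgB; first exact: cvg_cst.
  apply: cvgB; first by apply: cvgM; [exact: cutoff_cvg|exact: cvg_cst].
  apply: cvgM; last exact: cvg_cst.
  by apply: cvgM; [exact: k0|exact: cvg_cst].
have mD n : measurable_fun `[a, b] (D n) by exact: (seg_continuous_measurable (contW (cD n))).
have Bi (c : R) : seg_integrable a b (fun _ : R => c).
  by apply/seg_continuous_integrable/contW => x; exact: cvg_cst.
have int0 : segint a b (fun _ : R => 0) = 0 by rewrite segint_cst ?mul0r// ltW.
pose J n := segint a b (fun x => `|D n x|).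
have J0 : J @ \oo --> (0 : R).
  rewrite -int0; apply: (@segint_dct _ _ _ _ _ (fun=> B)) => //.
  - by move=> n; exact: measurableT_comp.
  - by move=> x xab; rewrite -[X in _ --> X](normr0 R); apply: cvg_norm; exact: D0.
  - by move=> n x xab; rewrite normr_id DB//; exact: subset_itv_oo_cc.
pose Q n := segint a b (fun x => D n x ^+ 2).
have Q0 : Q @ \oo --> (0 : R).
  rewrite -int0; apply: (@segint_dct _ _ _ _ _ (fun=> B ^+ 2)) => //.
  - by move=> n; exact: measurable_funX.
  - move=> x xab; rewrite -[X in _ --> X](mulr0 0).
    by under eq_fun do rewrite expr2; apply: cvgM; exact: D0.
  - move=> n x xab; rewrite normrX lerXn2r ?nnegrE// ?DB//; last exact: subset_itv_oo_cc.
    by apply: le_trans (DB n x _) => //; exact: subset_itv_oo_cc.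
move=> e e0.
have T0 : (fun n => Num.sqrt ((b - a) * J n ^+ 2) + Num.sqrt (Q n)) @ \oo --> (0 : R).
  rewrite -[X in _ --> X](addr0 0) -(sqrtr0 R); apply: cvgD.
    apply: (@cvg_comp _ _ _ (fun n => (b - a) * J n ^+ 2) Num.sqrt _ (nbhs 0)); last exact: sqrt_continuous.
    rewrite (_ : 0 = (b - a) * (0 * 0)); last by rewrite !mulr0.
    apply: cvgM; first exact: cvg_cst.
    by under eq_fun do rewrite expr2; apply: cvgM.
  by apply: (@cvg_comp _ _ _ Q Num.sqrt _ (nbhs 0)) => //; exact: sqrt_continuous.
have [n _ hn] := cvgr_lt _ T0 _ e0.
have {}hn := hn n (leqnn n).
have [ch tf dfE] := H n.
exists (fun x => segint a x (h n)) => //.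
apply: le_lt_trans hn; apply: lerD; last first.
  by rewrite dfE Lpnorm2E//; exact: (continuous_inLp2 (contW (cD n))).
have Vab : {within `[a, b], continuous (U \- (fun x => segint a x (h n)))}.
  move=> x; apply: cvgB; first exact: cU.
  exact: (contW (test_function_continuous tf)).
rewrite Lpnorm2E; last exact: continuous_inLp2.
apply: ler_wsqrtr.
have Di := seg_continuous_integrable (contW (cD n)).
have hi := seg_continuous_integrable (contW ch).
rewrite mulrC -segint_cst ?(ltW ab)//; apply: segint_le => //.
  exact/inLp2_elim/continuous_inLp2.
move=> x xab; have := xab; rewrite in_itv /= => /andP[ax xb].
have -> : U x - segint a x (h n) = segint a x (D n).
  rewrite (UU1 x xab) Ua add0r -segintB//.
  - exact: seg_integrableS U1i.
  - exact: seg_integrableS hi.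
have J00 : 0 <= J n by apply: segint_ge0.
rewrite -(real_normK (num_real (segint a x (D n)))) lerXn2r ?nnegrE//.
have Dx : seg_integrable a x (D n) by exact: seg_integrableS Di.
apply: (le_trans (segint_norm Dx)).
apply: segint_subset_le => //; exact: seg_integrable_norm.
Qed.

End Cutoff.

(** * Regularity of one-dimensional Sobolev functions *)

Section Clamp.
Context {R : realType}.
Implicit Types a b x : R.

Definition clamp a b x : R := Num.max a (Num.min b x).

Lemma clamp_id a b x : x \in `[a, b] -> clamp a b x = x.
Proof.
by rewrite in_itv /= => /andP[ax xb]; rewrite /clamp (min_idPr xb) (max_idPr ax).
Qed.

Lemma clamp_itv a b x : a <= b -> clamp a b x \in `[a, b].
Proof. by move=> ab; rewrite in_itv /= le_max lexx ge_max ab ge_min lexx. Qed.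

Lemma clamp_left a b x : a <= b -> x <= a -> clamp a b x = a.
Proof.
by move=> ab xa; rewrite /clamp (min_idPr (le_trans xa ab)); apply/max_idPl.
Qed.

Lemma clamp_right a b x : a <= b -> b <= x -> clamp a b x = b.
Proof. by move=> ab bx; rewrite /clamp (min_idPl bx); apply/max_idPr. Qed.

Lemma clamp_continuous a b (T : R -> R) : a <= b ->
  {within `[a, b], continuous T} -> continuous (fun x => T (clamp a b x)).
Proof.
move=> ab /subspace_continuousP cT y.
have cc (k : R) : continuous (fun _ : R => k) by move=> x; exact: cvg_cst.
have cl : clamp a b z @[z --> y] --> clamp a b y.
  apply: (@continuous_max _ _ (cst a) (fun z => Num.min b z) y); first exact: cc.
  by apply: (@continuous_min _ _ (cst b) id y); [exact: cc|exact: cvg_id].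
move=> B /(cT _ (clamp_itv y ab)) hB.
move: (cl _ hB); rewrite !nbhs_simpl /=; apply: filterS => z /=; apply.
exact: clamp_itv.
Qed.

End Clamp.

Section AlmostEverywhere.
Context {R : realType}.
Local Notation mu := (@lebesgue_measure R).
Implicit Types (a b : R) (P : R -> Prop).

Lemma ae_exists a b P : a < b -> {ae mu, forall x, P x} ->
  exists2 x, x \in `]a, b[ & P x.
Proof.
move=> ab [N [mN N0 PN]].
have [//|nP] := pselect (exists2 x, x \in `]a, b[ & P x).
suff : (mu `]a, b[%classic <= mu N)%E.
  by rewrite N0 lebesgue_measure_itv /= lte_fin ab leNgt lte_fin subr_gt0 ab.
apply: le_measure; rewrite ?inE//.
by move=> x xab; apply: PN => Px; apply: nP; exists x.
Qed.

Lemma ae_eq_continuous a b (f g : R -> R) : a < b ->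
  {within `[a, b], continuous f} -> {within `[a, b], continuous g} ->
  {ae mu, forall x, x \in `]a, b[ -> f x = g x} ->
  {in `[a, b], f =1 g}.
Proof.
move=> ab cf cg fg x xab; apply/eqP; rewrite -subr_eq0; apply/negPn/negP => D0.
pose D y := f (clamp a b y) - g (clamp a b y).
have cD : continuous D.
  by move=> y; apply: cvgB; [exact: clamp_continuous (ltW ab) cf y|exact: clamp_continuous (ltW ab) cg y].
have cN : continuous (fun y => - `|D y|).
  by move=> y; apply: cvgN; apply: cvg_norm; exact: cD.
have Dx : (fun y => - `|D y|) x < 0 by rewrite /= oppr_lt0 normr_gt0 /D clamp_id.
have [e e0 he] := continuous_lt_near (cN x) Dx.
have := xab; rewrite in_itv /= => /andP[ax xb].
pose c := Num.max a (x - e / 2); pose d := Num.min b (x + e / 2).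
have e2 : 0 < e / 2 by rewrite divr_gt0.
have cd : c < d by rewrite gt_max !lt_min ab/=; apply/andP; split; [|apply/andP; split]; lra.
have [y] := ae_exists cd fg.
rewrite in_itv /= gt_max lt_min => /andP[/andP[ay xy] /andP[yb yx]] fgy.
have yab : y \in `]a, b[ by rewrite in_itv /= ay.
have := he y; rewrite /D clamp_id ?(subset_itv_oo_cc yab)// fgy// subrr normr0 oppr0 ltxx.
by move=> H; apply: notF; apply: H; lra.
Qed.

End AlmostEverywhere.

Section DuBoisReymond.
Context {R : realType}.
Local Notation mu := (@lebesgue_measure R).
Variables (a b : R).
Hypothesis ab : a < b.

(** Lebesgue's differentiation theorem, applied to w extended by 0. *)
Lemma integrable_ae0 (w : R -> R) : seg_integrable a b w ->
  (forall y, y \in `[a, b] -> segint a y w = 0) ->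
  {ae mu, forall x, x \in `]a, b[ -> w x = 0}.
Proof.
move=> wi w0.
pose f := w \_ [set` `[a, b]].
have fi : mu.-integrable setT (EFin \o f).
  rewrite /f -restrict_EFin.
  exact: (@integrable_mkcond _ _ R mu _ (EFin \o w) (measurable_itv _)).1.
have fi' (y : R) : mu.-integrable [set` Interval (BLeft a) (BRight y)] (EFin \o f).
  by apply: integrableS fi.
have lf : locally_integrable setT f by apply: open_integrable_locally; [exact: openT|exact: fi].
have fw x : x \in `[a, b] -> f x = w x by move=> xab; rewrite /f patchE mem_set.
have f0 x : x \notin `[a, b] -> f x = 0 by move=> xab; rewrite /f patchE memNset//; exact/negP.
have F0 y : segint a y f = 0.
  have [ya|ay] := ltP y a; first by rewrite segint_gt.
  have [yb|/ltW bY] := leP y b.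
    rewrite (@eq_segint _ _ _ _ w) ?w0 ?in_itv /= ?ay// => x.
    by rewrite in_itv /= => /andP[ax xy]; rewrite fw// in_itv /= ax (le_trans xy).
  rewrite (@segint_split _ a b y) ?bY ?ltW//.
  rewrite (@eq_segint _ a b _ w) => [|x /fw//].
  rewrite w0 ?in_itv /= ?lexx ?ltW// add0r.
  rewrite (@segint_ae_eq _ b y f (fun=> 0)) ?segint_cst ?mul0r//.
  - by apply: seg_measurable_fun; apply: integrableS fi.
  - apply: aeW => x; rewrite in_itv /= => /andP[bx _]; apply: f0.
    by rewrite in_itv /= negb_and -!ltNge bx orbT.
apply: (ae_imp (FTC1 fi' lf)) => x h xab.
have xab' : x \in `[a, b] by exact: subset_itv_oo_cc.
have ax : a < x by move: xab; rewrite in_itv /= => /andP[].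
have [|_ fE] := h; first by rewrite (@lte_fin R).
rewrite -fw// -fE.
rewrite (_ : (fun _ => _) = fun=> 0) ?derive1_cst//.
by apply/funext => y; exact: F0.
Qed.

(** The difference w of U and the primitive of U1 has the weak derivative 0.
    Testing with the functions of cutoff_test_function shows that w - k is
    orthogonal to every continuous function, where k is the mean of w with respect
    to a fixed cutoff; hence w - k has a vanishing primitive. *)
Lemma du_bois_reymond (U U1 : R -> R) : sobolev12 a b U U1 ->
  exists k, {ae mu, forall x, x \in `]a, b[ -> U x = k + segint a x U1}.
Proof.
move=> [U2 U12 wd].
have Ui := inLp2_integrable U2; have U1i := inLp2_integrable U12.
pose V x := segint a x U1.
have aV : antiderivative a b V U1 by move=> x _; rewrite /V segint_xx add0r.
have cV := antiderivative_continuous (ltW ab) U1i aV.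
have Vi := seg_continuous_integrable cV.
have wdV := weak_derivative_antiderivative ab U1i aV.
pose w x := U x - V x.
have wi : seg_integrable a b w by exact: seg_integrableB.
have w0 f : test_function a b f -> segint a b (fun x => w x * derive1 f x) = 0.
  move=> tf; have [_ cf' _ _] := tf.
  have wf' : {within `[a, b], continuous (derive1 f)} by exact: continuous_subspaceT.
  have Mi g : seg_integrable a b g -> seg_integrable a b (fun x => g x * derive1 f x).
    move=> gi; apply: (@eq_seg_integrable _ _ _ (fun x => derive1 f x * g x)).
      by move=> x _; rewrite mulrC.
    exact: seg_integrable_mulc.
  rewrite (@eq_segint _ _ _ _ (fun x => U x * derive1 f x - V x * derive1 f x)).
    rewrite segintB ?Mi// -!segint_oo ?Mi//.
    by rewrite (wd f tf) (wdV f tf) subrr.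
  by move=> x _; rewrite /w mulrBl.
have [N r0] := cutoff_integral_gt0 ab.
set r := segint a b (cutoff a b N) in r0.
pose k := segint a b (fun x => w x * cutoff a b N x) / r.
have wrap (c : R -> R) : continuous c -> {within `[a, b], continuous c} by exact: continuous_subspaceT.
have ki : seg_integrable a b (fun=> k).
  by apply/seg_continuous_integrable/wrap => x; exact: cvg_cst.
have wki : seg_integrable a b (fun x => w x - k) by exact: seg_integrableB.
have key (g : R -> R) : continuous g -> segint a b (fun x => (w x - k) * g x) = 0.
  move=> cg.
  have gwki : seg_integrable a b (fun x => g x * (w x - k)) by exact: seg_integrable_mulc (wrap _ cg) wki.
  have lim := cutoff_mul_integral_cvg gwki.
  rewrite (@eq_segint _ _ _ _ (fun x => g x * (w x - k))) => [|x _]; last by rewrite mulrC.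
  apply: (cvg_unique _ lim) => //.
  rewrite (_ : (fun n => _) = fun=> 0); first exact: cvg_cst.
  apply/funext => n.
  have [ch tf dfE] := cutoff_test_function ab n cg r0.
  have := w0 _ tf; rewrite dfE => wh0.
  have cc : continuous (fun x => cutoff a b n x * g x).
    by move=> x; apply: cvgM; [exact: cutoff_continuous|exact: cg].
  have ccw : seg_integrable a b (fun x => cutoff a b n x * g x * w x).
    exact: seg_integrable_mulc (wrap _ cc) wi.
  have rw : seg_integrable a b (fun x => cutoff a b N x * w x).
    by apply: seg_integrable_mulc wi; exact/wrap/cutoff_continuous.
  have cci := seg_continuous_integrable (wrap _ cc).
  set kn := segint a b (fun x => cutoff a b n x * g x) in wh0.
  rewrite (@eq_segint _ _ _ _ (fun x => cutoff a b n x * g x * w x - k * (cutoff a b n x * g x))); last first.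
    by move=> x _; ring.
  rewrite segintB ?segintZ//; last exact: seg_integrableZ.
  rewrite -/kn -wh0.
  rewrite [in RHS](@eq_segint _ _ _ _ (fun x => cutoff a b n x * g x * w x
     - kn / r * (cutoff a b N x * w x))); last by move=> x _; rewrite -/r; ring.
  rewrite segintB ?segintZ//; last exact: seg_integrableZ.
  congr (_ - _); rewrite /k.
  rewrite (@eq_segint _ _ _ (fun x => w x * _) (fun x => cutoff a b N x * w x)) => [|x _]; last by rewrite mulrC.
  by rewrite mulrC mulrA mulrAC.
exists k.
have := @integrable_ae0 (fun x => w x - k) wki.
move=> h; apply: (ae_imp (h _)) => [|x hx xab]; last first.
  by have /eqP := hx xab; rewrite subr_eq0 /w subr_eq addrC => /eqP; rewrite /V.
move=> y; rewrite in_itv /= => /andP[]; rewrite le_eqVlt => /predU1P[<- _|ay yb].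
  by rewrite segint_xx.
have wky : seg_integrable a y (fun x => w x - k) by exact: seg_integrableS wki.
have lim := cutoff_mul_integral_cvg wky.
apply: (cvg_unique _ lim) => //.
rewrite (_ : (fun n => _) = fun=> 0); first exact: cvg_cst.
apply/funext => n; rewrite -(key (cutoff a y n)); last exact: cutoff_continuous.
rewrite (@segint_split _ a y b) ?yb ?ltW//.
  rewrite [X in _ + X](@eq_segint _ _ _ _ (fun=> 0)); last first.
    move=> x; rewrite in_itv /= => /andP[yx _]; rewrite cutoff_right ?mulr0//.
    by apply: le_trans yx; rewrite lerBlDr lerDl.
  by rewrite segint_cst// mul0r addr0; apply: eq_segint => x _; rewrite mulrC.
apply: (@eq_seg_integrable _ _ _ (fun x => cutoff a y n x * (w x - k))).
  by move=> x _; rewrite mulrC.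
by apply: seg_integrable_mulc wki; exact/wrap/cutoff_continuous.
Qed.

Lemma continuous_sobolev12_antiderivative (U U1 : R -> R) : sobolev12 a b U U1 ->
  {within `[a, b], continuous U} -> antiderivative a b U U1.
Proof.
move=> sU cU; have [k hk] := du_bois_reymond sU.
have [_ U12 _] := sU; have U1i := inLp2_integrable U12.
have cV := segint_continuous (ltW ab) U1i.
have ckV : {within `[a, b], continuous (fun x => k + segint a x U1)}.
  by move=> x; apply: cvgD; [exact: cvg_cst|exact: cV].
have E := ae_eq_continuous ab cU ckV hk.
move=> x xab; rewrite (E x xab) (E a) ?in_itv /= ?lexx ?ltW//.
by rewrite segint_xx addr0.
Qed.

(** At the end points f vanishes, and |U - f| at a point is at most its mean plus
    the L^1 norm of (U - f)', both controlled by the distance of f and U. *)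
Lemma sobolev120_trace (U U1 : R -> R) : sobolev120 a b U U1 ->
  {within `[a, b], continuous U} -> U a = 0 /\ U b = 0.
Proof.
move=> [sU hU] cU.
have aU := continuous_sobolev12_antiderivative sU cU.
have [U2 U12 _] := sU; have U1i := inLp2_integrable U12.
have L0 : 0 < b - a by rewrite subr_gt0.
set L := b - a in L0.
suff key z : z \in `[a, b] -> z \notin `]a, b[ -> U z = 0.
  by split; apply: key; rewrite in_itv /= ?lexx ?ltxx ?andbF// ltW.
move=> zab znoo; apply/eqP; rewrite -normr_le0; apply/ler_addgt0Pr => e e0.
rewrite add0r.
pose d := e * L / (L + 1) ^+ 2.
have L1 : 0 < L + 1 by rewrite ltr_wpDl// ltW.
have d0 : 0 < d by rewrite divr_gt0 ?exprn_gt0// mulr_gt0.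
have [f tf fd] := hU d d0.
have cf := test_function_continuous tf; have [df cf' _ _] := tf.
have wf : {within `[a, b], continuous f} by exact: continuous_subspaceT.
have wf' : {within `[a, b], continuous (derive1 f)} by exact: continuous_subspaceT.
have h2 : inLp 2%:E `]a, b[ (U \- f).
  by apply: continuous_inLp2 => x; apply: cvgB; [exact: cU|exact: wf].
have f'2 := continuous_inLp2 wf'.
have h12 : inLp 2%:E `]a, b[ (U1 \- derive1 f).
  have := inLp2D U12 (inLp2_mulb (M := 1) (g := fun=> -1) (measurable_cst _) _ f'2).
  rewrite (_ : (fun x => _) = U1 \- derive1 f); last by apply/funext => x /=; rewrite mulN1r.
  by apply => x _; rewrite normrN1.
have hi := inLp2_integrable h2; have h1i := inLp2_integrable h12.
have B1 : segint a b (fun x => `|(U \- f) x|) <= (L + 1) * d.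
  apply: (segint_norm_Lpnorm2 (ltW ab) d0 h2); apply: le_trans (ltW fd).
  by rewrite lerDl Lpnorm_ge0.
have B2 : segint a b (fun x => `|(U1 \- derive1 f) x|) <= (L + 1) * d.
  apply: (segint_norm_Lpnorm2 (ltW ab) d0 h12); apply: le_trans (ltW fd).
  by rewrite lerDr Lpnorm_ge0.
have df1 : forall x : R, x \in `]a, b[ -> is_derive x (1 : R) f (derive1 f x).
  by move=> x _; apply: DeriveDef; [exact: df|rewrite derive1E].
have f'i := seg_continuous_integrable wf'.
have incr x y : a <= x -> x <= y -> y <= b ->
    (U y - f y) - (U x - f x) = segint x y (U1 \- derive1 f).
  move=> ax xy yb.
  have sub' : [set` `[x, y]] `<=` [set` `[a, b]] by apply: subset_itv; rewrite bnd_simp.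
  have aU' := antiderivative_sub ax yb U1i aU.
  have yxy : y \in `[x, y] by rewrite in_itv /= lexx xy.
  have sub1 : seg_integrable x y U1 by exact: seg_integrableS U1i.
  have sub2 : seg_integrable x y (derive1 f) by exact: seg_integrableS f'i.
  rewrite (aU' y yxy) /= segintB//.
  have h1 : {within `[x, y], continuous (derive1 f)} by exact: continuous_subspaceW sub' wf'.
  have h2' : {within `[x, y], continuous f} by exact: continuous_subspaceW sub' wf.
  have h3 : forall t : R, t \in `]x, y[ -> is_derive t (1 : R) f (derive1 f t).
    move=> t; rewrite in_itv /= => /andP[xt ty]; apply: df1.
    by rewrite in_itv /= (le_lt_trans ax xt) (lt_le_trans ty yb).
  by rewrite (segint_FTC2 xy h1 h2' h3); ring.
have small x y : a <= x -> x <= y -> y <= b ->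
    `|(U y - f y) - (U x - f x)| <= (L + 1) * d.
  move=> ax xy yb; rewrite incr//.
  have i : seg_integrable x y (U1 \- derive1 f) by exact: seg_integrableS h1i.
  apply: (le_trans (segint_norm i)); apply: le_trans B2.
  apply: segint_subset_le => //; exact: seg_integrable_norm.
have fz : f z = 0 by exact: test_function0 tf znoo.
have dist y : y \in `[a, b] -> `|U z| <= `|(U \- f) y| + (L + 1) * d.
  move=> yab; rewrite -(subr0 (U z)) -fz.
  rewrite -(subrK ((U \- f) y) (U z - f z)) addrC.
  apply: (le_trans (ler_normD _ _)); rewrite lerD2l.
  move: yab zab; rewrite !in_itv /= => /andP[ay yb] /andP[az zb].
  case: (leP y z) => [yz|/ltW zy]; first exact: small.
  by rewrite distrC; exact: small.
have : `|U z| * L <= (L + 1) * d + (L + 1) * d * L.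
  rewrite -!segint_cst ?(ltW ab)//.
  apply: (@le_trans _ _ (segint a b (fun y => `|(U \- f) y| + (L + 1) * d))).
    apply: segint_le => //.
    - by apply/seg_continuous_integrable/continuous_subspaceT => x; exact: cvg_cst.
    - apply: seg_integrableD; first exact: seg_integrable_norm.
      by apply/seg_continuous_integrable/continuous_subspaceT => x; exact: cvg_cst.
  rewrite segintD ?lerD2r//; first exact: seg_integrable_norm.
  by apply/seg_continuous_integrable/continuous_subspaceT => x; exact: cvg_cst.
have -> : (L + 1) * d + (L + 1) * d * L = e * L.
  by rewrite /d; field; rewrite gt_eqF.
by rewrite ler_pM2r.
Qed.

End DuBoisReymond.

(** * The operator - u'' + b u' in self-adjoint form *)

Section Weight.
Context {R : realType}.
Local Notation mu := (@lebesgue_measure R).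
Variables (a b : R) (b0 : R -> R).
Hypothesis ab : a < b.
Hypothesis hb : {within `[a, b], continuous b0}.

Let Bo := Bover a b0.
Let q := Bunder a b0.

Let b0i : seg_integrable a b b0. Proof. exact: seg_continuous_integrable. Qed.

Lemma Bover_gt0 x : 0 < Bo x. Proof. exact: expR_gt0. Qed.
Lemma Bunder_gt0 x : 0 < q x. Proof. exact: expR_gt0. Qed.
Lemma BoverM x : Bo x * q x = 1. Proof. exact: expRxMexpNx_1. Qed.

Lemma Bover_continuous : {within `[a, b], continuous Bo}.
Proof.
have cI := segint_continuous (ltW ab) b0i.
move=> x; apply: (@cvg_comp _ _ _ (fun x => segint a x b0) expR _ _ _ (cI x)).
exact: continuous_expR.
Qed.

Lemma Bunder_continuous : {within `[a, b], continuous q}.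
Proof.
have cI := segint_continuous (ltW ab) b0i.
have cN : {within `[a, b], continuous (fun x => - segint a x b0)}.
  by move=> x; apply: cvgN; exact: cI.
move=> x; apply: (@cvg_comp _ _ _ (fun x => - segint a x b0) expR _ _ _ (cN x)).
exact: continuous_expR.
Qed.

Lemma is_derive_segint (f : R -> R) x : {within `[a, b], continuous f} ->
  x \in `]a, b[ -> is_derive x (1 : R) (fun y => segint a y f) (f x).
Proof.
move=> cf xab; have := xab; rewrite in_itv /= => /andP[ax xb].
have fi := seg_continuous_integrable cf.
have cfx : {for x, continuous f}.
  by move/(continuous_within_itvP _ ab) : cf => [c _ _]; exact: c.
have [dx dE] := continuous_FTC1_closed xb fi ax cfx.
by apply: DeriveDef; [exact: dx|rewrite -derive1E].
Qed.

Lemma is_derive_Bover x : x \in `]a, b[ -> is_derive x (1 : R) Bo (b0 x * Bo x).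
Proof.
move=> xab; have d1 := is_derive_segint hb xab.
have := @is_derive1_comp _ expR (fun y => segint a y b0) x _ _ (is_derive_expR _) d1.
by rewrite mulrC.
Qed.

Lemma is_derive_Bunder x : x \in `]a, b[ -> is_derive x (1 : R) q (- b0 x * q x).
Proof.
move=> xab; have d1 := is_deriveN (is_derive_segint hb xab).
have := @is_derive1_comp _ expR (fun y => - segint a y b0) x _ _ (is_derive_expR _) d1.
by rewrite mulrC.
Qed.

Definition scale x := segint a (clamp a b x) Bo.

Let Boi : seg_integrable a b Bo.
Proof. exact: seg_continuous_integrable Bover_continuous. Qed.

Lemma scaleE x : x \in `[a, b] -> scale x = segint a x Bo.
Proof. by move=> xab; rewrite /scale clamp_id. Qed.

Lemma segint_Bover c d : a <= c -> c <= d -> d <= b -> segint c d Bo = scale d - scale c.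
Proof.
move=> ac cd db.
rewrite !scaleE ?in_itv /= ?ac ?(le_trans ac cd) ?db ?(le_trans cd db)//.
rewrite (@segint_split _ a c d) ?ac//; first by rewrite addrC addKr.
exact: seg_integrableS Boi.
Qed.

Lemma scale_is_scale : scale_function a b scale.
Proof.
split.
- have := clamp_continuous (ltW ab) (segint_continuous (ltW ab) Boi); exact.
- move=> x y ax xy yb; rewrite -subr_gt0 -segint_Bover ?(ltW xy)//.
  have [m mab hm] := EVT_min (ltW ab) Bover_continuous.
  apply: (@lt_le_trans _ _ (Bo m * (y - x))); first by rewrite mulr_gt0 ?Bover_gt0// subr_gt0.
  rewrite -(segint_cst (Bo m) (ltW xy)); apply: segint_le.
  - by apply/seg_continuous_integrable/continuous_subspaceT => z; exact: cvg_cst.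
  - exact: seg_integrableS Boi.
  - move=> z; rewrite in_itv /= => /andP[xz zy]; apply: hm.
    by rewrite in_itv /= (le_trans ax xz) (le_trans zy yb).
- by move=> x xa; rewrite /scale clamp_left ?segint_xx// ltW.
- by move=> x bx; rewrite /scale !clamp_right// ltW.
Qed.

Let hS := scale_is_scale.
Let S := scale.

Lemma is_derive_scale x : x \in `]a, b[ -> is_derive x (1 : R) S (Bo x).
Proof.
move=> xab; have d1 := is_derive_segint Bover_continuous xab.
apply: near_eq_is_derive d1.
have : \forall y \near x, y \in `]a, b[ by exact: near_in_itvoo.
by apply: filterS => y yab; rewrite /S scaleE//; exact: subset_itv_oo_cc.
Qed.

Lemma scale_triangle c x (F : R -> R) : a <= c -> c <= x -> x <= b ->
  seg_integrable c x F ->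
  segint c x (fun t => Bo t * segint c t F) = segint c x (fun y => (S x - S y) * F y).
Proof.
move=> ac cx xb Fi; rewrite segint_triangle//; last exact: seg_integrableS Boi.
apply: eq_segint => y; rewrite in_itv /= => /andP[cy yx].
by rewrite (segint_Bover (le_trans ac cy) yx xb) mulrC.
Qed.

(** The equation as a system v' = Y / q, Y' = - F, with Y = q v'. *)
Lemma represents_system c d (v Y F : R -> R) : a <= c -> c <= d -> d <= b ->
  seg_integrable c d F ->
  antiderivative c d v (fun x => Bo x * Y x) -> antiderivative c d Y (fun x => - F x) ->
  represents S v F c d.
Proof.
move=> ac cd db Fi vE YE.
have NFi : seg_integrable c d (fun x => - F x) by exact: seg_integrableN.
exists (Y c) => x xcd; have := xcd; rewrite in_itv /= => /andP[cx xd].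
have xb := le_trans xd db.
have Fi' : seg_integrable c x F by exact: seg_integrableS Fi.
have Boi' : seg_integrable c x Bo by exact: seg_integrableS Boi.
rewrite (vE x xcd) -addrA; congr (_ + _).
rewrite -(scale_triangle ac cx xb Fi') -(segint_Bover ac cx xb) -segintZ// -segintB; last 2 first.
- exact: seg_integrableZ.
- have cI : {within `[c, x], continuous (fun t => segint c t F)} by exact: segint_continuous.
  apply: (@eq_seg_integrable _ _ _ (fun t => segint c t F * Bo t)).
    by move=> t _; rewrite mulrC.
  exact: seg_integrable_mulc.
apply: eq_segint => t; rewrite in_itv /= => /andP[ct tx].
rewrite (YE t) ?in_itv /= ?ct ?(le_trans tx)// segintN; first by ring.
by apply: seg_integrableS Fi => //; exact: le_trans xd.
Qed.

(** The derivative of a Green potential is u' = Bover Y with Y absolutely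
    continuous and Y' = - q f; the product rule then gives u''. *)
Lemma Green_sobolev (u f : R -> R) : inLp 2%:E `]a, b[ f ->
  (forall x, u x = Green S a b (fun y => q y * f y) x) ->
  exists u1 u2, [/\ sobolev22 a b u u1 u2, sobolev120 a b u u1 &
    forall x, x \in `]a, b[ -> - u2 x + b0 x * u1 x = f x].
Proof.
move=> f2 uE; have fi := inLp2_integrable f2.
have qfi : seg_integrable a b (fun y => q y * f y).
  by apply: seg_integrable_mulc => //; exact: Bunder_continuous.
have ua : u a = 0 by rewrite uE (Green_out ab hS) ?lexx.
have ub : u b = 0 by rewrite uE (Green_out ab hS) ?lexx ?orbT.
have [z hz] := Green_represents ab hS qfi.
pose Y t := z - segint a t (fun y => q y * f y).
have cQ := segint_continuous (ltW ab) qfi.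
have cY : {within `[a, b], continuous Y}.
  by move=> x; apply: cvgB; [exact: cvg_cst|exact: cQ].
have cBY : {within `[a, b], continuous (fun x => Bo x * Y x)}.
  by move=> x; apply: cvgM; [exact: Bover_continuous|exact: cY].
pose u1 x := Bo (clamp a b x) * Y (clamp a b x).
have cu1 : continuous u1 by exact: (clamp_continuous (ltW ab) cBY).
have u1E x : x \in `[a, b] -> u1 x = Bo x * Y x by move=> xab; rewrite /u1 clamp_id.
have wu1 : {within `[a, b], continuous u1} by exact: continuous_subspaceT.
have au : antiderivative a b u u1.
  move=> x xab; have := xab; rewrite in_itv /= => /andP[ax xb].
  rewrite ua add0r uE (hz x xab) -uE ua add0r.
  have qfi' : seg_integrable a x (fun y => q y * f y) by exact: seg_integrableS qfi.
  rewrite -(scale_triangle (lexx a) ax xb qfi').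
  have Boi' : seg_integrable a x Bo by exact: seg_integrableS Boi.
  rewrite -(segint_Bover (lexx a) ax xb) -segintZ// -segintB; last 2 first.
  - exact: seg_integrableZ.
  - apply: (@seg_integrableS _ a b) => //.
    apply: seg_continuous_integrable => t.
    by apply: cvgM; [exact: Bover_continuous|exact: cQ].
  apply: eq_segint => t; rewrite in_itv /= => /andP[at_ tx].
  by rewrite u1E ?in_itv /= ?at_ ?(le_trans tx)// /Y; ring.
pose u2 x := b0 x * u1 x - f x.
have au1 : antiderivative a b u1 u2.
  have aY : antiderivative a b Y (fun y => - (q y * f y)).
    move=> x; rewrite in_itv /= => /andP[ax xb].
    rewrite /Y segint_xx subr0 segintN//; exact: seg_integrableS qfi.
  have cbB : {within `[a, b], continuous (fun x => b0 x * Bo x)}.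
    by move=> x; apply: cvgM; [exact: hb|exact: Bover_continuous].
  have := antiderivative_mul (ltW ab) Bover_continuous cbB is_derive_Bover (seg_integrableN qfi) aY.
  move=> H x xab; rewrite !u1E ?in_itv /= ?lexx ?(ltW ab)// (H x xab).
  congr (_ + _); apply: eq_segint => t; rewrite in_itv /= => /andP[at_ tx].
  have tab : t \in `[a, b].
    by rewrite in_itv /= at_ (le_trans tx)//; move: xab; rewrite in_itv /= => /andP[].
  by rewrite /u2 u1E// mulrA mulrN mulrA BoverM mul1r.
have u12 := continuous_inLp2 wu1.
have u22 : inLp 2%:E `]a, b[ u2.
  have [M _ b0M] := seg_continuous_bounded hb.
  have h1 := inLp2_mulb (seg_continuous_measurable hb) b0M u12.
  have h2 : inLp 2%:E `]a, b[ (fun x => -1 * f x).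
    by apply: (@inLp2_mulb _ _ _ 1) => // x _; rewrite normrN1.
  have := inLp2D h1 h2.
  by rewrite (_ : (fun x => _) = u2)//; apply/funext => x; rewrite /u2 mulN1r.
exists u1, u2; split.
- by split; exact: sobolev12_antiderivative.
- exact: sobolev120_antiderivative.
- by move=> x xab; rewrite /u2; ring.
Qed.

(** The product rule for q phi', with the continuous representative of phi',
    brings the equation to self-adjoint form. *)
Lemma dirichlet_solution_represents x0 x1 (c : R -> R) (rhs : R -> R -> R) (phi : R -> R) :
  a <= x0 -> x0 < x1 -> x1 <= b ->
  positive_dirichlet_solution x0 x1 b0 c rhs phi ->
  exists F, [/\ seg_integrable x0 x1 F,
    {ae mu, forall y, y \in `]x0, x1[ -> F y = q y * (rhs y (phi y) - c y * phi y)},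
    represents S phi F x0 x1, phi x0 = 0 & phi x1 = 0].
Proof.
move=> ax0 x01 x1b [phi1 [phi2 [[s1 s2] s0 cphi _ eqn]]].
have aphi := continuous_sobolev12_antiderivative x01 s1 cphi.
have [phi0 phi0'] := sobolev120_trace x01 s0 cphi.
have [k hk] := du_bois_reymond x01 s2.
have [_ _ _] := s1; have [phi12 phi22 _] := s2.
have phi2i := inLp2_integrable phi22; have phi1i := inLp2_integrable phi12.
pose Z x := k + segint x0 x phi2.
have aZ : antiderivative x0 x1 Z phi2 by move=> x _; rewrite /Z segint_xx addr0.
have cZ := antiderivative_continuous (ltW x01) phi2i aZ.
have sub : [set` `[x0, x1]] `<=` [set` `[a, b]] by apply: subset_itv; rewrite bnd_simp.
have cq : {within `[x0, x1], continuous q} := continuous_subspaceW sub Bunder_continuous.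
have cBo : {within `[x0, x1], continuous Bo} := continuous_subspaceW sub Bover_continuous.
have cb0 : {within `[x0, x1], continuous b0} := continuous_subspaceW sub hb.
have cbq : {within `[x0, x1], continuous (fun x => - b0 x * q x)}.
  by move=> x; apply: cvgM; [apply: cvgN; exact: cb0|exact: cq].
have dq : forall x : R, x \in `]x0, x1[ -> is_derive x (1 : R) q (- b0 x * q x).
  move=> x; rewrite in_itv /= => /andP[x0x xx1]; apply: is_derive_Bunder.
  by rewrite in_itv /= (le_lt_trans ax0 x0x) (lt_le_trans xx1 x1b).
have aqZ := antiderivative_mul (ltW x01) cq cbq dq phi2i aZ.
pose F y := - (- b0 y * q y * Z y + q y * phi2 y).
have Fi : seg_integrable x0 x1 F.
  apply: seg_integrableN; apply: seg_integrableD; last exact: seg_integrable_mulc.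
  by apply: seg_continuous_integrable => x; apply: cvgM; [exact: cbq|exact: cZ].
exists F; split => //.
- apply: (ae_imp2 hk eqn) => y h1 h2 yin.
  by rewrite /F -(h2 yin) (h1 yin) /Z; ring.
- apply: (represents_system ax0 (ltW x01) x1b Fi (Y := fun x => q x * Z x)); last first.
    move=> x xin; rewrite (aqZ x xin); congr (_ + _).
    by apply: eq_segint => y _; rewrite /F opprK.
  move=> x xin; rewrite (aphi x xin); congr (_ + _).
  have := xin; rewrite in_itv /= => /andP[x0x xx1].
  apply: segint_ae_eq.
  - by apply: seg_measurable_fun; exact: seg_integrableS phi1i.
  - apply: seg_continuous_measurable.
    apply: (continuous_subspaceW (B := [set` `[x0, x1]])).
      by apply: subset_itv; rewrite bnd_simp.
    by move=> y; apply: cvgM; [exact: cBo|apply: cvgM; [exact: cq|exact: cZ]].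
  - apply: (ae_imp hk) => y h; rewrite in_itv /= => /andP[x0y yx].
    by rewrite mulrA BoverM mul1r /Z -h// in_itv /= x0y (lt_le_trans yx).
Qed.

End Weight.

(** * Barriers *)

Section Touching.
Context {R : realType}.
Local Notation mu := (@lebesgue_measure R).
Variables (a b : R) (S : R -> R).
Hypothesis ab : a < b.
Hypothesis hS : scale_function a b S.
Implicit Types (rhs : R -> R -> R) (f g v F : R -> R).

Lemma touched_below_le rhs f g x c' d' : c' < x -> x < d' ->
  (forall y, y \in `[c', d'] -> f y <= g y) -> f x = g x ->
  touched_below a b S rhs f x -> touched_below a b S rhs g x.
Proof.
move=> cx xd fg fgx [c0 [d0 [chi [F [[ac0 c0x xd0 d0b] [Fi cchi chix chif] hsd hF]]]]].
pose c1 := Num.max c0 c'; pose d1 := Num.min d0 d'.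
have [c01 c'1] : c0 <= c1 /\ c' <= c1 by split; rewrite le_max lexx ?orbT.
have [d01 d'1] : d1 <= d0 /\ d1 <= d' by split; rewrite ge_min lexx ?orbT.
exists c1, d1, chi, F; split.
- by split; [exact: le_trans c01|rewrite gt_max c0x|rewrite lt_min xd0|exact: le_trans d0b].
- split.
  + exact: seg_integrableS Fi.
  + by apply: continuous_subspaceW cchi; apply: subset_itv; rewrite bnd_simp.
  + by rewrite chix.
  + move=> y; rewrite in_itv /= => /andP[cy yd].
    apply: (@le_trans _ _ (f y)).
      by apply: chif; rewrite in_itv /= (le_trans c01 cy) (le_trans yd d01).
    by apply: fg; rewrite in_itv /= (le_trans c'1 cy) (le_trans yd d'1).
- move=> c d c1c cx' xd' dd1; apply: hsd => //; first exact: le_trans c1c.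
  exact: le_trans d01.
- apply: (ae_imp hF) => y h; rewrite in_itv /= => /andP[cy yd]; apply: h.
  by rewrite in_itv /= (le_lt_trans c01 cy) (lt_le_trans yd d01).
Qed.

Lemma touched_below_represents rhs v F c0 d0 x : a <= c0 -> c0 < x -> x < d0 -> d0 <= b ->
  {within `[c0, d0], continuous v} -> seg_integrable c0 d0 F ->
  represents S v F c0 d0 ->
  {ae mu, forall y, y \in `]c0, d0[ -> F y <= rhs y (v y)} ->
  touched_below a b S rhs v x.
Proof.
move=> ac0 c0x xd0 d0b cv Fi rv hF; exists c0, d0, v, F; split => //.
move=> c d c0c cx xd dd0.
by rewrite (sdiff_represents hS ac0 d0b c0c (ltW cx) (ltW xd) dd0 Fi rv).
Qed.

Variables (p : R) (P N C : R -> R).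
Hypothesis p01 : 0 < p < 1.
Hypotheses (P0 : forall y, 0 <= P y) (N0 : forall y, 0 <= N y).
Hypothesis Ni : seg_integrable a b N.

Let rhs y t := (P y - N y) * t `^ p - C y * t.
Let p0 : 0 < p. Proof. by case/andP: p01. Qed.
Let p1 : p < 1. Proof. by case/andP: p01. Qed.
Let k := (1 - p)^-1.

Let k1 : 1 < k.
Proof. by rewrite /k invf_gt1 ?subr_gt0// ltrBlDr ltrDl. Qed.

Let kp : k * p = k - 1.
Proof. by rewrite /k; field; rewrite subr_eq0 gt_eqF. Qed.

(** Young's inequality in the form of the convexity of t^r. *)
Lemma powR_tangent (r s t : R) : 1 < r -> 0 <= s -> 0 <= t ->
  s `^ r + r * s `^ (r - 1) * (t - s) <= t `^ r.
Proof.
move=> r1 s0 t0; have r0 : 0 < r by exact: lt_trans r1.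
have r10 : 0 < r - 1 by rewrite subr_gt0.
have sr : s * s `^ (r - 1) = s `^ r by exact: mulr_powRB1.
have := @conjugate_powR R t (s `^ (r - 1)) r (r / (r - 1)) t0 (powR_ge0 _ _) r0 (divr_gt0 r0 r10).
have -> : r^-1 + (r / (r - 1))^-1 = 1 by field; rewrite !gt_eqF.
move=> /(_ erefl); rewrite -powRrM.
have -> : (r - 1) * (r / (r - 1)) = r by field; rewrite gt_eqF.
move=> H.
have : r * (t * s `^ (r - 1)) <= t `^ r + (r - 1) * s `^ r.
  have -> : t `^ r + (r - 1) * s `^ r = r * (t `^ r / r + s `^ r / (r / (r - 1))).
    by field; rewrite !gt_eqF.
  by rewrite ler_wpM2l// ltW.
rewrite -[X in _ -> X <= _](_ : r * (t * s `^ (r - 1)) - (r - 1) * s `^ r = _).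
  by move=> ?; rewrite lerBlDr.
by rewrite mulrBr [_ * s]mulrC mulrCA -sr; ring.
Qed.

(** Let k = 1 / (1 - p) and - (q w')' = - (1 - p) (1 + eta) N.  By convexity w^k
    lies above l = s^k + k s^(k - 1) (w - s), with s the value of w at x, and
    - (q l')' = - (1 + eta) s^(k - 1) N, while N l^p equals N s^(k - 1) at x.  The
    surplus eta covers the variation of l^p near x. *)
Lemma touched_below_power (w : R -> R) eta x : x \in `]a, b[ -> 0 < eta ->
  {within `[a, b], continuous w} -> (forall y, y \in `[a, b] -> 0 <= w y) -> 0 < w x ->
  represents S w (fun y => - ((1 - p) * (1 + eta)) * N y) a b ->
  {ae mu, forall y, y \in `]a, b[ -> C y = 0} ->
  touched_below a b S rhs (fun y => w y `^ k) x.
Proof.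
move=> xab eta0 cw w0 wx rw C0.
set s := w x in wx *.
have kk : 0 < k * s `^ (k - 1) by rewrite mulr_gt0 ?powR_gt0// (lt_trans ltr01).
pose l y := s `^ k + k * s `^ (k - 1) * (w y - s).
have lx : l x = s `^ k by rewrite /l subrr mulr0 addr0.
have cl : {within `[a, b], continuous l}.
  move=> y; apply: cvgD; first exact: cvg_cst.
  by apply: cvgM; [exact: cvg_cst|apply: cvgB; [exact: cw|exact: cvg_cst]].
have clx : {for x, continuous l}.
  by move/(continuous_within_itvP _ ab) : cl => [c _ _]; exact: c.
have lx0 : 0 < l x by rewrite lx powR_gt0.
have clp : {for x, continuous (fun y => l y `^ p)}.
  by apply: (@cvg_comp _ _ _ l (fun t : R => t `^ p) _ _ _ clx); exact: powR_continuous.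
have small : (fun y => l y `^ p) x < (1 + eta) * s `^ (k - 1).
  rewrite /= lx -powRrM kp mulrDl mul1r ltrDl mulr_gt0// powR_gt0//.
have [e e0 he] := continuous_lt_near clp small.
have := xab; rewrite in_itv /= => /andP[ax xb].
pose c0 := Num.max a (x - e / 2); pose d0 := Num.min b (x + e / 2).
have e2 : 0 < e / 2 by rewrite divr_gt0.
have ac0 : a <= c0 by rewrite le_max lexx.
have d0b : d0 <= b by rewrite ge_min lexx.
have c0x : c0 < x by rewrite gt_max ax/=; lra.
have xd0 : x < d0 by rewrite lt_min xb/=; lra.
have c0e : x - e < c0 by rewrite lt_max; apply/orP; right; lra.
have d0e : d0 < x + e by rewrite gt_min; apply/orP; right; lra.
pose F y := - ((1 - p) * (1 + eta)) * N y.
have Fi : seg_integrable a b F by exact: seg_integrableZ.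
pose F' y := k * s `^ (k - 1) * F y.
have Fi' : seg_integrable c0 d0 F'.
  by apply: seg_integrableZ; exact: seg_integrableS Fi.
exists c0, d0, l, F'; split => //.
- split => //.
  + by apply: continuous_subspaceW cl; apply: subset_itv; rewrite bnd_simp.
  + move=> y; rewrite in_itv /= => /andP[cy yd]; apply: powR_tangent => //; first exact: ltW.
    by apply: w0; rewrite in_itv /= (le_trans ac0 cy) (le_trans yd d0b).
- move=> c d c0c cx xd dd0.
  have ac := le_trans ac0 c0c; have db := le_trans dd0 d0b.
  have := sdiff_represents hS (lexx a) (lexx b) ac (ltW cx) (ltW xd) db Fi rw.
  have -> : sdiff S l c x d = k * s `^ (k - 1) * sdiff S w c x d.
    by rewrite /sdiff /l; ring.
  move=> ->; rewrite /kernint -segintZ.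
    by rewrite (@eq_segint _ c d _ (fun y => kern S c d x y * F' y))// => y _; rewrite /F'; ring.
  by apply: (seg_integrable_kern hS); exact: seg_integrableS Fi.
- apply: (ae_imp C0) => y h; rewrite in_itv /= => /andP[cy yd].
  have yab : y \in `]a, b[ by rewrite in_itv /= (le_lt_trans ac0 cy) (lt_le_trans yd d0b).
  rewrite /rhs (h yab) mul0r subr0 mulrBl.
  have lyp : l y `^ p <= (1 + eta) * s `^ (k - 1).
    by apply: ltW; apply: he; [exact: lt_trans cy|exact: lt_trans d0e].
  have -> : F' y = - ((1 + eta) * s `^ (k - 1) * N y).
    by rewrite /F' /F /k; field; rewrite gt_eqF ?subr_gt0.
  have := ler_wpM2r (N0 y) lyp; have : 0 <= P y * l y `^ p by rewrite mulr_ge0// powR_ge0.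
  by rewrite [l y `^ p * N y]mulrC; lra.
Qed.

End Touching.

Section PositivePart.
Context {R : realType}.

Lemma powR_pos_continuous (r : R) : 0 < r -> continuous (fun t : R => Num.max t 0 `^ r).
Proof.
move=> r0 t; have [t0|t0|->] := ltgtP t 0.
- apply: (@cvg_trans _ ((fun _ : R => 0 : R) @ nbhs t)); last first.
    by rewrite (max_idPr (ltW t0)) powR0 ?gt_eqF//; exact: (@cvg_cst _ (0 : R) _ (nbhs t)).
  apply: near_eq_cvg; near=> s.
  have s0 : s < 0 by near: s; exact: lt_nbhsl.
  by rewrite (max_idPr (ltW s0)) powR0 ?gt_eqF.
- apply: (@cvg_trans _ ((fun s : R => s `^ r) @ nbhs t)); last first.
    by rewrite (max_idPl (ltW t0)); exact: powR_continuous.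
  apply: near_eq_cvg; near=> s.
  have s0 : 0 < s by near: s; exact: lt_nbhsr.
  by rewrite (max_idPl (ltW s0)).
- rewrite /continuous_at /= maxxx powR0 ?gt_eqF//; apply/cvgrPdist_le => e e0.
  have d0 : 0 < e `^ r^-1 by rewrite powR_gt0.
  near=> s.
  rewrite sub0r normrN ger0_norm ?powR_ge0//.
  have sd : Num.max s 0 <= e `^ r^-1.
    rewrite ge_max (ltW d0) andbT; apply: ltW; near: s.
    exact: lt_nbhsl.
  apply: (@le_trans _ _ ((e `^ r^-1) `^ r)).
    by apply: powR_le => //; [exact: ltW|rewrite le_max lexx orbT].
  by rewrite -powRrM mulVf ?gt_eqF// powRr1// ltW.
Unshelve. all: by end_near. Qed.

End PositivePart.

(** * Extending a local subsolution by barriers *)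
Section Patch.
Context {R : realType}.
Local Notation mu := (@lebesgue_measure R).
Variables (a b : R) (S : R -> R) (rhs : R -> R -> R).
Variables (x0 xs x1 : R) (phi uL uR : R -> R).

(** The maximum of phi, extended by 0, with uL to the left of xs and uR to
    its right.  At xs the function phi dominates both, so that the change from
    uL to uR does not show. *)
Lemma patch_subsolution :
  a <= x0 -> x0 < xs -> xs < x1 -> x1 <= b ->
  {within `[x0, x1], continuous phi} -> phi x0 = 0 -> phi x1 = 0 ->
  (forall x, x \in `]x0, x1[ -> 0 < phi x) ->
  (forall x, x \in `]x0, x1[ -> touched_below a b S rhs phi x) ->
  continuous uL -> continuous uR -> (forall y, 0 <= uL y) -> (forall y, 0 <= uR y) ->
  uL a = 0 -> uR b = 0 ->
  (forall y, a < y -> y <= xs -> 0 < uL y) -> (forall y, xs <= y -> y < b -> 0 < uR y) ->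
  uL xs < phi xs -> uR xs < phi xs ->
  (forall x, a < x -> x < xs -> touched_below a b S rhs uL x) ->
  (forall x, xs < x -> x < b -> touched_below a b S rhs uR x) ->
  exists psi : R -> R, [/\ {within `[a, b], continuous psi}, psi a <= 0, psi b <= 0,
    forall x, x \in `]a, b[ -> 0 < psi x & subsolution a b S rhs psi].
Proof.
move=> ax0 x0s sx1 x1b cphi phi0 phi1 phigt tphi cL cR L0 R0 La Rb Lgt Rgt Ls Rs tL tR.
have x01 := ltW (lt_trans x0s sx1).
pose ph y := phi (clamp x0 x1 y).
have cph : continuous ph by exact: clamp_continuous.
have phE y : y \in `[x0, x1] -> ph y = phi y by move=> h; rewrite /ph clamp_id.
have phs : ph xs = phi xs by rewrite phE// in_itv /= !ltW.
have ph_out y : y \notin `]x0, x1[ -> ph y = 0.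
  rewrite in_itv /= negb_and -!leNgt => /orP[h|h].
  - by rewrite /ph clamp_left.
  - by rewrite /ph clamp_right.
have ph0 y : 0 <= ph y.
  have [yin|/ph_out ->//] := boolP (y \in `]x0, x1[).
  by rewrite phE ?ltW ?phigt//; exact: subset_itv_oo_cc.
pose f1 y := Num.max (uL y) (ph y); pose f2 y := Num.max (uR y) (ph y).
have cf1 : continuous f1.
  by move=> y; apply: (@continuous_max _ _ uL ph y); [exact: cL|exact: cph].
have cf2 : continuous f2.
  by move=> y; apply: (@continuous_max _ _ uR ph y); [exact: cR|exact: cph].
have f1s : f1 xs = ph xs by apply/max_idPr; rewrite phs ltW.
have f2s : f2 xs = ph xs by apply/max_idPr; rewrite phs ltW.
pose psi y := f1 (Num.min y xs) + f2 (Num.max y xs) - ph xs.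
have psiL y : y <= xs -> psi y = f1 y.
  by move=> ys; rewrite /psi (min_idPl ys) (max_idPr ys) f2s addrK.
have psiR y : xs <= y -> psi y = f2 y.
  by move=> sy; rewrite /psi (min_idPr sy) (max_idPl sy) f1s addrC addKr.
have phpsi y : ph y <= psi y.
  by case: (leP y xs) => [/psiL ->|/ltW/psiR ->]; rewrite le_max lexx orbT.
have cid : continuous (fun y : R => y) by move=> y; exact: cvg_id.
have ccs : continuous (fun _ : R => xs) by move=> y; exact: cvg_cst.
have cpsi : continuous psi.
  move=> y; apply: cvgB; last exact: cvg_cst.
  have cm : {for y, continuous (fun y : R => Num.min y xs)}.
    by apply: (@continuous_min _ _ (fun y => y) (fun _ => xs) y); [exact: cid|exact: ccs].
  have cM : {for y, continuous (fun y : R => Num.max y xs)}.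
    by apply: (@continuous_max _ _ (fun y => y) (fun _ => xs) y); [exact: cid|exact: ccs].
  apply: cvgD.
  - by apply: (@cvg_comp _ _ _ (fun y : R => Num.min y xs) f1 _ _ _ cm); exact: cf1.
  - by apply: (@cvg_comp _ _ _ (fun y : R => Num.max y xs) f2 _ _ _ cM); exact: cf2.
have as_ : a < xs by exact: le_lt_trans x0s.
have sb : xs < b by exact: lt_le_trans x1b.
have phia : ph a = 0 by apply: ph_out; rewrite in_itv /= ltNge ax0.
have phib : ph b = 0 by apply: ph_out; rewrite in_itv /= [b < x1]ltNge x1b andbF.
exists psi; split.
- exact: continuous_subspaceT.
- by rewrite (psiL _ (ltW as_)) /f1 La phia maxxx.
- by rewrite (psiR _ (ltW sb)) /f2 Rb phib maxxx.
- move=> x; rewrite in_itv /= => /andP[ax xb].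
  have [xs'|/ltW xs'] := leP x xs.
  + by rewrite psiL// lt_max Lgt.
  + by rewrite psiR// lt_max Rgt.
move=> x; rewrite in_itv /= => /andP[ax xb].
have viaphi : 0 < ph x -> psi x = ph x -> touched_below a b S rhs psi x.
  move=> phx psix.
  have xin : x \in `]x0, x1[ by apply: contraLR phx => /ph_out ->; rewrite ltxx.
  have := xin; rewrite in_itv /= => /andP[x0x xx1].
  apply: (touched_below_le x0x xx1 _ _ (tphi x xin)).
  - by move=> y yin; rewrite -phE.
  - by rewrite psix phE//; exact: subset_itv_oo_cc.
have [xs'|xs'|xs'] := ltgtP x xs.
- have [h|h] := leP (ph x) (uL x).
  + apply: (touched_below_le ax xs' _ _ (tL x ax xs')).
    * move=> y; rewrite in_itv /= => /andP[_ ys].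
      by rewrite psiL// le_max lexx.
    * by rewrite (psiL _ (ltW xs')); apply/esym/max_idPl.
  + apply: viaphi; first exact: le_lt_trans h.
    by rewrite (psiL _ (ltW xs')); apply/max_idPr; exact: ltW.
- have [h|h] := leP (ph x) (uR x).
  + apply: (touched_below_le xs' xb _ _ (tR x xs' xb)).
    * move=> y; rewrite in_itv /= => /andP[sy _].
      by rewrite psiR// le_max lexx.
    * by rewrite (psiR _ (ltW xs')); apply/esym/max_idPl.
  + apply: viaphi; first exact: le_lt_trans h.
    by rewrite (psiR _ (ltW xs')); apply/max_idPr; exact: ltW.
- apply: viaphi; last by rewrite xs' psiL.
  by rewrite xs' phs; apply: le_lt_trans Ls.
Qed.

End Patch.

(** * Powers of the scale function as barriers *)
Section PowerBarrier.
Context {R : realType}.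
Local Notation mu := (@lebesgue_measure R).
Variables (a b : R) (b0 : R -> R).
Hypothesis ab : a < b.
Hypothesis hb : {within `[a, b], continuous b0}.
Let S := scale a b b0.
Let Bo := Bover a b0.
Let hS : scale_function a b S := scale_is_scale ab hb.

Lemma is_derive_antiderivative c d (G g : R -> R) : {within `[c, d], continuous G} ->
  {within `[c, d], continuous g} ->
  (forall x : R, x \in `]c, d[ -> is_derive x (1 : R) G (g x)) -> antiderivative c d G g.
Proof.
move=> cG cg dG x; rewrite in_itv /= => /andP[cx xd].
have sub : [set` `[c, x]] `<=` [set` `[c, d]] by apply: subset_itv; rewrite bnd_simp.
have h1 : {within `[c, x], continuous g} by exact: continuous_subspaceW sub cg.
have h2 : {within `[c, x], continuous G} by exact: continuous_subspaceW sub cG.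
have h3 : forall y : R, y \in `]c, x[ -> is_derive y (1 : R) G (g y).
  move=> y; rewrite in_itv /= => /andP[cy yx]; apply: dG.
  by rewrite in_itv /= cy (lt_le_trans yx).
by rewrite (segint_FTC2 cx h1 h2 h3) addrC subrK.
Qed.

Variables (p : R) (P N C : R -> R).
Hypothesis p01 : 0 < p < 1.
Hypotheses (P0 : forall y, 0 <= P y) (C0 : forall y, 0 <= C y).
Let rhs y t := (P y - N y) * t `^ p - C y * t.
Let p1 : p < 1. Proof. by case/andP: p01. Qed.
Let r := 2 / (1 - p).

(** As (T')^2 = Bover^2, the function v = A T^r with r = 2 / (1 - p) satisfies
    (q v')' = A r (r - 1) T^(r - 2) Bover.  Here r (r - 1) = Cp p and r p = r - 2,
    so that this and N v^p are multiples of T^(r - 2), and C v is one up to the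
    factor T^2 <= gam^2.  The sign of T' distinguishes the two barriers. *)
Lemma touched_below_linear_power (sg tau A gam c0 d0 x : R) (T := fun y => sg * S y + tau) :
  sg ^+ 2 = 1 -> 0 < A -> a < c0 -> c0 < x -> x < d0 -> d0 < b ->
  (forall y, y \in `[c0, d0] -> 0 < T y <= gam) ->
  {ae mu, forall y, y \in `]a, b[ ->
     N y * A `^ p + C y * A * gam ^+ 2 <= A * Cp p * Bo y} ->
  touched_below a b S rhs (fun y => A * T y `^ r) x.
Proof.
move=> sg1 A0 ac0 c0x xd0 d0b Tb hNC.
have [p0 _] := andP p01.
have q0 : 0 < 1 - p by rewrite subr_gt0.
have rC : r * (r - 1) = Cp p by rewrite /r /Cp; field; rewrite gt_eqF.
have rp : r * p = r - 2 by rewrite /r; field; rewrite gt_eqF.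
have c0d0 := ltW (lt_trans c0x xd0).
have sub : [set` `[c0, d0]] `<=` [set` `[a, b]].
  by apply: subset_itv; rewrite bnd_simp; exact: ltW.
have T0 y : y \in `[c0, d0] -> 0 < T y by move=> /Tb/andP[].
have cT : continuous T.
  move=> y; apply: cvgD; last exact: cvg_cst.
  by apply: cvgM; [exact: cvg_cst|exact: (scale_continuous hS)].
have cTr s : {within `[c0, d0], continuous (fun y => T y `^ s)}.
  apply: continuous_in_subspaceT => y; rewrite inE => yin.
  by apply: (@cvg_comp _ _ _ T (fun t : R => t `^ s) _ _ _ (cT y)); exact/powR_continuous/T0.
have cB : {within `[c0, d0], continuous Bo} := continuous_subspaceW sub (Bover_continuous ab hb).
have dT y : y \in `]c0, d0[ -> is_derive y (1 : R) T (sg * Bo y).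
  rewrite in_itv /= => /andP[cy yd].
  have yab : y \in `]a, b[ by rewrite in_itv /= (lt_trans ac0) ?(lt_trans yd).
  have dS := is_derive_scale ab hb yab.
  have := is_deriveD (is_deriveZ sg dS) (is_derive_cst tau y (1 : R)).
  by rewrite addr0.
have dTr s y : y \in `]c0, d0[ ->
    is_derive y (1 : R) (fun y => T y `^ s) (s * T y `^ (s - 1) * (sg * Bo y)).
  move=> yin; have Ty := T0 _ (subset_itv_oo_cc yin).
  exact: (@is_derive1_comp _ (fun t : R => t `^ s) T y _ _ (is_derive_powR s Ty) (dT y yin)).
pose Y y := A * r * sg * T y `^ (r - 1).
pose F y := - (A * Cp p * T y `^ (r - 2) * Bo y).
have cv : {within `[c0, d0], continuous (fun y => A * T y `^ r)}.
  by move=> y; apply: cvgM; [exact: cvg_cst|exact: cTr].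
have cY : {within `[c0, d0], continuous Y}.
  by move=> y; apply: cvgM; [exact: cvg_cst|exact: cTr].
have cF : {within `[c0, d0], continuous F}.
  move=> y; apply: cvgN; apply: cvgM; last exact: cB.
  by apply: cvgM; [exact: cvg_cst|exact: cTr].
have cNF : {within `[c0, d0], continuous (fun y => - F y)}.
  by move=> y; apply: cvgN; exact: cF.
have cBY : {within `[c0, d0], continuous (fun y => Bo y * Y y)}.
  by move=> y; apply: cvgM; [exact: cB|exact: cY].
have Fi := seg_continuous_integrable cF.
apply: (touched_below_represents hS (ltW ac0) c0x xd0 (ltW d0b) cv Fi).
- apply: (represents_system ab hb (ltW ac0) c0d0 (ltW d0b) Fi (Y := Y)).
  + apply: (is_derive_antiderivative cv cBY) => y yin.
    have := is_deriveZ A (dTr r y yin).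
    by rewrite (_ : A *: _ = Bo y * Y y)// /Y /GRing.scale /=; ring.
  + apply: (is_derive_antiderivative cY cNF) => y yin.
    have := is_deriveZ (A * r * sg) (dTr (r - 1) y yin).
    rewrite (_ : (A * r * sg) *: _ = - F y)//.
    have -> : r - 1 - 1 = r - 2 by ring.
    rewrite /F /GRing.scale /= opprK -rC.
    transitivity (sg ^+ 2 * (A * (r * (r - 1)) * T y `^ (r - 2) * Bo y)); first by ring.
    by rewrite sg1 mul1r.
apply: (ae_imp hNC) => y h yin.
have yin' := subset_itv_oo_cc yin.
have /andP[Ty Tg] := Tb _ yin'.
have yab : y \in `]a, b[.
  by move: yin; rewrite !in_itv /= => /andP[cy yd]; rewrite (lt_trans ac0) ?(lt_trans yd).
have {}h := h yab.
set t := T y in Ty Tg *.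
have trp : (A * t `^ r) `^ p = A `^ p * t `^ (r - 2).
  by rewrite powRM ?powR_ge0 ?(ltW A0)// -powRrM rp.
have t2 : t `^ r = t `^ (r - 2) * t ^+ 2.
  by rewrite -powR_mulrn ?(ltW Ty)// -powRD ?subrK// (gt_eqF Ty) implybT.
rewrite /rhs /F trp t2 -/t.
have tr0 : 0 < t `^ (r - 2) by rewrite powR_gt0.
have tg2 : t ^+ 2 <= gam ^+ 2 by rewrite lerXn2r ?nnegrE ?(ltW Ty)// (le_trans _ Tg)// ltW.
have h1 : C y * A * t ^+ 2 <= C y * A * gam ^+ 2.
  by rewrite ler_wpM2l// mulr_ge0// ltW.
have h2 : N y * A `^ p + C y * A * t ^+ 2 <= A * Cp p * Bo y by lra.
have h3 := ler_wpM2r (ltW tr0) h2.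
have h4 : 0 <= P y * (A `^ p * t `^ (r - 2)) by rewrite mulr_ge0// mulr_ge0// powR_ge0.
move: h3 h4; set z := t `^ (r - 2); set Ap := A `^ p; set t2' := t ^+ 2; set CC := Cp p; set B := Bo y.
by lra.
Qed.

End PowerBarrier.

(** * Existence of a positive solution *)
Section Problem.
Context {R : realType}.
Local Notation mu := (@lebesgue_measure R).
Variables (a b p : R) (b0 c m : R -> R).
Hypothesis ab : a < b.
Hypothesis p01 : 0 < p < 1.
Hypothesis hb : {within `[a, b], continuous b0}.
Hypothesis hc : inLp +oo%E `]a, b[ c.
Hypothesis hc0 : {ae mu, forall x : R, x \in `]a, b[ -> 0 <= c x}.
Hypothesis hm : inLp 2%:E `]a, b[ m.

Let S := scale a b b0.
Let q := Bunder a b0.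
Let Bo := Bover a b0.
Let hS : scale_function a b S := scale_is_scale ab hb.
Let p0 : 0 < p. Proof. by case/andP: p01. Qed.
Let p1 : p < 1. Proof. by case/andP: p01. Qed.
Let k := (1 - p)^-1.
Let k0 : 0 < k. Proof. by rewrite invr_gt0 subr_gt0. Qed.
Let k1p : k * (1 - p) = 1. Proof. by rewrite mulVf// gt_eqF// subr_gt0. Qed.
Let Cn := Lpnorm +oo%E `]a, b[ c.

(** The bounds on c hold almost everywhere only; this representative of its class
    satisfies them everywhere. *)
Definition bounded_rep y := Num.min (Num.max (c y) 0) Cn.
Let cc := bounded_rep.

Lemma bounded_rep_itv y : 0 <= cc y <= Cn.
Proof. by rewrite le_min le_max lexx orbT Lpnorm_ge0 ge_min lexx orbT. Qed.

Lemma bounded_rep_ae : {ae mu, forall y : R, y \in `]a, b[ -> cc y = c y}.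
Proof.
apply: (ae_imp2 hc0 (inLpy_ae hc)) => y h1 h2 yab.
rewrite /cc /bounded_rep (max_idPl (h1 yab)); apply/min_idPl.
exact: le_trans (ler_norm _) (h2 yab).
Qed.

Let cc_measurable : measurable_fun `[a, b] cc.
Proof.
apply: measurable_minr; last exact: measurable_cst.
by apply: measurable_maxr; [exact: inLp_measurable hc|exact: measurable_cst].
Qed.

(** The terms of the equation after multiplication by q. *)
Definition source_pos y := q y * m^\+ y.
Definition source_neg y := q y * m^\- y.
Definition killing y := q y * cc y.
Let P := source_pos.
Let N := source_neg.
Let C := killing.

Let P0 y : 0 <= P y.
Proof. by rewrite mulr_ge0 ?funrpos_ge0// ltW// Bunder_gt0. Qed.

Let N0 y : 0 <= N y.
Proof. by rewrite mulr_ge0 ?funrneg_ge0// ltW// Bunder_gt0. Qed.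

Let C0 y : 0 <= C y.
Proof. by rewrite mulr_ge0 ?(ltW (Bunder_gt0 _ _ _))//; case/andP: (bounded_rep_itv y). Qed.

Let PN y : P y - N y = q y * m y.
Proof. by rewrite /P /N /source_pos /source_neg -mulrBr -[in RHS](funrposBneg m). Qed.

Let cq : {within `[a, b], continuous q} := Bunder_continuous ab hb.

Let Pi : seg_integrable a b P.
Proof.
apply: seg_integrable_mulc => //; have mi := inLp2_integrable hm.
apply: (seg_integrable_le _ _ (seg_integrable_norm mi)).
  by apply: measurable_funrpos; exact: seg_measurable_fun mi.
move=> y _; rewrite ger0_norm ?funrpos_ge0//.
by rewrite /funrpos ge_max normr_ge0 ler_norm.
Qed.

Let Ni : seg_integrable a b N.
Proof.
apply: seg_integrable_mulc => //; have mi := inLp2_integrable hm.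
apply: (seg_integrable_le _ _ (seg_integrable_norm mi)).
  by apply: measurable_funrneg; exact: seg_measurable_fun mi.
move=> y _; rewrite ger0_norm ?funrneg_ge0//.
by rewrite /funrneg ge_max normr_ge0 -normrN ler_norm.
Qed.

Let ccM y : `|cc y| <= Cn.
Proof. by have /andP[h1 h2] := bounded_rep_itv y; rewrite ger0_norm. Qed.

Let Ci : seg_integrable a b C.
Proof.
apply: seg_integrable_mulc => //.
apply: (@seg_integrable_le _ _ _ _ (fun _ : R => Cn)) => //.
by apply: seg_continuous_integrable => y; exact: cvg_cst.
Qed.

Let rhs y t := (P y - N y) * t `^ p - C y * t.

Lemma solution_of_subsolution (psi : R -> R) : {within `[a, b], continuous psi} ->
  psi a <= 0 -> psi b <= 0 -> (forall x, x \in `]a, b[ -> 0 < psi x) ->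
  subsolution a b S rhs psi -> exists u : R -> R, is_solution a b b0 c m p u.
Proof.
move=> cpsi psia psib psi0 sub.
have [u [cu psiu [M uM] fi uE]] :=
  solution_above_subsolution ab hS p01 Pi Ni Ci P0 N0 C0 cpsi psia psib psi0 sub.
have M0 : 0 <= M by have /andP[h1 h2] := uM a; exact: le_trans h2.
have cu' : {within `[a, b], continuous u} by exact: continuous_subspaceT.
have mu' := seg_continuous_measurable cu'.
pose f y := u y `^ p * m y + - cc y * u y.
have f2 : inLp 2%:E `]a, b[ f.
  apply: inLp2D.
  - apply: (@inLp2_mulb _ _ _ (M `^ p)) => //.
      by apply: (@measurableT_comp _ _ _ _ _ _ (fun t : R => t `^ p) _ u _ mu'); exact: measurable_powR.
    move=> y _; have /andP[u0 uMy] := uM y.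
    by rewrite ger0_norm ?powR_ge0//; apply: powR_le => //; exact: ltW.
  - apply: (@inLp2_mulb _ _ _ Cn); last exact: continuous_inLp2.
      exact: measurable_funN cc_measurable.
    by move=> y _; rewrite normrN.
have uE' x : u x = Green S a b (fun y => q y * f y) x.
  rewrite uE; apply: eq_Green => y _.
  by rewrite PN /C /killing /f; ring.
have [u1 [u2 [s22 s120 eqn]]] := Green_sobolev ab hb f2 uE'.
exists u, u1, u2; split => //.
- move=> x xab; apply: (lt_le_trans (psi0 x xab)); apply: psiu.
  exact: subset_itv_oo_cc.
- apply: (ae_imp bounded_rep_ae) => x h xab.
  by rewrite (eqn x xab) -(h xab) /f; ring.
Qed.

Variables (x0 x1 : R).
Hypotheses (ax0 : a <= x0) (x01 : x0 < x1) (x1b : x1 <= b).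
Hypothesis hmI : {ae mu, forall x : R, x \in `]x0, x1[ -> 0 <= m x}.

Let I_ab y : y \in `]x0, x1[ -> y \in `]a, b[.
Proof.
by rewrite !in_itv /= => /andP[h1 h2]; rewrite (le_lt_trans ax0)// (lt_le_trans h2).
Qed.

(** As p < 1, an eigenfunction is a subsolution as long as it is small: if
    t^(1 - p) <= 1 / lam, then lam t <= t^p.  It is scaled so that its maximum, at
    xs, is the largest admissible value. *)
Lemma eigenfunction_subsolution (lam : R) : principal_eigenvalue x0 x1 b0 c m lam ->
  exists (phi : R -> R) (xs : R), [/\ x0 < xs, xs < x1, phi xs = lam^-1 `^ k,
    [/\ {within `[x0, x1], continuous phi}, phi x0 = 0 & phi x1 = 0] &
    forall x, x \in `]x0, x1[ -> 0 < phi x /\ touched_below a b S rhs phi x].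
Proof.
move=> [lam0 [phi hphi]].
have [F [Fi FE rF phi0 phi1]] := dirichlet_solution_represents ab hb ax0 x01 x1b hphi.
have [u1 [u2 [_ _ cphi phigt _]]] := hphi.
have [xs xsin phimax] := EVT_max (ltW x01) cphi.
have midin : (x0 + x1) / 2 \in `]x0, x1[ by rewrite in_itv /= !midf_lt.
have phis : 0 < phi xs.
  apply: (lt_le_trans (phigt _ midin)); apply: phimax; exact: subset_itv_oo_cc.
have [x0s sx1] : x0 < xs /\ xs < x1.
  have ne y : phi y = 0 -> xs != y.
    by move=> y0; apply: contraTneq phis => ->; rewrite y0 ltxx.
  have := xsin; rewrite in_itv /= => /andP[h1 h2].
  by split; rewrite lt_neqAle ?h1 ?h2 andbT ?ne// eq_sym ne.
pose L := lam^-1; have L0 : 0 < L by rewrite invr_gt0.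
pose kap := L `^ k / phi xs.
have kap0 : 0 < kap by rewrite divr_gt0// powR_gt0.
pose v y := kap * phi y.
have vs : v xs = L `^ k by rewrite /v /kap divfK// gt_eqF.
have cv : {within `[x0, x1], continuous v}.
  by move=> y; apply: cvgM; [exact: cvg_cst|exact: cphi].
exists v, xs; split => //; first by rewrite /v phi0 phi1 mulr0.
have Fi' : seg_integrable x0 x1 (fun y => kap * F y) by exact: seg_integrableZ.
have rv : represents S v (fun y => kap * F y) x0 x1.
  have [z hz] := rF; exists (kap * z) => x xin; rewrite /v (hz x xin) mulrBr mulrDr mulrA.
  congr (_ - _); have := xin; rewrite in_itv /= => /andP[x0x xx1].
  have Fx : seg_integrable x0 x F by exact: seg_integrableS Fi.
  have Sx : seg_integrable x0 x (fun y => (S x - S y) * F y).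
    apply: seg_integrable_mulc => //; apply: continuous_subspaceT => y.
    by apply: cvgB; [exact: cvg_cst|exact: (scale_continuous hS)].
  by rewrite -(segintZ kap Sx); apply: eq_segint => y _; rewrite mulrCA.
move=> x xin; split; first by rewrite mulr_gt0// phigt.
have := xin; rewrite in_itv /= => /andP[x0x xx1].
apply: (touched_below_represents hS ax0 x0x xx1 x1b cv Fi' rv).
apply: (ae_imp2 hmI (ae_imp2 FE bounded_rep_ae (fun y h1 h2 => conj h1 h2))) => y my [Fy cy] yin.
rewrite /rhs PN /C /killing (Fy yin) -/cc (cy (I_ab yin)) -/q.
set t := v y.
have t0 : 0 < t by rewrite mulr_gt0// phigt.
have tL : t `^ (1 - p) <= L.
  have -> : L = (L `^ k) `^ (1 - p) by rewrite -powRrM k1p powRr1// ltW.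
  apply: powR_le => //.
  - by rewrite subr_ge0 ltW.
  - exact: ltW.
  - by rewrite -vs ler_wpM2l ?(ltW kap0)//; apply: phimax; exact: subset_itv_oo_cc.
have tt : t = t `^ p * t `^ (1 - p).
  by rewrite -powRD ?(gt_eqF t0) ?implybT// addrC subrK powRr1// ltW.
have lt : lam * t <= t `^ p.
  rewrite {1}tt mulrCA -[leRHS]mulr1 ler_wpM2l ?powR_ge0//.
  by rewrite mulrC -ler_pdivlMr// div1r.
have -> : kap * (q y * (lam * m y * phi y - c y * phi y)) = q y * m y * (lam * t) - q y * c y * t.
  by rewrite /t /v; ring.
rewrite lerD2r ler_wpM2l// mulr_ge0 ?my// ltW//; exact: Bunder_gt0.
Qed.

Let L := (lambda1 x0 x1 b0 c m)^-1.

(** The barriers are compared with the maximum of the eigenfunction at every point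
    of ]x0, x1[, because the maximum point is not known.  Positivity of L excludes
    the default value of lambda1. *)
Lemma solution_of_barriers (uL uR : R -> R) : 0 < L ->
  continuous uL -> continuous uR -> (forall y, 0 <= uL y) -> (forall y, 0 <= uR y) ->
  uL a = 0 -> uR b = 0 ->
  (forall y, a < y -> y < x1 -> 0 < uL y) -> (forall y, x0 < y -> y < b -> 0 < uR y) ->
  (forall y, y \in `]x0, x1[ -> uL y < L `^ k) ->
  (forall y, y \in `]x0, x1[ -> uR y < L `^ k) ->
  (forall x, a < x -> x < x1 -> touched_below a b S rhs uL x) ->
  (forall x, x0 < x -> x < b -> touched_below a b S rhs uR x) ->
  exists u : R -> R, is_solution a b b0 c m p u.
Proof.
move=> L0 cL cR uL0 uR0 La Rb Lgt Rgt Llt Rlt tL tR.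
have [lam lamE hlam] : exists2 lam, L = lam^-1 & principal_eigenvalue x0 x1 b0 c m lam.
  move: L0; rewrite /L /lambda1; case: xgetP => [lam _ h _|_]; first by exists lam.
  by rewrite invr0 ltxx.
have [phi [xs [x0s sx1 phis [cphi phi0 phi1] hphi]]] := eigenfunction_subsolution hlam.
have sin : xs \in `]x0, x1[ by rewrite in_itv /= x0s.
have [psi [cpsi psia psib psi0 sub]] := @patch_subsolution R a b S rhs x0 xs x1 phi uL uR
  ax0 x0s sx1 x1b cphi phi0 phi1 (fun x h => (hphi x h).1) (fun x h => (hphi x h).2)
  cL cR uL0 uR0 La Rb
  (fun y h1 h2 => Lgt y h1 (le_lt_trans h2 sx1))
  (fun y h1 h2 => Rgt y (lt_le_trans x0s h1) h2)
  ltac:(by rewrite phis -lamE; exact: Llt) ltac:(by rewrite phis -lamE; exact: Rlt)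
  (fun x h1 h2 => tL x h1 (lt_trans h2 sx1)) (fun x h1 h2 => tR x (lt_trans x0s h1) h2).
exact: solution_of_subsolution sub.
Qed.


Let gam := gammab a b x0 x1 b0.
Let Q := Lpnorm +oo%E `]a, b[ q.
Let Nn := Lpnorm +oo%E `]a, b[ m^\-.
Let r := 2 / (1 - p).
Let r0 : 0 < r. Proof. by rewrite divr_gt0// subr_gt0. Qed.

Let Bover_Lpnorm1 s t : a <= s -> s <= t -> t <= b -> Lpnorm 1%E `]s, t[ Bo = S t - S s.
Proof.
move=> as_ st tb; rewrite Lpnorm1E; last first.
  by apply: (seg_integrableS as_ tb); exact/seg_continuous_integrable/Bover_continuous.
rewrite -(segint_Bover ab hb as_ st tb); apply: eq_segint => y _.
by rewrite ger0_norm// ltW// Bover_gt0.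
Qed.

Let gammabE : gam = Num.max (S x1) (S b - S x0).
Proof.
have ax1 := le_trans ax0 (ltW x01); have x0b := le_trans (ltW x01) x1b.
rewrite /gam /gammab (Bover_Lpnorm1 (lexx a) ax1 x1b) (Bover_Lpnorm1 ax0 x0b (lexx b)).
by rewrite (scale_a hS) subr0.
Qed.

Let S_gt0 y : a < y -> y <= b -> 0 < S y.
Proof. by move=> ay yb; rewrite -(scale_a hS) (scale_lt hS). Qed.

Let S_lt y z : a <= y -> y < z -> z <= b -> S y < S z.
Proof. exact: (scale_lt hS). Qed.

Let power_continuous s A (T : R -> R) : 0 < s -> continuous T -> (forall y, 0 <= T y) ->
  continuous (fun y => A * T y `^ s).
Proof.
move=> s0 cT T0; have -> : (fun y => A * T y `^ s) = (fun y => A * Num.max (T y) 0 `^ s).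
  by apply/funext => y; rewrite (max_idPl (T0 y)).
move=> y; apply: cvgM; first exact: cvg_cst.
apply: (@cvg_comp _ _ _ T (fun t : R => Num.max t 0 `^ s) _ _ _ (cT y)).
exact: powR_pos_continuous.
Qed.

(** The barriers are A S^r and A (S b - S)^r with the same A; gam bounds their
    bases on the intervals where they are used. *)
Lemma solution_of_small_norm (K := (gam * Q) ^+ 2) : inLp +oo%E `]a, b[ m^\- ->
  0 < K / (Cp p - Cn * K) * Nn <= L -> exists u : R -> R, is_solution a b b0 c m p u.
Proof.
move=> hmn /andP[pos le].
have Kge : 0 <= K by exact: sqr_ge0.
have Nge : 0 <= Nn by exact: Lpnorm_ge0.
have L0 : 0 < L by exact: lt_le_trans le.
pose D := Cp p - Cn * K.
have KD : 0 < K / D.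
  rewrite lt_neqAle; apply/andP; split.
    by apply: contraTneq pos => e; rewrite -/D -e mul0r ltxx.
  rewrite leNgt; apply/negP => h.
  by move: pos; rewrite ltNge mulr_le0_ge0// ltW.
have Kn0 : K != 0 by apply: contraTneq KD => ->; rewrite mul0r ltxx.
have K0 : 0 < K by rewrite lt_neqAle eq_sym Kn0.
have D0 : 0 < D by move: KD; rewrite pmulr_rgt0// invr_gt0.
have N_gt0 : 0 < Nn by move: pos; rewrite pmulr_rgt0.
have Qn0 : Q != 0 by apply: contraNneq Kn0 => e; rewrite /K e mulr0 expr0n.
have Q0 : 0 < Q by rewrite lt_neqAle eq_sym Qn0; exact: Lpnorm_ge0.
have g0 : 0 < gam by rewrite gammabE lt_max S_gt0// (le_lt_trans ax0).
(* With A^(1 - p) = E, the bounds m^- <= Nn, c <= Cn and q <= Q turn the condition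
   on A in touched_below_linear_power into D + Cn K = Cp p. *)
pose E := Q ^+ 2 * Nn / D.
have E0 : 0 < E by rewrite divr_gt0// mulr_gt0// exprn_gt0.
pose A := E `^ k.
have A0 : 0 < A by rewrite powR_gt0.
have Ap : A `^ p * E = A.
  have -> : E = A `^ (1 - p) by rewrite -powRrM k1p powRr1// ltW.
  by rewrite -powRD ?(gt_eqF A0) ?implybT// addrC subrK powRr1// ltW.
have rk : r = k * 2%:R by rewrite /r mulrC.
have Agam : A * gam `^ r <= L `^ k.
  have -> : gam `^ r = (gam ^+ 2) `^ k.
    by rewrite -powR_mulrn ?(ltW g0)// -powRrM mulrC rk.
  rewrite -powRM ?(ltW E0) ?sqr_ge0//; apply: powR_le; first exact: ltW.
    by rewrite mulr_ge0 ?sqr_ge0 ?(ltW E0).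
  apply: le_trans le; rewrite -/D le_eqVlt; apply/orP; left; apply/eqP.
  by rewrite /E /K exprMn; ring.
have hNC : {ae mu, forall y, y \in `]a, b[ ->
     N y * A `^ p + C y * A * gam ^+ 2 <= A * Cp p * Bo y}.
  apply: (ae_imp2 (Lpnormy_ae Qn0) (inLpy_ae hmn)) => y h1 h2 yab.
  have {h1} qQ : q y <= Q by exact: le_trans (ler_norm _) (h1 yab).
  have {h2} mN : m^\- y <= Nn by exact: le_trans (ler_norm _) (h2 yab).
  have q0 : 0 < q y by exact: Bunder_gt0.
  have /andP[cc0 ccn] := bounded_rep_itv y.
  have e1 : N y * A `^ p <= q y * Nn * A `^ p.
    by rewrite ler_wpM2r ?powR_ge0// ler_wpM2l// ltW.
  have e2 : C y * A * gam ^+ 2 <= q y * Cn * A * gam ^+ 2.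
    rewrite ler_wpM2r ?sqr_ge0// ler_wpM2r ?(ltW A0)// ler_wpM2l// ltW//.
  have e3 : q y * Nn * A `^ p + q y * Cn * A * gam ^+ 2 = A * Cp p * (q y / Q ^+ 2).
    rewrite -{2 3}Ap /E.
    have -> : Cp p = D + Cn * (gam * Q) ^+ 2 by rewrite /D /K subrK.
    by field; rewrite Qn0 (gt_eqF D0).
  apply: (le_trans (lerD e1 e2)); rewrite e3 ler_wpM2l//.
    rewrite mulr_ge0 ?(ltW A0)// /Cp divr_ge0 ?sqr_ge0// mulr_ge0// addr_ge0// ltW//.
  have -> : Bo y = (q y)^-1.
    by apply: (mulIf (lt0r_neq0 q0)); rewrite BoverM mulVf// gt_eqF.
  rewrite ler_pdivrMr ?exprn_gt0// -(ler_pM2l q0) mulrA divff ?gt_eqF// mul1r -expr2.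
  by rewrite lerXn2r ?nnegrE ?(ltW q0) ?(ltW Q0).
pose TL y := 1 * S y + 0; pose TR y := -1 * S y + S b.
have TLE y : TL y = S y by rewrite /TL mul1r addr0.
have TRE y : TR y = S b - S y by rewrite /TR mulN1r addrC.
have cS : continuous S := scale_continuous hS.
have cTL : continuous TL.
  by move=> y; apply: cvgD; [apply: cvgM; [exact: cvg_cst|exact: cS]|exact: cvg_cst].
have cTR : continuous TR.
  by move=> y; apply: cvgD; [apply: cvgM; [exact: cvg_cst|exact: cS]|exact: cvg_cst].
have TL0 y : 0 <= TL y by rewrite TLE; case/andP: (scale_itv ab hS y).
have TR0 y : 0 <= TR y by rewrite TRE subr_ge0; case/andP: (scale_itv ab hS y).
have lt_gam t : 0 <= t -> t < gam -> A * t `^ r < L `^ k.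
  move=> t0 tg; apply: lt_le_trans Agam; rewrite ltr_pM2l//.
  by apply: gt0_ltr_powR => //; rewrite nnegrE// ltW.
have ltL y : a <= y -> y < x1 -> TL y < gam.
  by move=> ay yx; rewrite TLE gammabE lt_max (S_lt ay yx).
have ltR y : x0 < y -> y <= b -> TR y < gam.
  by move=> xy yb; rewrite TRE gammabE lt_max ltrD2l ltrN2 (S_lt ax0 xy yb) orbT.
apply: (@solution_of_barriers (fun y => A * TL y `^ r) (fun y => A * TR y `^ r)) => //.
- exact: power_continuous.
- exact: power_continuous.
- by move=> y; rewrite mulr_ge0 ?powR_ge0// ltW.
- by move=> y; rewrite mulr_ge0 ?powR_ge0// ltW.
- by rewrite TLE (scale_a hS) powR0 ?mulr0// gt_eqF.
- by rewrite TRE subrr powR0 ?mulr0// gt_eqF.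
- move=> y ay yx; rewrite mulr_gt0// powR_gt0// TLE S_gt0//.
  by rewrite (le_trans _ x1b)// ltW.
- by move=> y xy yb; rewrite mulr_gt0// powR_gt0// TRE subr_gt0 S_lt// (le_trans ax0)// ltW.
- move=> y; rewrite in_itv /= => /andP[xy yx]; apply: lt_gam => //.
  by apply: ltL => //; rewrite (le_trans ax0)// ltW.
- move=> y; rewrite in_itv /= => /andP[xy yx]; apply: lt_gam => //.
  by apply: ltR => //; rewrite (le_trans _ x1b)// ltW.
- move=> x ax xx1.
  apply: (@touched_below_linear_power R a b b0 ab hb p P N C p01 P0 C0 1 0 A gam
    ((a + x) / 2) ((x + x1) / 2) x) => //; rewrite ?expr1n ?midf_lt//.
  + by rewrite (lt_le_trans _ x1b)// midf_lt.
  + move=> y; rewrite in_itv /= => /andP[h1 h2].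
    have ay : a < y by rewrite (lt_le_trans _ h1)// midf_lt.
    have yx : y < x1 by rewrite (le_lt_trans h2)// midf_lt.
    apply/andP; split; last by apply: ltW; apply: ltL => //; exact: ltW.
    by rewrite -/(TL y) TLE S_gt0// (le_trans (ltW yx)).
- move=> x xx bx.
  apply: (@touched_below_linear_power R a b b0 ab hb p P N C p01 P0 C0 (-1) (S b) A gam
    ((x0 + x) / 2) ((x + b) / 2) x) => //; rewrite ?sqrrN ?expr1n ?midf_lt//.
  + by rewrite (le_lt_trans ax0)// midf_lt.
  + move=> y; rewrite in_itv /= => /andP[h1 h2].
    have xy : x0 < y by rewrite (lt_le_trans _ h1)// midf_lt.
    have yb : y < b by rewrite (le_lt_trans h2)// midf_lt.
    apply/andP; split; last by apply: ltW; apply: ltR => //; exact: ltW.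
    by rewrite -/(TR y) TRE subr_gt0 S_lt// (le_trans ax0)// ltW.
Qed.


(** JL solves (q w')' = N with w = q w' = 0 at a, and JR with the same at b. *)
Let JL x := segint a x (fun y => (S x - S y) * N y).
Let JR x := segint x b (fun y => (S y - S x) * N y).

Let Nix s t : a <= s -> t <= b -> seg_integrable s t N.
Proof. by move=> as_ tb; exact: seg_integrableS Ni. Qed.

Let SN s t : a <= s -> t <= b -> seg_integrable s t (fun y => S y * N y).
Proof. by move=> as_ tb; apply: (seg_integrable_scale hS); exact: Nix. Qed.

Let kSN z s t : a <= s -> t <= b -> seg_integrable s t (fun y => (z - S y) * N y).
Proof.
move=> as_ tb; apply: seg_integrable_mulc; last exact: Nix.
apply: continuous_subspaceT => y.
by apply: cvgB; [exact: cvg_cst|exact: (scale_continuous hS)].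
Qed.

Let SkN z s t : a <= s -> t <= b -> seg_integrable s t (fun y => (S y - z) * N y).
Proof.
move=> as_ tb; apply: (eq_seg_integrable _ (seg_integrableN (kSN z as_ tb))) => y _.
by rewrite -mulNr opprB.
Qed.

Let JLE x : x \in `[a, b] -> JL x = S x * segint a x N - segint a x (fun y => S y * N y).
Proof. by rewrite in_itv /= => /andP[ax xb]; rewrite /JL (segint_scaleBr hS)//; exact: Nix. Qed.

Let JRE x : x \in `[a, b] ->
  JR x = segint a b (fun y => S y * N y) - segint a b N * S x + JL x.
Proof.
move=> xab; have := xab; rewrite in_itv /= => /andP[ax xb].
have -> : JR x = segint x b (fun y => S y * N y) - S x * segint x b N.
  rewrite /JR -opprB -(segint_scaleBr hS); last exact: Nix.
  rewrite -[RHS]segintN; last exact: kSN.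
  by apply: eq_segint => y _; rewrite -mulNr opprB.
rewrite JLE// (segint_split (x := x) _ Ni) ?ax//.
by rewrite (segint_split (x := x) _ (SN (lexx a) (lexx b))) ?ax//; ring.
Qed.

Let JL_continuous : {within `[a, b], continuous JL}.
Proof.
apply: (@subspace_eq_continuous _ _ _ (fun x => S x * segint a x N - segint a x (fun y => S y * N y))).
  by move=> x; rewrite inE => xab; rewrite -JLE.
have cN := segint_continuous (ltW ab) Ni.
have cSN := segint_continuous (ltW ab) (SN (lexx a) (lexx b)).
have cS : {within `[a, b], continuous S} := continuous_subspaceT (scale_continuous hS).
by move=> x; apply: cvgB; [apply: cvgM; [exact: cS|exact: cN]|exact: cSN].
Qed.

Let JL_ge0 x : x \in `[a, b] -> 0 <= JL x.
Proof.
rewrite in_itv /= => /andP[ax xb]; apply: segint_ge0 => y; rewrite in_itv /= => /andP[ay yx].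
by rewrite mulr_ge0// subr_ge0 (scale_le hS).
Qed.

Let JR_ge0 x : x \in `[a, b] -> 0 <= JR x.
Proof.
rewrite in_itv /= => /andP[ax xb]; apply: segint_ge0 => y; rewrite in_itv /= => /andP[xy yb].
by rewrite mulr_ge0// subr_ge0 (scale_le hS).
Qed.

(** Exchanging the order of integration turns the two integrals into values of JR
    and JL. *)
Let calME : calM a b x0 x1 b0 m = Num.max (JR x0) (JL x1).
Proof.
have ax1 := le_trans ax0 (ltW x01); have x0b := le_trans (ltW x01) x1b.
have Boi s t : a <= s -> t <= b -> seg_integrable s t Bo.
  move=> as_ tb; apply: (seg_integrableS as_ tb).
  exact/seg_continuous_integrable/Bover_continuous.
have normN s t : a <= s -> t <= b ->
    Lpnorm 1%E `]s, t[ (fun y => m^\- y * Bunder a b0 y) = segint s t N.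
  move=> as_ tb; rewrite Lpnorm1E.
    by apply: eq_segint => y _; rewrite mulrC; exact: (ger0_norm (N0 y)).
  by apply: (eq_seg_integrable _ (Nix as_ tb)) => y _; rewrite /N /source_neg mulrC.
have prodE s t (G : R -> R) : a <= s -> t <= b -> {within `[s, t], continuous G} ->
    \int[mu]_(x in `]s, t[) (Bo x * G x) = segint s t (fun x => Bo x * G x).
  move=> as_ tb cG; apply: segint_oo.
  apply: (@eq_seg_integrable _ _ _ (fun x => G x * Bo x)) => [x _|]; first exact: mulrC.
  by apply: seg_integrable_mulc => //; exact: Boi.
have cNx s t : a <= s -> s <= t -> t <= b -> {within `[s, t], continuous (fun x => segint s x N)}.
  by move=> as_ st tb; apply: segint_continuous => //; exact: Nix.
rewrite /calM; congr Num.max.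
- have cNb : {within `[x0, b], continuous (fun x => segint x b N)}.
    apply: (@subspace_eq_continuous _ _ _ (fun x => segint x0 b N - segint x0 x N)).
      move=> x; rewrite inE /= in_itv /= => /andP[xx xb].
      by rewrite (segint_split (x := x) _ (Nix ax0 (lexx b))) ?xx// addrC addKr.
    by move=> x; apply: cvgB; [exact: cvg_cst|exact: (cNx _ _ ax0 x0b (lexx b))].
  transitivity (\int[mu]_(x in `]x0, b[) (Bo x * segint x b N)).
    apply: eq_Rintegral => x; rewrite inE /= in_itv /= => /andP[xx xb].
    by rewrite normN// (le_trans ax0)// ltW.
  rewrite prodE// -segint_triangle; [|exact: Nix|exact: Boi].
  apply: eq_segint => y; rewrite in_itv /= => /andP[xy yb].
  by rewrite (segint_Bover ab hb ax0 xy yb) mulrC.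
- transitivity (\int[mu]_(x in `]a, x1[) (Bo x * segint a x N)).
    apply: eq_Rintegral => x; rewrite inE /= in_itv /= => /andP[ax xx].
    by rewrite normN// (le_trans (ltW xx)).
  rewrite prodE//; last exact: cNx.
  by rewrite (scale_triangle ab hb (lexx a) ax1 x1b); last exact: Nix.
Qed.

(** The barriers are (th JL + eta S)^k and (th JR + eta (S b - S))^k.  The terms
    with eta make them positive, and th exceeds 1 - p as touched_below_power
    requires. *)
Lemma solution_of_small_integral : {ae mu, forall x : R, x \in `]a, b[ -> c x = 0} ->
  (1 - p) * calM a b x0 x1 b0 m < L -> exists u : R -> R, is_solution a b b0 c m p u.
Proof.
move=> c0; set M := calM a b x0 x1 b0 m => ML.
have ax1 := le_trans ax0 (ltW x01); have x0b := le_trans (ltW x01) x1b.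
have x1ab : x1 \in `[a, b] by rewrite in_itv /= ax1.
have aab : a \in `[a, b] by rewrite in_itv /= lexx ltW.
have bab : b \in `[a, b] by rewrite in_itv /= lexx ltW.
have x0ab : x0 \in `[a, b] by rewrite in_itv /= ax0.
have q0 : 0 < 1 - p by rewrite subr_gt0.
have max_ge (s t : R) : s <= Num.max s t /\ t <= Num.max s t.
  by split; rewrite le_max lexx ?orbT.
have [JRM JLM] : JR x0 <= M /\ JL x1 <= M.
  by have := max_ge (JR x0) (JL x1); rewrite -calME.
have M0 : 0 <= M := le_trans (JL_ge0 x1ab) JLM.
have L0 : 0 < L by apply: le_lt_trans ML; rewrite mulr_ge0// ltW.
have Sb0 : 0 < S b by exact: (scale_b_gt0 ab hS).
have C00 : {ae mu, forall y, y \in `]a, b[ -> C y = 0}.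
  by apply: (ae_imp2 c0 bounded_rep_ae) => y h1 h2 yab; rewrite /C /killing h2// h1// mulr0.
(* eta E is the slack in the hypothesis; the 1 in E keeps the inequality in small
   strict. *)
pose E := (1 - p) * M + S b + 1.
have E0 : 0 < E by rewrite ltr_wpDl// addr_ge0 ?mulr_ge0// ltW.
pose eta := (L - (1 - p) * M) / E.
have eta0 : 0 < eta by rewrite divr_gt0// subr_gt0.
have etaE : eta * ((1 - p) * M + S b) = L - (1 - p) * M - eta.
  rewrite -[L - _](@divfK _ E) ?gt_eqF// -/eta /E; ring.
pose th := (1 - p) * (1 + eta).
have th0 : 0 < th by rewrite mulr_gt0// addr_gt0.
have small t s : t <= M -> s <= S b -> th * t + eta * s < L.
  move=> tM sS; apply: (@le_lt_trans _ _ (th * M + eta * S b)).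
    by apply: lerD; rewrite ler_wpM2l// ltW.
  have -> : th * M + eta * S b = (1 - p) * M + eta * ((1 - p) * M + S b) by rewrite /th; ring.
  by rewrite etaE; lra.
have pow_lt t : 0 <= t -> t < L -> t `^ k < L `^ k.
  by move=> t0 tL; apply: gt0_ltr_powR => //; rewrite nnegrE// ltW.
pose cl := clamp a b.
have clE x : x \in `[a, b] -> cl x = x by exact: clamp_id.
have cl_itv x : cl x \in `[a, b] by apply: clamp_itv; exact: ltW.
pose VL x := th * JL x + eta * S x; pose VR x := th * JR x + eta * (S b - S x).
pose wL x := VL (cl x); pose wR x := VR (cl x).
have cVL : {within `[a, b], continuous VL}.
  have cS : {within `[a, b], continuous S} := continuous_subspaceT (scale_continuous hS).
  by move=> x; apply: cvgD; apply: cvgM; [exact: cvg_cst|exact: JL_continuous|exact: cvg_cst|exact: cS].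
have cVR : {within `[a, b], continuous VR}.
  have cS : {within `[a, b], continuous S} := continuous_subspaceT (scale_continuous hS).
  apply: (@subspace_eq_continuous _ _ _ (fun x => th * (segint a b (fun y => S y * N y)
      - segint a b N * S x + JL x) + eta * (S b - S x))).
    by move=> x; rewrite inE => xab; congr (th * _ + _); exact/esym/JRE.
  move=> x; apply: cvgD; (apply: cvgM; first exact: cvg_cst); last first.
    by apply: cvgB; [exact: cvg_cst|exact: cS].
  apply: cvgD; last exact: JL_continuous.
  by apply: cvgB; [exact: cvg_cst|apply: cvgM; [exact: cvg_cst|exact: cS]].
have cwL : continuous wL by apply: clamp_continuous => //; exact: ltW.
have cwR : continuous wR by apply: clamp_continuous => //; exact: ltW.
have SL0 x : 0 <= S x by case/andP: (scale_itv ab hS x).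
have SR0 x : 0 <= S b - S x by rewrite subr_ge0; case/andP: (scale_itv ab hS x).
have wL_ge x : eta * S (cl x) <= wL x by rewrite /wL /VL lerDr mulr_ge0 ?(ltW th0) ?JL_ge0.
have wR_ge x : eta * (S b - S (cl x)) <= wR x.
  by rewrite /wR /VR lerDr mulr_ge0 ?(ltW th0) ?JR_ge0.
have wL0 x : 0 <= wL x by apply: le_trans (wL_ge x); rewrite mulr_ge0// ltW.
have wR0 x : 0 <= wR x by apply: le_trans (wR_ge x); rewrite mulr_ge0// ltW.
have itvc x : a < x -> x < b -> x \in `[a, b] by move=> ax xb; rewrite in_itv /= !ltW.
have wL_gt x : a < x -> x < b -> 0 < wL x.
  move=> ax xb; apply: lt_le_trans (wL_ge x); rewrite clE ?itvc// mulr_gt0//.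
  by rewrite S_gt0// ltW.
have wR_gt x : a < x -> x < b -> 0 < wR x.
  move=> ax xb; apply: lt_le_trans (wR_ge x); rewrite clE ?itvc// mulr_gt0//.
  by rewrite subr_gt0 S_lt// ltW.
have JL_a : JL a = 0 by rewrite /JL segint_xx.
have rL : represents S wL (fun y => - th * N y) a b.
  exists eta => x xab; rewrite /wL (clE _ xab) (clE _ aab) /VL JL_a (scale_a hS).
  have := xab; rewrite in_itv /= => /andP[ax xb].
  have -> : segint a x (fun y => (S x - S y) * (- th * N y)) = - th * JL x.
    rewrite -(segintZ (- th) (kSN (S x) (lexx a) xb)).
    by apply: eq_segint => y _; rewrite mulrCA.
  by ring.
have rR : represents S wR (fun y => - th * N y) a b.
  exists (- (th * segint a b N + eta)) => x xab.
  rewrite /wR (clE _ xab) (clE _ aab) /VR (JRE xab) (JRE aab).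
  rewrite JL_a (scale_a hS).
  have := xab; rewrite in_itv /= => /andP[ax xb].
  have -> : segint a x (fun y => (S x - S y) * (- th * N y)) = - th * JL x.
    rewrite -(segintZ (- th) (kSN (S x) (lexx a) xb)).
    by apply: eq_segint => y _; rewrite mulrCA.
  by ring.
have cpow (w : R -> R) : continuous w -> (forall y, 0 <= w y) -> continuous (fun y : R => w y `^ k).
  move=> cw w0; have := @power_continuous k 1 w k0 cw w0.
  have -> // : (fun y : R => 1 * w y `^ k) = (fun y : R => w y `^ k).
  by apply/funext => y; rewrite mul1r.
have JL_le x : a <= x -> x <= x1 -> JL x <= JL x1.
  move=> ax xx; have xb := le_trans xx x1b.
  apply: (@le_trans _ _ (segint a x (fun y => (S x1 - S y) * N y))).
    apply: segint_le; [exact: kSN|exact: kSN|move=> y _].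
    by rewrite ler_wpM2r// lerD2r (scale_le hS).
  apply: segint_subset_le => //; last exact: kSN.
  move=> y; rewrite in_itv /= => /andP[ay yx].
  by rewrite mulr_ge0// subr_ge0 (scale_le hS).
have JR_le x : x0 <= x -> x <= b -> JR x <= JR x0.
  move=> xx xb; have ax := le_trans ax0 xx.
  apply: (@le_trans _ _ (segint x b (fun y => (S y - S x0) * N y))).
    apply: segint_le; [exact: SkN|exact: SkN|move=> y _].
    by rewrite ler_wpM2r// lerD2l lerN2 (scale_le hS).
  apply: segint_subset_le => //; last exact: SkN.
  move=> y; rewrite in_itv /= => /andP[ay yx].
  by rewrite mulr_ge0// subr_ge0 (scale_le hS).
have x0x1 y : y \in `]x0, x1[ -> [/\ a < y, y < b, x0 <= y & y <= x1].
  rewrite in_itv /= => /andP[h1 h2]; split; rewrite ?ltW//.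
    exact: le_lt_trans h1.
  exact: lt_le_trans x1b.
apply: (@solution_of_barriers (fun y => wL y `^ k) (fun y => wR y `^ k)) => //.
- exact: cpow.
- exact: cpow.
- by move=> y; exact: powR_ge0.
- by move=> y; exact: powR_ge0.
- rewrite /wL (clE _ aab) /VL JL_a (scale_a hS) !mulr0 addr0 powR0//.
  by rewrite gt_eqF.
- rewrite /wR (clE _ bab) /VR /JR segint_xx subrr !mulr0 addr0 powR0//.
  by rewrite gt_eqF.
- by move=> y ay yx; rewrite powR_gt0// wL_gt// (lt_le_trans yx).
- by move=> y xy yb; rewrite powR_gt0// wR_gt// (le_lt_trans ax0).
- move=> y /x0x1[ay yb xy yx]; apply: pow_lt => //; rewrite /wL clE ?itvc//.
  apply: small; first by apply: le_trans JLM; apply: JL_le => //; exact: ltW.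
  by case/andP: (scale_itv ab hS y).
- move=> y /x0x1[ay yb xy yx]; apply: pow_lt => //; rewrite /wR clE ?itvc//.
  apply: small; first by apply: le_trans JRM; apply: JR_le => //; exact: ltW.
  by rewrite gerBl.
- move=> x ax xx1; have xb := lt_le_trans xx1 x1b.
  apply: (touched_below_power ab hS p01 P0 N0 Ni _ eta0 _ _ _ rL C00) => //.
  + by rewrite in_itv /= ax.
  + exact: continuous_subspaceT.
  + exact: wL_gt.
- move=> x xx xb; have ax := le_lt_trans ax0 xx.
  apply: (touched_below_power ab hS p01 P0 N0 Ni _ eta0 _ _ _ rR C00) => //.
  + by rewrite in_itv /= ax.
  + exact: continuous_subspaceT.
  + exact: wR_gt.
Qed.

End Problem.

Theorem theorem3p5 (R : realType) (alpha beta p x0 x1 : R) (b c m : R -> R)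
    (hab : alpha < beta)
    (hp : 0 < p < 1)
    (hb : {within `[alpha, beta], continuous b})
    (hc : inLp +oo%E `]alpha, beta[ c)
    (hc0 : {ae @lebesgue_measure R, forall x : R,
              x \in `]alpha, beta[ -> 0 <= c x})
    (hm : inLp 2%:E `]alpha, beta[ m)
    (hsign : changes_sign alpha beta m)
    (hx0 : alpha <= x0) (hx01 : x0 < x1) (hx1 : x1 <= beta)
    (hmI : {ae @lebesgue_measure R, forall x : R,
              x \in `]x0, x1[ -> 0 <= m x})
    (hmI0 : ~ {ae @lebesgue_measure R, forall x : R,
              x \in `]x0, x1[ -> m x = 0}) :
  (let K := (gammab alpha beta x0 x1 b *
             Lpnorm +oo%E `]alpha, beta[ (Bunder alpha b)) ^+ 2 in
   inLp +oo%E `]alpha, beta[ m^\- ->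
   0 < K / (Cp p - Lpnorm +oo%E `]alpha, beta[ c * K) *
       Lpnorm +oo%E `]alpha, beta[ m^\- <= (lambda1 x0 x1 b c m)^-1 ->
   exists u : R -> R, is_solution alpha beta b c m p u)
  /\
  ({ae @lebesgue_measure R, forall x : R, x \in `]alpha, beta[ -> c x = 0} ->
   (1 - p) * calM alpha beta x0 x1 b m < (lambda1 x0 x1 b c m)^-1 ->
   exists u : R -> R, is_solution alpha beta b c m p u).

Proof.
split=> [K|].
- exact: (solution_of_small_norm hab hp hb hc hc0 hm hx0 hx01 hx1 hmI).
- exact: (solution_of_small_integral hab hp hb hc hc0 hm hx0 hx01 hx1 hmI).
Qed.
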